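(* The $S$-spectrum of the quaternionic nabla operator $\nabla=e_1\partial_{x_1}+e_2\partial_{x_2}+e_3\partial_{x_3}$ as an operator on $L^2(\mathbb{R}^3,\mathbb{H})$ is $$\sigma_S(\nabla)=\mathbb{R}.$$
   Context: $\mathbb{H}$ denotes the quaternions with standard imaginary units $e_1,e_2,e_3$ ($e_i^2=-1$, $e_ie_j=-e_je_i$ for $i\ne j$, $e_3=e_1e_2$). $L^2(\mathbb{R}^3,\mathbb{H})$ is the quaternionic right Hilbert space of square-integrable $\mathbb{H}$-valued functions on $\mathbb{R}^3$ with scalar product $\langle w,v\rangle=\int_{\mathbb{R}^3}\overline{w(x)}v(x)\,dx$. The operator $\nabla v=e_1\partial_{x_1}v+e_2\partial_{x_2}v+e_3\partial_{x_3}v$ is the closed right-linear operator with domain $\{v\in L^2(\mathbb{R}^3,\mathbb{H}):\ |\xi|\widehat{v}(\xi)\in L^2\}$, i.e. the Sobolev space $H^1(\mathbb{R}^3,\mathbb{H})$ (derivatives in the weak sense). For a closed right-linear operator $T$ on a quaternionic (right) Banach space $V$ let $\mathcal{Q}_s(T)=T^2-2\mathrm{Re}(s)T+|s|^2\mathcal{I}$ for $s\in\mathbb{H}$ with domain $\mathcal{D}(T^2)$. The $S$-resolvent set is $\rho_S(T)=\{s\in\mathbb{H}:\mathcal{Q}_s(T)^{-1}\text{ exists as a bounded right-linear operator on }V\}$ and the $S$-spectrum is $\sigma_S(T)=\mathbb{H}\setminus\rho_S(T)$. *)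

(* Defs.v *)
From HB Require Import structures.
From mathcomp Require Import all_boot all_order all_algebra ring_quotient.
From mathcomp Require Import ring lra.
From mathcomp Require Import all_classical all_reals all_analysis.

Set Implicit Arguments.
Unset Strict Implicit.
Unset Printing Implicit Defensive.
Import Order.TTheory GRing.Theory Num.Theory.
Import numFieldNormedType.Exports.

Local Open Scope classical_set_scope.
Local Open Scope ring_scope.

Lemma sqrt_discr_le (R : realType) (a b c : R) : 0 <= a -> 0 <= c ->
  (forall t, 0 <= a + 2 * t * b + t ^+ 2 * c) ->
  Num.sqrt (a + 2 * b + c) <= Num.sqrt a + Num.sqrt c.
Proof.
move=> a0 c0 H.
have b2 : b ^+ 2 <= a * c.
  have [c00|cn0] := eqVneq c 0.
    have [->|bn0] := eqVneq b 0; first by rewrite expr0n mulr_ge0.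
    have := H (- (a + 1) / (2 * b)).
    rewrite c00 mulr0 addr0 (_ : a + _ = -1); last by field.
    by rewrite lerNr oppr0 ler10.
  have cp : 0 < c by rewrite lt_neqAle eq_sym cn0.
  have := H (- b / c).
  rewrite (_ : a + _ + _ = (a * c - b ^+ 2) / c); last by field.
  by rewrite pmulr_lge0 ?invr_gt0// subr_ge0.
have sa := sqr_sqrtr a0; have sc := sqr_sqrtr c0.
have bs : b <= Num.sqrt a * Num.sqrt c.
  rewrite -sqrtrM// (le_trans (ler_norm _))// -sqrtr_sqr ler_wsqrtr//.
have s0 : 0 <= Num.sqrt a + Num.sqrt c by rewrite addr_ge0 ?sqrtr_ge0.
rewrite -(ger0_norm s0) -sqrtr_sqr ler_wsqrtr// sqrrD sa sc mulr2n.
lra.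
Qed.

Record quat (R : Type) := Quat {qre : R; qim1 : R; qim2 : R; qim3 : R}.
Arguments Quat {R}.
Arguments qre {R}.
Arguments qim1 {R}.
Arguments qim2 {R}.
Arguments qim3 {R}.

Section quaternions.
Variable R : realType.
Notation H := (quat R).
Implicit Types p q r : H.

Definition quat_tuple q := (qre q, qim1 q, qim2 q, qim3 q).
Definition tuple_quat (t : R * R * R * R) :=
  let: (a, b, c, d) := t in Quat a b c d.
Lemma quat_tupleK : cancel quat_tuple tuple_quat.
Proof. by case. Qed.

HB.instance Definition _ := Choice.copy (quat R) (can_type quat_tupleK).

Lemma quatP p q : qre p = qre q -> qim1 p = qim1 q -> qim2 p = qim2 q ->
  qim3 p = qim3 q -> p = q.
Proof. by case: p q => ? ? ? ? [? ? ? ?] /= -> -> -> ->. Qed.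

Definition addq p q :=
  Quat (qre p + qre q) (qim1 p + qim1 q) (qim2 p + qim2 q) (qim3 p + qim3 q).
Definition oppq p := Quat (- qre p) (- qim1 p) (- qim2 p) (- qim3 p).
Definition mulq p q :=
  Quat (qre p * qre q - qim1 p * qim1 q - qim2 p * qim2 q - qim3 p * qim3 q)
       (qre p * qim1 q + qim1 p * qre q + qim2 p * qim3 q - qim3 p * qim2 q)
       (qre p * qim2 q - qim1 p * qim3 q + qim2 p * qre q + qim3 p * qim1 q)
       (qre p * qim3 q + qim1 p * qim2 q - qim2 p * qim1 q + qim3 p * qre q).

Fact addqA : associative addq.
Proof. by move=> p q r; apply: quatP; rewrite /= addrA. Qed.
Fact addqC : commutative addq.
Proof. by move=> p q; apply: quatP; rewrite /= addrC. Qed.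
Fact add0q : left_id (Quat 0 0 0 0) addq.
Proof. by move=> p; apply: quatP; rewrite /= add0r. Qed.
Fact addNq : left_inverse (Quat 0 0 0 0) oppq addq.
Proof. by move=> p; apply: quatP; rewrite /= addNr. Qed.

HB.instance Definition _ := GRing.isZmodule.Build (quat R) addqA addqC add0q addNq.

Fact mulqA : associative mulq.
Proof. by move=> p q r; apply: quatP => /=; ring. Qed.
Fact mul1q : left_id (Quat 1 0 0 0) mulq.
Proof. by move=> q; apply: quatP => /=; ring. Qed.
Fact mulq1 : right_id (Quat 1 0 0 0) mulq.
Proof. by move=> q; apply: quatP => /=; ring. Qed.
Fact mulqDl : left_distributive mulq addq.
Proof. by move=> p q r; apply: quatP => /=; ring. Qed.
Fact mulqDr : right_distributive mulq addq.
Proof. by move=> p q r; apply: quatP => /=; ring. Qed.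
Fact oneq_neq0 : Quat 1 0 0 0 != 0 :> H.
Proof. by apply/eqP => -[] /eqP; rewrite oner_eq0. Qed.

HB.instance Definition _ :=
  GRing.Zmodule_isNzRing.Build (quat R) mulqA mul1q mulq1 mulqDl mulqDr oneq_neq0.

Definition scaleq (t : R) q := Quat (t * qre q) (t * qim1 q) (t * qim2 q) (t * qim3 q).

Fact scaleqA s t q : scaleq s (scaleq t q) = scaleq (s * t) q.
Proof. by apply: quatP; rewrite /= mulrA. Qed.
Fact scale1q : left_id 1 scaleq.
Proof. by move=> q; apply: quatP; rewrite /= mul1r. Qed.
Fact scaleqDr : right_distributive scaleq +%R.
Proof. by move=> t p q; apply: quatP; rewrite /= mulrDr. Qed.
Fact scaleqDl q : {morph scaleq^~ q : s t / s + t}.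
Proof. by move=> s t; apply: quatP; rewrite /= mulrDl. Qed.

HB.instance Definition _ :=
  GRing.Zmodule_isLmodule.Build R (quat R) scaleqA scale1q scaleqDr scaleqDl.

Fact scaleqAl t p q : t *: (p * q) = t *: p * q.
Proof. by apply: quatP => /=; ring. Qed.

HB.instance Definition _ := GRing.Lmodule_isLalgebra.Build R (quat R) scaleqAl.

Definition conjq q := Quat (qre q) (- qim1 q) (- qim2 q) (- qim3 q).

Definition normq q : R :=
  Num.sqrt (qre q ^+ 2 + qim1 q ^+ 2 + qim2 q ^+ 2 + qim3 q ^+ 2).

Definition qdot p q :=
  qre p * qre q + qim1 p * qim1 q + qim2 p * qim2 q + qim3 p * qim3 q.

Lemma qre_conjM p q : qre (conjq p * q) = qdot p q.
Proof. by rewrite /qdot /=; ring. Qed.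

Lemma qdot_ge0 q : 0 <= qdot q q.
Proof. by rewrite /qdot -!expr2 !addr_ge0 ?sqr_ge0. Qed.

Lemma qdot_eq0 q : qdot q q = 0 -> q = 0.
Proof.
case: q => a b c d; rewrite /qdot /= -!expr2 => /eqP.
rewrite !paddr_eq0 ?addr_ge0 ?sqr_ge0// !sqrf_eq0.
by move=> /andP[/andP[/andP[/eqP-> /eqP->] /eqP->] /eqP->].
Qed.

Lemma normqE q : normq q = Num.sqrt (qdot q q).
Proof. by rewrite /normq /qdot -!expr2. Qed.

Lemma qdotDtE p q t :
  qdot (p + t *: q) (p + t *: q) = qdot p p + 2 * t * qdot p q + t ^+ 2 * qdot q q.
Proof. by rewrite /qdot /=; ring. Qed.

Fact ler_normqD p q : normq (p + q) <= normq p + normq q.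
Proof.
rewrite !normqE; apply: le_trans (sqrt_discr_le (b := qdot p q) _ _ _).
- by rewrite -{1 2}[q]scale1r qdotDtE expr1n mulr1 mul1r.
- exact: qdot_ge0.
- exact: qdot_ge0.
- by move=> t; rewrite -qdotDtE qdot_ge0.
Qed.

Fact normq_eq0 q : normq q = 0 -> q = 0.
Proof.
rewrite normqE => /eqP; rewrite sqrtr_eq0 => q0.
by apply: qdot_eq0; apply/le_anti; rewrite q0 qdot_ge0.
Qed.

Lemma normqM p q : normq (p * q) = normq p * normq q.
Proof.
rewrite !normqE -sqrtrM ?qdot_ge0//; congr Num.sqrt.
by rewrite /qdot /=; ring.
Qed.

Lemma normqZ t q : normq (t *: q) = `|t| * normq q.
Proof.
rewrite !normqE -sqrtr_sqr -sqrtrM ?sqr_ge0//; congr Num.sqrt.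
by rewrite /qdot /=; ring.
Qed.

Fact normqMn q n : normq (q *+ n) = normq q *+ n.
Proof. by rewrite -scaler_nat normqZ normr_nat mulr_natl. Qed.

Fact normqN q : normq (- q) = normq q.
Proof. by rewrite -scaleN1r normqZ normrN normr1 mul1r. Qed.

HB.instance Definition _ :=
  Num.Zmodule_isNormed.Build R (quat R) ler_normqD normq_eq0 normqMn normqN.

End quaternions.

Definition e1 {R : realType} : quat R := Quat 0 1 0 0.
Definition e2 {R : realType} : quat R := Quat 0 0 1 0.
Definition e3 {R : realType} : quat R := Quat 0 0 0 1.

Lemma mul_e1e2 (R : realType) : e1 * e2 = e3 :> quat R.
Proof. by apply: quatP => /=; ring. Qed.

(* A right H-module is a left module over the converse ring H^c, in which
   [a * b] is the product [b a] of H: [a *: v] is the right multiple [v a], and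
   [{linear V -> W}] is the type of right-linear maps. Completeness of the norm
   plays no role in the definition of the S-spectrum, so it is not required. *)
HB.mixin Record isRightQuatNormed (R : realType) V of GRing.Lmodule (quat R)^c V := {
  qnorm : V -> R;
  ler_qnormD : forall u v, qnorm (u + v) <= qnorm u + qnorm v;
  qnorm0_eq0 : forall v, qnorm v = 0 -> v = 0;
  qnorm_rscale : forall (a : quat R) (v : V), qnorm ((a : (quat R)^c) *: v) = qnorm v * `|a|
}.

#[short(type="rightQuatNormedType")]
HB.structure Definition RightQuatNormed (R : realType) :=
  {V of isRightQuatNormed R V & GRing.Lmodule (quat R)^c V}.

Definition rscale (R : realType) (V : lmodType (quat R)^c) (v : V) (a : quat R) : V :=
  (a : (quat R)^c) *: v.
Notation "v <* a" := (rscale v a) (at level 40, left associativity) : ring_scope.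

(* [papp] is only meaningful on [pdom]. *)
Record partial_op (V : Type) := PartialOp {pdom : set V; papp : V -> V}.

Section S_spectrum.
Variables (R : realType) (V : rightQuatNormedType R).
Implicit Types (T : partial_op V) (s : quat R).

Definition Qs T s : partial_op V := {|
  pdom := [set v | pdom T v /\ pdom T (papp T v)];
  papp := fun v => papp T (papp T v) - papp T v <* (2 * qre s)%:A + v <* (`|s| ^+ 2)%:A
|}.

Definition qbounded (B : V -> V) := exists C, forall v, qnorm (B v) <= C * qnorm v.

Definition inverse_of T (B : V -> V) :=
  (forall w, pdom T (B w) /\ papp T (B w) = w) /\
  (forall v, pdom T v -> B (papp T v) = v).

Definition rho_S T : set (quat R) :=
  [set s | exists B : {linear V -> V}, qbounded B /\ inverse_of (Qs T s) B].

Definition sigma_S T : set (quat R) := ~` rho_S T.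

End S_spectrum.

Section L2.
Context d (X : measurableType d) (R : realType) (mu : {measure set X -> \bar R}).
Notation H := (quat R).
Implicit Types f g : X -> H.

Definition qL2 : {pred X -> H} := fun f =>
  [&& qre \o f \in Lfun mu 2%:E, qim1 \o f \in Lfun mu 2%:E,
      qim2 \o f \in Lfun mu 2%:E & qim3 \o f \in Lfun mu 2%:E].

Let L2comb (t : R) (u v : X -> R) : u \in Lfun mu 2%:E -> v \in Lfun mu 2%:E ->
  (fun x => t * u x + v x) \in Lfun mu 2%:E.
Proof. exact: (Lfun_submod_closed mu (lee1n 2)).2. Qed.

Let L20 : (fun=> 0) \in Lfun mu 2%:E.
Proof. exact: (Lfun_submod_closed mu (lee1n 2)).1. Qed.

Let L2scale (t : R) (u : X -> R) : u \in Lfun mu 2%:E -> (fun x => t * u x) \in Lfun mu 2%:E.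
Proof.
move=> /(L2comb t)/(_ L20).
by under [X in X \in _]eq_fun do rewrite addr0.
Qed.

Let L2add (u v : X -> R) : u \in Lfun mu 2%:E -> v \in Lfun mu 2%:E ->
  (fun x => u x + v x) \in Lfun mu 2%:E.
Proof.
move=> /(L2comb 1) h /h.
by under [X in X \in _ -> _]eq_fun do rewrite mul1r.
Qed.

Let L2sub (u v : X -> R) : u \in Lfun mu 2%:E -> v \in Lfun mu 2%:E ->
  (fun x => u x - v x) \in Lfun mu 2%:E.
Proof.
move=> hu /(L2comb (-1))/(_ hu).
by under [X in X \in _ -> _]eq_fun do rewrite mulN1r addrC.
Qed.

Lemma qL2_zmod_closed : zmod_closed qL2.
Proof.
split; first by apply/and4P; split; exact: L20.
by move=> f g /and4P[? ? ? ?] /and4P[? ? ? ?]; apply/and4P; split; exact: L2sub.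
Qed.

HB.instance Definition _ := GRing.isZmodClosed.Build (X -> H) qL2 qL2_zmod_closed.

Lemma qL2_mull a f : f \in qL2 -> (fun x => a * f x) \in qL2.
Proof.
by move=> /and4P[? ? ? ?]; apply/and4P; split;
  rewrite /comp /=; do ?[apply: L2sub|apply: L2add]; apply: L2scale.
Qed.

Lemma qL2_mulr a f : f \in qL2 -> (fun x => f x * a) \in qL2.
Proof.
move=> /and4P[? ? ? ?]; apply/and4P; split;
  rewrite /comp /=; do ?[apply: L2sub|apply: L2add];
  under eq_fun do rewrite mulrC; exact: L2scale.
Qed.

(* Square-integrable functions, before identification of a.e. equal ones. *)
Record L2fun := MkL2fun {L2fun_val :> X -> H; _ : L2fun_val \in qL2}.

HB.instance Definition _ := [isSub for L2fun_val].
HB.instance Definition _ := [Choice of L2fun by <:].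
HB.instance Definition _ := [SubChoice_isSubZmodule of L2fun by <:].

Definition L2null : {pred L2fun} := fun u => `[< \forall x \ae mu, u x = 0 >].

Lemma L2null_zmod_closed : zmod_closed L2null.
Proof.
split; first by apply/asboolP/aeW.
move=> u v /asboolP u0 /asboolP v0; apply/asboolP.
by apply: filterS2 u0 v0 => x /= u0 v0; rewrite [LHS](_ : _ = u x - v x)// u0 v0 subr0.
Qed.

HB.instance Definition _ := GRing.isZmodClosed.Build L2fun L2null L2null_zmod_closed.

Definition L2 : Type := Quotient.quot L2null.
HB.instance Definition _ := GRing.Zmodule.on L2.

Local Open Scope quotient_scope.

Lemma L2_piP (u v : L2fun) : \pi_L2 u = \pi_L2 v <-> \forall x \ae mu, u x = v x.
Proof.
split=> [/eqP|uv].
  rewrite -[_ == _]/(u == v %[mod Quotient.quot L2null]) -Quotient.idealrBE.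
  by move=> /asboolP; apply: filterS => x /= /eqP; rewrite subr_eq0 => /eqP.
apply/eqP; rewrite -[_ == _]/(u == v %[mod Quotient.quot L2null]) -Quotient.idealrBE.
by apply/asboolP; apply: filterS uv => x /= /eqP; rewrite -subr_eq0 => /eqP.
Qed.

Definition L2_fun (v : L2) : X -> H := repr v : L2fun.
Coercion L2_fun : L2 >-> Funclass.

Lemma L2_funP (v : L2) : (v : X -> H) \in qL2.
Proof. by rewrite /L2_fun; case: (repr v). Qed.

Definition L2_class f (fL2 : f \in qL2) : L2 := \pi_L2 (MkL2fun fL2).

Lemma L2_classE f (fL2 : f \in qL2) : \forall x \ae mu, L2_class fL2 x = f x.
Proof. by apply/(L2_piP (repr (L2_class fL2)) (MkL2fun fL2)); rewrite reprK. Qed.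

Lemma L2_eqP (v w : L2) : (\forall x \ae mu, v x = w x) -> v = w.
Proof. by move=> vw; rewrite -[v]reprK -[w]reprK; exact/L2_piP. Qed.

Lemma L2_addE (v w : L2) : \forall x \ae mu, (v + w : L2) x = v x + w x.
Proof.
apply/(L2_piP (repr (v + w)) (repr v + repr w)).
rewrite reprK; have /= -> := raddfD (\pi_(Quotient.quot L2null)) (repr v) (repr w).
by rewrite !reprK.
Qed.

Let aeI (P Q : X -> Prop) : (\forall x \ae mu, P x) -> (\forall x \ae mu, Q x) ->
  \forall x \ae mu, P x /\ Q x.
Proof. exact: filterI. Qed.

Definition L2_lmul (a : H) (v : L2) : L2 := L2_class (qL2_mull a (L2_funP v)).

Lemma L2_lmulE a v : \forall x \ae mu, L2_lmul a v x = a * v x.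
Proof. exact: L2_classE. Qed.

Definition L2_rmul (a : H^c) (v : L2) : L2 := L2_class (qL2_mulr (a : H) (L2_funP v)).

Lemma L2_rmulE (a : H) v : \forall x \ae mu, L2_rmul a v x = v x * a.
Proof. exact: L2_classE. Qed.

Fact L2_rmulA (a b : H^c) v : L2_rmul a (L2_rmul b v) = L2_rmul (a * b) v.
Proof.
apply: L2_eqP.
have := aeI (L2_rmulE a (L2_rmul b v)) (aeI (L2_rmulE b v) (L2_rmulE (a * b : H^c) v)).
by apply: filterS => x [-> [-> ->]]; rewrite -mulrA.
Qed.

Fact L2_rmul1 : left_id (1 : H^c) L2_rmul.
Proof. by move=> v; apply: L2_eqP; apply: filterS (L2_rmulE 1 v) => x ->; rewrite mulr1. Qed.

Fact L2_rmulDr : right_distributive L2_rmul +%R.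
Proof.
move=> a v w; apply: L2_eqP.
have := aeI (aeI (L2_rmulE a v) (L2_rmulE a w)) (aeI (L2_rmulE a (v + w))
  (aeI (L2_addE v w) (L2_addE (L2_rmul a v) (L2_rmul a w)))).
by apply: filterS => x [[ev ew] [evw [e ->]]]; rewrite evw e ev ew mulrDl.
Qed.

Fact L2_rmulDl v : {morph L2_rmul^~ v : a b / a + b}.
Proof.
move=> a b; apply: L2_eqP.
have := aeI (L2_rmulE a v) (aeI (L2_rmulE b v) (aeI (L2_rmulE (a + b) v)
  (L2_addE (L2_rmul a v) (L2_rmul b v)))).
by apply: filterS => x [ea [eb [eab ->]]]; rewrite ea eb eab mulrDr.
Qed.

HB.instance Definition _ :=
  GRing.Zmodule_isLmodule.Build H^c L2 L2_rmulA L2_rmul1 L2_rmulDr L2_rmulDl.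

Definition qintegral (f : X -> H) : H :=
  Quat (\int[mu]_x qre (f x)) (\int[mu]_x qim1 (f x))
       (\int[mu]_x qim2 (f x)) (\int[mu]_x qim3 (f x)).

Definition L2_inner (w v : L2) : H := qintegral (fun x => conjq (w x) * v x).

Definition L2_norm (v : L2) : R := Num.sqrt (qre (L2_inner v v)).

Let idot f g : R := \int[mu]_x qdot (f x) (g x).

Lemma L2_normE v : L2_norm v = Num.sqrt (idot v v).
Proof. by congr Num.sqrt; apply: eq_Rintegral => x _; rewrite qre_conjM. Qed.

Lemma qdot_integrable f g : f \in qL2 -> g \in qL2 ->
  mu.-integrable setT (EFin \o (fun x => qdot (f x) (g x))).
Proof.
move=> /and4P[f0 f1 f2 f3] /and4P[g0 g1 g2 g3].
have h u v : u \in Lfun mu 2%:E -> v \in Lfun mu 2%:E ->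
    mu.-integrable setT (EFin \o (u \* v)).
  by move=> uL vL; apply/Lfun1_integrable/Lfun2_mul_Lfun1.
have D (u v : X -> R) : mu.-integrable setT (EFin \o u) -> mu.-integrable setT (EFin \o v) ->
    mu.-integrable setT (EFin \o (fun x => u x + v x)).
  by move=> iu iv; have := integrableD measurableT iu iv.
apply: (D); last exact: h.
apply: (D); last exact: h.
by apply: (D); exact: h.
Qed.

Lemma eq_idot f g f' g' : f \in qL2 -> g \in qL2 -> f' \in qL2 -> g' \in qL2 ->
  (\forall x \ae mu, f x = f' x) -> (\forall x \ae mu, g x = g' x) ->
  idot f g = idot f' g'.
Proof.
move=> fL gL fL' gL' ff gg; congr fine; apply: ae_eq_integral => //.
- exact: measurable_int (qdot_integrable fL gL).
- exact: measurable_int (qdot_integrable fL' gL').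
- by apply: filterS2 ff gg => x -> ->.
Qed.

Lemma idot_ge0 f : 0 <= idot f f.
Proof. by apply: Rintegral_ge0 => x _; exact: qdot_ge0. Qed.

Fact ler_L2_normD (v w : L2) : L2_norm (v + w) <= L2_norm v + L2_norm w.
Proof.
have vL := L2_funP v; have wL := L2_funP w.
have key t : idot (fun x => v x + t *: w x) (fun x => v x + t *: w x) =
    idot v v + 2 * t * idot v w + t ^+ 2 * idot w w.
  rewrite /idot -!RintegralZl//; last 2 first.
  - exact: qdot_integrable.
  - exact: qdot_integrable.
  have Z c f g : f \in qL2 -> g \in qL2 ->
      mu.-integrable setT (EFin \o (fun x => c * qdot (f x) (g x))).
    by move=> fL gL; have := integrableZl measurableT c (qdot_integrable fL gL).
  have D (f g : X -> R) : mu.-integrable setT (EFin \o f) -> mu.-integrable setT (EFin \o g) ->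
      mu.-integrable setT (EFin \o (fun x => f x + g x)).
    by move=> iu iv; have := integrableD measurableT iu iv.
  rewrite -!RintegralD//; do ?[exact: qdot_integrable|exact: Z|apply: (D)].
  by apply: eq_Rintegral => x _; rewrite qdotDtE.
have -> : L2_norm (v + w) = Num.sqrt (idot v v + 2 * idot v w + idot w w).
  rewrite L2_normE; congr Num.sqrt.
  have := key 1; rewrite expr1n mulr1 mul1r => <-.
  have vwL : (fun x => v x + 1 *: w x) \in qL2.
    under eq_fun do rewrite scale1r.
    exact: rpredD.
  apply: eq_idot => //; try exact: L2_funP.
  + by apply: filterS (L2_addE v w) => x ->; rewrite scale1r.
  + by apply: filterS (L2_addE v w) => x ->; rewrite scale1r.
rewrite !L2_normE; apply: sqrt_discr_le; [exact: idot_ge0..|].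
by move=> t; rewrite -key idot_ge0.
Qed.

Fact L2_norm0_eq0 (v : L2) : L2_norm v = 0 -> v = 0.
Proof.
rewrite L2_normE => /eqP; rewrite sqrtr_eq0 => v0.
have {}v0 : idot v v = 0 by apply/le_anti; rewrite v0 idot_ge0.
have iv := qdot_integrable (L2_funP v) (L2_funP v).
have /(ae_eq_integral_abs _ measurableT (measurable_int _ iv)) : 
   (\int[mu]_x `|(EFin \o (fun x => qdot (v x) (v x))) x| = 0)%E.
  under eq_integral do rewrite gee0_abs ?lee_fin ?qdot_ge0//.
  by rewrite -[LHS]fineK ?(integrable_fin_num _ iv)//; congr EFin.
move=> v0x; rewrite -[v]reprK -[RHS]reprK; apply/L2_piP.
have z : \forall x \ae mu, (0 : L2) x = 0.
  have /= e := raddf0 (\pi_(Quotient.quot L2null)).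
  by apply/(L2_piP (repr (0 : L2)) 0); rewrite reprK.
apply: filterS2 v0x z => x /= /(_ I) [] /qdot_eq0 vx zx.
by rewrite -[LHS]/(v x) -[RHS]/((0 : L2) x) vx zx.
Qed.

Fact L2_norm_rscale (a : H) (v : L2) : L2_norm ((a : H^c) *: v) = L2_norm v * `|a|.
Proof.
rewrite !L2_normE -[`|a|]/(normq a) normqE -sqrtrM ?idot_ge0//; congr Num.sqrt.
have vL := L2_funP v.
rewrite (@eq_idot _ _ (fun x => v x * a) (fun x => v x * a)); try exact: L2_funP.
- rewrite /idot -RintegralZr//; last exact: qdot_integrable.
  by apply: eq_Rintegral => x _; rewrite /qdot /=; ring.
- exact: qL2_mulr.
- exact: qL2_mulr.
- exact: L2_rmulE.
- exact: L2_rmulE.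
Qed.

HB.instance Definition _ :=
  isRightQuatNormed.Build R L2 ler_L2_normD L2_norm0_eq0 L2_norm_rscale.

End L2.

Section nabla.
Variable R : realType.
Implicit Types (phi : R * R * R -> R) (u : R * R * R).

Notation R3 := (measurableTypeR R * measurableTypeR R * measurableTypeR R)%type.

Definition lebesgue3 : {measure set R3 -> \bar R} :=
  ((lebesgue_measure \x lebesgue_measure) \x lebesgue_measure)%E.

Definition b1 : R * R * R := (1, 0, 0).
Definition b2 : R * R * R := (0, 1, 0).
Definition b3 : R * R * R := (0, 0, 1).

Fixpoint Cn (n : nat) phi : Prop :=
  continuous phi /\
  if n is m.+1 then
    forall u, u \in [:: b1; b2; b3] -> (forall x, derivable phi x u) /\ Cn m ('D_u phi)
  else True.

Definition test_function phi :=
  (forall n, Cn n phi) /\ compact (closure [set x | phi x != 0]).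

Definition weak_deriv u (v w : L2 lebesgue3) :=
  forall phi, test_function phi ->
  qintegral lebesgue3 (fun x => 'D_u phi x *: v x) =
  - qintegral lebesgue3 (fun x => phi x *: w x).

Definition has_weak_deriv u (v : L2 lebesgue3) := exists w, weak_deriv u v w.

(* Weak derivatives are unique up to a.e. equality, so on functions which have one this is it. *)
Definition pderiv u (v : L2 lebesgue3) : L2 lebesgue3 :=
  xget 0 [set w | weak_deriv u v w].

Definition sobolevH1 : set (L2 lebesgue3) :=
  [set v | forall u, u \in [:: b1; b2; b3] -> has_weak_deriv u v].

Definition nabla : partial_op (L2 lebesgue3) := {|
  pdom := sobolevH1;
  papp := fun v =>
    L2_lmul e1 (pderiv b1 v) + L2_lmul e2 (pderiv b2 v) + L2_lmul e3 (pderiv b3 v)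
|}.

End nabla.

(* Main.v *)
(* Write Q_s for Q_s(nabla). Both inclusions rest on the symmetry of nabla on H^1, so that
   <Q_s v, v> = |nabla v - Re(s) v|^2 + |Im(s)|^2 |v|^2.

   If Im(s) <> 0, this coercivity gives injectivity of Q_s and the bound of its inverse.
   Surjectivity is obtained without the Fourier transform: let T_n be the sum of the e_i D_i,
   where D_i is the centred difference quotient of step 1/(n+1) in direction i. Since the e_i
   anticommute and the D_i are skew, T_n is bounded, symmetric and |T_n v|^2 is the sum of the
   |D_i v|^2. By the Riesz theorem for the form <Q_s(T_n) u, v> there is v_n with
   Q_s(T_n) v_n = w, and v_n, D_i v_n and D_i T_n v_n are bounded in n. The weak limit of v_n
   along a free ultrafilter solves Q_s v = w.

   If s = r is real, Q_r = A^2 with A = nabla - r symmetric. A bounded inverse B of Q_r would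
   give |A B w|^2 = <w, B w> <= C |w|^2, hence |w|^2 = <A B w, A w> and |w|^2 <= C |A w|^2 for
   all w in H^1. This fails for w = exp(- e1 r x1) eta(x / n) with a cutoff eta, where A w only
   involves the derivatives of eta(x / n), which are O(1/n). *)

From HB Require Import structures.
From mathcomp Require Import all_boot all_order all_algebra.
From mathcomp Require Import ring lra.
From mathcomp Require Import all_classical all_reals all_analysis measurable_realfun.
Require Import Defs.

Set Implicit Arguments.
Unset Strict Implicit.
Unset Printing Implicit Defensive.
Import Order.TTheory GRing.Theory Num.Theory.
Import numFieldNormedType.Exports.
Local Open Scope classical_set_scope.
Local Open Scope ring_scope.

(** * Real Hilbert spaces and weak compactness *)

(** The norm of a difference quotient grows like the inverse of its step, so boundedness of T_n only
    serves to solve the discrete equation for a fixed n. The uniform bounds come from algebra: the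
    square of T_n is minus the sum of the squares of the D_i, so a bound of T_n u controls every D_i
    u. Coercivity bounds v_n and T_n v_n, the equation itself then bounds T_n T_n v_n, and D_i T_n
    v_n follows. Weak limits suffice because the equation is linear and D_i can be moved onto a test
    vector, where it converges in norm. The ultrafilter makes all these bounded sequences converge
    together.

    Symmetry of nabla on H^1 is inherited from the D_i too: on a vector with a weak derivative the
    quotients are bounded by that derivative and converge to it weakly.

    The analysis runs in a real Hilbert space whose product is the real part of the quaternionic
    one; the norm is the same, and compatibility with right multiplication is checked separately on
    weak derivatives.

    In the real case the squared norm of the test vector grows like n^3, the volume of its support,
    and that of its residual like n^3 / n^2. *)

Record hilbert_form (R : realType) (V : lmodType R) (ip : V -> V -> R) : Prop := HilbertForm {
  ipC : forall u v, ip u v = ip v u;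
  ipDl : forall u v w, ip (u + v) w = ip u w + ip v w;
  ipZl : forall a u w, ip (a *: u) w = a * ip u w;
  ip_ge0 : forall u, 0 <= ip u u;
  ip_eq0 : forall u, ip u u = 0 -> u = 0;
  ip_complete : forall u : nat -> V,
    (forall e, 0 < e -> exists N, forall m n, (N <= m)%N -> (N <= n)%N ->
      ip (u m - u n) (u m - u n) < e) ->
    exists l, ip (u n - l) (u n - l) @[n --> \oo] --> (0 : R) }.

Section hilbert.
Context {R : realType} {V : lmodType R} {ip : V -> V -> R}.
Hypothesis hip : hilbert_form ip.
Implicit Types u v w : V.

Lemma ipDr u v w : ip w (u + v) = ip w u + ip w v.
Proof. by rewrite !(ipC hip w) ipDl. Qed.

Lemma ipZr a u w : ip w (a *: u) = a * ip w u.
Proof. by rewrite !(ipC hip w) ipZl. Qed.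

Lemma ipNl u w : ip (- u) w = - ip u w.
Proof. by rewrite -scaleN1r ipZl// mulN1r. Qed.

Lemma ipNr u w : ip w (- u) = - ip w u.
Proof. by rewrite !(ipC hip w) ipNl. Qed.

Lemma ip0l w : ip 0 w = 0.
Proof. by rewrite -(scale0r (0 : V)) ipZl// mul0r. Qed.

Lemma ip0r w : ip w 0 = 0.
Proof. by rewrite ipC// ip0l. Qed.

Definition ipE := (ipDl hip, ipDr, ipZl hip, ipZr, ipNl, ipNr, ip0l, ip0r).

Lemma ip_suml (I : finType) (F : I -> V) w : ip (\sum_i F i) w = \sum_i ip (F i) w.
Proof. by apply: (big_morph (fun u => ip u w)) => [u v|]; rewrite ipE. Qed.

Lemma ip_sumr (I : finType) (F : I -> V) w : ip w (\sum_i F i) = \sum_i ip w (F i).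
Proof. by apply: (big_morph (fun u => ip w u)) => [u v|]; rewrite ipE. Qed.

Lemma cauchy_schwarz u v : ip u v ^+ 2 <= ip u u * ip v v.
Proof.
have [v0|vn0] := eqVneq (ip v v) 0.
  by rewrite (ip_eq0 hip v0) !ipE mulr0 expr0n.
have vp : 0 < ip v v by rewrite lt_neqAle eq_sym vn0 ip_ge0.
have := ip_ge0 hip (u - (ip u v / ip v v) *: v).
rewrite !ipE (ipC hip v u).
rewrite [leRHS](_ : _ = (ip u u * ip v v - ip u v ^+ 2) / ip v v); last by field.
by rewrite pmulr_lge0 ?invr_gt0// subr_ge0.
Qed.

Lemma ipD_le u v : ip (u + v) (u + v) <= 2 * ip u u + 2 * ip v v.
Proof.
have := ip_ge0 hip (u - v); rewrite !ipE (ipC hip v u).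
by move=> ?; lra.
Qed.

Lemma ip_inj u v : (forall w, ip u w = ip v w) -> u = v.
Proof.
move=> uv; apply/eqP; rewrite -subr_eq0; apply/eqP; apply: (ip_eq0 hip).
by rewrite ipDl// ipNl uv subrr.
Qed.

Lemma cvg_ipl (u : nat -> V) l w :
  ip (u n - l) (u n - l) @[n --> \oo] --> (0 : R) -> ip (u n) w @[n --> \oo] --> ip l w.
Proof.
move=> ul; apply/subr_cvg0/norm_cvg0P.
have: (fun n => Num.sqrt (ip (u n - l) (u n - l) * ip w w)) @ \oo --> Num.sqrt (0 * ip w w).
  apply: continuous_cvg; first exact: sqrt_continuous.
  exact: cvgMr_tmp.
rewrite mul0r sqrtr0.
apply: squeeze_cvgr; last exact: cvg_cst.
apply: nearW => n; rewrite normr_ge0/= -sqrtr_sqr ler_wsqrtr//.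
by rewrite -ipNl -ipDl//; exact: cauchy_schwarz.
Qed.

Lemma cvg_ip (u : nat -> V) l :
  ip (u n - l) (u n - l) @[n --> \oo] --> (0 : R) ->
  ip (u n) (u n) @[n --> \oo] --> ip l l.
Proof.
move=> ul.
have -> : (fun n => ip (u n) (u n)) =
    (fun n => ip (u n - l) (u n - l) + (2 * ip (u n) l - ip l l)).
  by apply/funext => n; rewrite !ipE (ipC hip l (u n)); ring.
have : (fun n => ip (u n - l) (u n - l) + (2 * ip (u n) l - ip l l)) @ \oo -->
    0 + (2 * ip l l - ip l l).
  apply: cvgD => //; apply: cvgB; last exact: cvg_cst.
  by apply: cvgMl_tmp; exact: cvg_ipl.
by rewrite (_ : 0 + _ = ip l l)//; ring.
Qed.

Definition is_subspace (M : set V) :=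
  M 0 /\ forall a u v, M u -> M v -> M (a *: u + v).

(* The minimizing sequences of [ip m m - 2 * f m] on [M] converge; [M] need not be closed. *)
Lemma riesz_sub (M : set V) (f : V -> R) (C : R) : is_subspace M ->
  (forall a u v, M u -> M v -> f (a *: u + v) = a * f u + f v) ->
  (forall m, M m -> f m ^+ 2 <= C * ip m m) ->
  exists l, (forall m, M m -> ip l m = f m) /\
    exists2 u : nat -> V, forall n, M (u n) &
      ip (u n - l) (u n - l) @[n --> \oo] --> (0 : R).
Proof.
move=> [M0 ML] fL fC; pose J m := ip m m - 2 * f m.
have f0 : f 0 = 0 by have := fL 1 0 0 M0 M0; rewrite scale1r addr0 mul1r; lra.
have C0 m : M m -> 0 <= C * ip m m by move=> /fC; apply: le_trans; rewrite sqr_ge0.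
have JC m : M m -> - `|C| <= J m.
  move=> Mm; have := fC _ Mm; rewrite /J; have := ip_ge0 hip m.
  move: (ip m m) (f m) => N x N0 xC; have CC := ler_norm C.
  (* By the inequality of the means, [x ^+ 2 <= |C| * N] yields [2 * x <= |C| + N]. *)
  suff : 2 * x <= `|C| + N by lra.
  rewrite leNgt; apply/negP => h.
  have : (`|C| + N) ^+ 2 < (2 * x) ^+ 2.
    by rewrite ltr_pXn2r// nnegrE; [rewrite addr_ge0|apply: ltW; apply: le_lt_trans h; rewrite addr_ge0].
  have : C * N <= `|C| * N by rewrite ler_wpM2r.
  have := sqr_ge0 (`|C| - N).
  by move: xC; rewrite !expr2 => ? ? ? ?; nra.
pose I := inf [set J m | m in M].
have hI : has_inf [set J m | m in M].
  split; first by exists (J 0), 0.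
  by exists (- `|C|) => _ [m Mm <-]; exact: JC.
have IJ m : M m -> I <= J m by move=> Mm; apply: (ge_inf hI.2); exists m.
have /choice[u uP] : forall n, exists m, M m /\ J m < I + n.+1%:R^-1.
  move=> n; have [_ [m Mm <-] Jm] := inf_adherent (ltac:(by []) : 0 < n.+1%:R^-1 :> R) hI.
  by exists m.
have Mu n : M (u n) by case: (uP n).
have uc m n : ip (u m - u n) (u m - u n) <= 2 * (m.+1%:R^-1 + n.+1%:R^-1).
  (* The midpoint of [u m] and [u n] has [J] at least [I], and the parallelogram identity turns this
     into a bound of their distance. The midpoint is spelled in the form [a *: u + v] under which
     [M] is closed. *)
  have /IJ : M ((1/2) *: ((1:R) *: u m + u n) + 0) by apply: (ML) => //; exact: ML.
  rewrite /J fL//; last exact: ML.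
  rewrite fL// f0 !addr0 !ipE.
  have [_] := uP m; have [_] := uP n; rewrite /J (ipC hip (u n) (u m)).
  move: (ip (u m) (u m)) (ip (u m) (u n)) (ip (u n) (u n)) (f (u m)) (f (u n))
    n.+1%:R^-1 m.+1%:R^-1 (I) => a b c d e g h.
  by move=> H1 H2 H3; lra.
have [l ul] : exists l, ip (u n - l) (u n - l) @[n --> \oo] --> (0 : R).
  apply: (ip_complete hip) => e e0.
  have e40 : 0 < e / 4 by rewrite divr_gt0.
  have [N _ hN] := near_infty_natSinv_lt (PosNum e40).
  exists N => m n Nm Nn; apply: le_lt_trans (uc m n) _.
  have /= := hN _ Nm; have /= := hN _ Nn.
  by move: n.+1%:R^-1 m.+1%:R^-1 => x y; lra.
exists l; split; last by exists u.
move=> m Mm.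
have ul2 := cvg_ipl (w := m) ul.
(* Compare [I] with [J (t *: m + u n)] and let [n] grow. This gives the variational inequality at
   [l], although [l] may lie outside [M]. *)
have key t : 0 <= 2 * t * (ip l m - f m) + t ^+ 2 * ip m m.
  have c1 : (2 * t * (ip (u n) m - f m) + t ^+ 2 * ip m m + n.+1%:R^-1) @[n --> \oo] -->
      2 * t * (ip l m - f m) + t ^+ 2 * ip m m + 0.
    apply: cvgD; last exact: cvg_harmonic.
    apply: cvgD; last exact: cvg_cst.
    apply: cvgMl_tmp; apply: cvgB; last exact: cvg_cst.
    exact: ul2.
  rewrite -[leRHS]addr0; apply: (cvgr_to_ge c1) => /=; apply: nearW => n.
  have := IJ _ (ML t _ _ Mm (Mu n)); rewrite /J fL// !ipE.
  have [_] := uP n; rewrite /J (ipC hip m (u n)).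
  move: (ip (u n) (u n)) (ip (u n) m) (ip m m) (f (u n)) (f m) n.+1%:R^-1 (I) => a b c d e g h.
  by rewrite expr2; nra.
apply/eqP; rewrite -subr_eq0; apply/eqP.
move: (ip l m - f m) (ip m m) (ip_ge0 hip m) key => x N N0 key.
(* The minimum over [t] is at [- x / N]; the denominator [N + 1] also covers [N = 0] and still gives
   a negative value unless [x = 0]. *)
have := key (- x / (N + 1)).
have -> : 2 * (- x / (N + 1)) * x + (- x / (N + 1)) ^+ 2 * N =
   - (x ^+ 2 * (N + 2) / (N + 1) ^+ 2).
  by field; rewrite gt_eqF//; lra.
rewrite oppr_ge0 pmulr_lle0; last by rewrite invr_gt0 exprn_gt0//; lra.
rewrite pmulr_lle0; last lra.
by move=> x0; apply/eqP; rewrite -sqrf_eq0; apply/eqP/le_anti; rewrite x0 sqr_ge0.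
Qed.

Lemma riesz (f : V -> R) (C : R) :
  (forall a u v, f (a *: u + v) = a * f u + f v) ->
  (forall m, f m ^+ 2 <= C * ip m m) -> exists l, forall m, ip l m = f m.
Proof.
move=> fL fC; have [||//|l [h _]] := @riesz_sub setT f C; last by exists l => m; exact: h.
  by [].
by move=> *; exact: fL.
Qed.

Definition total_set (M : set V) := forall u, (forall m, M m -> ip u m = 0) -> u = 0.

(** A total subspace is dense: [riesz_sub] applied to [ip u] returns a limit of elements of [M] that
    agrees with [u] against [M], hence equals [u]. The bound is then read off on approximants of [u]
    itself. *)
Lemma total_bound (M : set V) u C : 0 <= C -> is_subspace M -> total_set M ->
  (forall m, M m -> ip u m ^+ 2 <= C * ip m m) -> ip u u <= C.
Proof.
move=> C0 sM tM uC.
have [||l [lu [m Mm ml]]] := @riesz_sub M (ip u) (ip u u) sM.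
- by move=> *; rewrite !ipE.
- by move=> *; exact: cauchy_schwarz.
have {}lu : l = u.
  apply/eqP; rewrite -subr_eq0; apply/eqP/tM => x Mx.
  by rewrite !ipE lu// subrr.
rewrite {}lu in ml.
have c1 := cvg_ipl (w := u) ml; have c2 := cvg_ip ml.
have [->//|un0] := eqVneq (ip u u) 0.
have up : 0 < ip u u by rewrite lt_neqAle eq_sym un0 ip_ge0.
rewrite -(ler_pM2r up).
have c3 : (ip (m n) u * ip (m n) u) @[n --> \oo] --> ip u u * ip u u by exact: cvgM.
have c4 : (C * ip (m n) (m n)) @[n --> \oo] --> C * ip u u by exact: cvgMl_tmp.
apply: (ler_cvg_to c3 c4).
by apply: nearW => n; rewrite (ipC hip _ u) -expr2 uC.
Qed.

End hilbert.

(** * Weak limits of bounded sequences along an ultrafilter *)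

Section bounded_sequences.
Context {R : realType} {V : lmodType R} {ip : V -> V -> R}.
Hypothesis hip : hilbert_form ip.
Implicit Types (u v w l : V) (x y : nat -> V).

Definition bdd x := exists C, forall n, ip (x n) (x n) <= C.

Lemma bddD x y : bdd x -> bdd y -> bdd (fun n => x n + y n).
Proof.
move=> [C xC] [D yD]; exists (2 * C + 2 * D) => n.
apply: le_trans (ipD_le hip _ _) _; have := xC n; have := yD n.
by move=> ? ?; lra.
Qed.

Lemma bddZ a x : bdd x -> bdd (fun n => a *: x n).
Proof.
move=> [C xC]; exists (a ^+ 2 * C) => n.
by rewrite !(ipE hip) mulrA -expr2 ler_wpM2l// sqr_ge0.
Qed.

Lemma bdd_cst u : bdd (fun=> u).
Proof. by exists (ip u u). Qed.

Context {U : set_system nat}.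
Hypothesis UU : UltraFilter U.
Hypothesis Uoo : \oo `<=` U.
Let UP : ProperFilter U := ultra_proper.

Definition wcvg x l := forall w, ip (x n) w @[n --> U] --> ip l w.

Lemma wcvgD x y l l' : wcvg x l -> wcvg y l' -> wcvg (fun n => x n + y n) (l + l').
Proof.
move=> xl yl w; rewrite (ipE hip); under eq_fun do rewrite (ipE hip).
by apply: cvgD; [exact: xl|exact: yl].
Qed.

Lemma wcvgZ a x l : wcvg x l -> wcvg (fun n => a *: x n) (a *: l).
Proof.
move=> xl w; rewrite (ipE hip); under eq_fun do rewrite (ipE hip).
by apply: cvgMl_tmp; exact: xl.
Qed.

Lemma wcvg_sum (I : finType) (x : I -> nat -> V) (l : I -> V) :
  (forall i, wcvg (x i) (l i)) -> wcvg (fun n => \sum_i x i n) (\sum_i l i).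
Proof.
move=> xl w; rewrite (ip_suml hip).
under eq_fun do rewrite (ip_suml hip).
elim: (index_enum I) => [|i r IH].
  by rewrite big_nil; under eq_fun do rewrite big_nil; exact: cvg_cst.
rewrite big_cons (_ : (fun n => _) = (fun n => ip (x i n) w + \sum_(j <- r) ip (x j n) w)).
  by apply: cvgD => //; exact: xl.
by apply/funext => n; rewrite big_cons.
Qed.

Lemma wcvg_adjoint (A B : V -> V) x l : (forall u w, ip (A u) w = ip u (B w)) ->
  wcvg x l -> wcvg (A \o x) (A l).
Proof.
move=> AB xl w; rewrite AB; under eq_fun do rewrite /= AB.
exact: xl.
Qed.

Lemma cvg_U (f : nat -> R) (a : R) : f n @[n --> \oo] --> a -> f n @[n --> U] --> a.
Proof. by move=> fa A /fa /Uoo. Qed.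

Lemma wcvg_cst_unique u l : wcvg (fun=> u) l -> l = u.
Proof.
move=> ul; apply: (ip_inj hip) => w.
exact/esym/(cvg_unique _ (cvg_cst _) (ul w)).
Qed.

Lemma ultra_fmap (T : Type) (f : nat -> T) : UltraFilter (fmap f U).
Proof.
split; first exact: fmap_proper_filter.
move=> G PG fUG; apply/seteqP; split=> // A GA.
have [//|fA] := in_ultra_setVsetC (f @^-1` A) UU.
have /fUG GA' : fmap f U (~` A) by [].
by have := @filterI _ G (@filter_filter _ _ PG) _ _ GA GA'; rewrite setICr => /(@filter_not_empty _ _ PG).
Qed.

Lemma cvg_ultra_segment (f : nat -> R) (a b : R) :
  (forall n, a <= f n <= b) -> exists l : R, f n @[n --> U] --> l.
Proof.
move=> fab; have := @segment_compact R a b; rewrite compact_ultra.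
move=> /(_ (fmap f U) (ultra_fmap f))[|l [_ fl]]; last by exists l.
by apply: nearW => n; rewrite /= in_itv/= fab.
Qed.

(** Along an ultrafilter the bounded real sequences [ip (x n) w] converge for all [w] at once,
    without separability or diagonal extraction. The limit is a bounded linear functional of [w],
    which [riesz] represents. *)
Lemma weak_compact x : bdd x -> exists l, wcvg x l.
Proof.
move=> [C xC].
have bnd w n : ip (x n) w ^+ 2 <= C * ip w w.
  by apply: le_trans (cauchy_schwarz hip _ _) _; rewrite ler_wpM2r// (ip_ge0 hip).
have /choice[f fP] : forall w, exists a : R, ip (x n) w @[n --> U] --> a.
  move=> w; pose K := Num.sqrt (C * ip w w).
  have [|a fa] := cvg_ultra_segment (f := fun n => ip (x n) w) (a := - K) (b := K).
    by move=> n; rewrite -ler_norml -sqrtr_sqr ler_wsqrtr.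
  by exists a.
have [||l fl] := riesz hip (f := f) (C := C).
- move=> a u v; apply: (cvg_unique _ (fP _)) => //.
  have -> : (fun n => ip (x n) (a *: u + v)) = (fun n => a * ip (x n) u + ip (x n) v).
    by apply/funext => n; rewrite !(ipE hip).
  by apply: cvgD; [apply: cvgMl_tmp|]; exact: fP.
- move=> w; have c : ip (x n) w ^+ 2 @[n --> U] --> f w ^+ 2.
    by rewrite expr2; under eq_fun do rewrite expr2; exact: cvgM.
  by apply: (cvgr_to_le c); apply: nearW => n; exact: bnd.
by exists l => w; rewrite fl; exact: fP.
Qed.

(** Split [y n] as [u + (y n - u)]: boundedness of [x] makes the contribution of the second part
    vanish. *)
Lemma wcvg_strong x y l u : bdd x -> wcvg x l ->
  ip (y n - u) (y n - u) @[n --> \oo] --> (0 : R) ->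
  ip (x n) (y n) @[n --> U] --> ip l u.
Proof.
move=> [C xC] xl yu.
have C0 : 0 <= C by apply: le_trans (xC 0); exact: ip_ge0.
under eq_fun => n do rewrite -[y n](subrK u) (ipDr hip) addrC.
rewrite -[ip l u]addr0; apply: cvgD; first exact: xl.
apply/cvg_U/norm_cvg0P.
have: (fun n => Num.sqrt (C * ip (y n - u) (y n - u))) @ \oo --> Num.sqrt (C * 0).
  apply: continuous_cvg; first exact: sqrt_continuous.
  exact: cvgMl_tmp.
rewrite mulr0 sqrtr0; apply: squeeze_cvgr; last exact: cvg_cst.
apply: nearW => n; rewrite normr_ge0/= -sqrtr_sqr ler_wsqrtr//.
apply: le_trans (cauchy_schwarz hip _ _) _.
by rewrite ler_wpM2r// (ip_ge0 hip).
Qed.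

End bounded_sequences.

(** * Abstract Dirac operators *)

(* [E i] stands for left multiplication by [e_i] and [D i] for a difference quotient in
   direction [i]. *)
Record discrete_clifford (R : realType) (V : lmodType R) (ip : V -> V -> R)
    (I : finType) (E D : I -> V -> V) (K : R) : Prop := DiscreteClifford {
  dc_Elin : forall i a u v, E i (a *: u + v) = a *: E i u + E i v;
  dc_Dlin : forall i a u v, D i (a *: u + v) = a *: D i u + D i v;
  dc_Eskew : forall i u v, ip (E i u) v = - ip u (E i v);
  dc_Dskew : forall i u v, ip (D i u) v = - ip u (D i v);
  dc_DD : forall i j u, D i (D j u) = D j (D i u);
  dc_DE : forall i j u, D i (E j u) = E j (D i u);
  dc_EE : forall i j u, E i (E j u) + E j (E i u) = - ((i == j)%:R * 2) *: u;
  dc_Dbnd : forall i u, ip (D i u) (D i u) <= K * ip u u }.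

Section discrete.
Context {R : realType} {V : lmodType R} {ip : V -> V -> R}.
Hypothesis hip : hilbert_form ip.
Context {I : finType} {E D : I -> V -> V} {K : R}.
Hypothesis H : discrete_clifford ip E D K.
Implicit Types u v w : V.

Definition dirac u := \sum_i E i (D i u).

Let D0 i : D i 0 = 0.
Proof. by have := dc_Dlin H i (-1) 0 0; rewrite scaler0 addr0 scaleN1r addNr. Qed.
Let E0 i : E i 0 = 0.
Proof. by have := dc_Elin H i (-1) 0 0; rewrite scaler0 addr0 scaleN1r addNr. Qed.
Let DDE i u v : D i (u + v) = D i u + D i v.
Proof. by have := dc_Dlin H i 1 u v; rewrite !scale1r. Qed.
Let EDE i u v : E i (u + v) = E i u + E i v.
Proof. by have := dc_Elin H i 1 u v; rewrite !scale1r. Qed.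
Let Dsum i (F : I -> V) : D i (\sum_j F j) = \sum_j D i (F j).
Proof. exact: (big_morph (D i) (DDE i) (D0 i)). Qed.
Let Esum i (F : I -> V) : E i (\sum_j F j) = \sum_j E i (F j).
Proof. exact: (big_morph (E i) (EDE i) (E0 i)). Qed.

Lemma dirac_sym u v : ip (dirac u) v = ip u (dirac v).
Proof.
rewrite (ip_suml hip) (ip_sumr hip); apply: eq_bigr => i _.
by rewrite (dc_Eskew H) (dc_Dskew H) opprK (dc_DE H).
Qed.

(** Since [D i] and [D j] commute, the double sum may be added to its copy with [E i] and [E j]
    exchanged. The anticommutators then kill all terms off the diagonal, and the factor 2
    cancels. *)
Lemma dirac_dirac u : dirac (dirac u) = - \sum_i D i (D i u).
Proof.
have e : dirac (dirac u) = \sum_i \sum_j E i (E j (D i (D j u))).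
  apply: eq_bigr => i _; rewrite Dsum Esum; apply: eq_bigr => j _.
  by rewrite (dc_DE H).
have e' : dirac (dirac u) = \sum_i \sum_j E j (E i (D i (D j u))).
  rewrite e exchange_big; apply: eq_bigr => i _; apply: eq_bigr => j _.
  by rewrite (dc_DD H).
have : dirac (dirac u) + dirac (dirac u) = (-2) *: \sum_i D i (D i u).
  rewrite {1}e e' -big_split scaler_sumr; apply: eq_bigr => i _ /=.
  rewrite -big_split (bigD1 i)//= (dc_EE H) eqxx mul1r big1 ?addr0// => j ji.
  by rewrite (dc_EE H) eq_sym (negbTE ji) mul0r oppr0 scale0r.
move: (dirac _) (\sum_i _) => x y; rewrite -mulr2n -scaler_nat scaleNr -scalerN.
by move=> /scalerI; apply; rewrite pnatr_eq0.
Qed.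

Lemma dirac_norm u : ip (dirac u) (dirac u) = \sum_i ip (D i u) (D i u).
Proof.
rewrite dirac_sym dirac_dirac (ipNr hip) (ip_sumr hip) -sumrN.
by apply: eq_bigr => i _; rewrite (dc_Dskew H).
Qed.

(** Transfers bounds from the Dirac operator to each single difference quotient. *)
Lemma dirac_ge i u : ip (D i u) (D i u) <= ip (dirac u) (dirac u).
Proof.
by rewrite dirac_norm (bigD1 i)//= lerDl sumr_ge0// => j _; exact: ip_ge0.
Qed.

Variables a b : R.
Hypothesis b0 : b != 0.

Let b20 : 0 < b ^+ 2. Proof. by rewrite exprn_even_gt0. Qed.

(** This is [(dirac - a)^2 + b^2], that is Q_s with [a] for Re(s) and [b] for the norm of Im(s). *)
Definition dirac_Q u := dirac (dirac u) - (2 * a) *: dirac u + (a ^+ 2 + b ^+ 2) *: u.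

Lemma dirac_QE u v : ip (dirac_Q u) v =
  ip (dirac u - a *: u) (dirac v - a *: v) + b ^+ 2 * ip u v.
Proof.
rewrite /dirac_Q !(ipE hip) dirac_sym (dirac_sym u v); ring.
Qed.

Lemma dirac_Q_ge u : b ^+ 2 * ip u u <= ip (dirac_Q u) u.
Proof. by rewrite dirac_QE lerDr (ip_ge0 hip). Qed.

(** Depends on [K], which blows up with the step. It only enters the completeness of the energy
    norm, never an estimate that has to be uniform. *)
Let N := 2 * (#|I|%:R * K) + 2 * a ^+ 2 + b ^+ 2.

Lemma dirac_Q_le u : ip (dirac_Q u) u <= N * ip u u.
Proof.
have := ipD_le hip (dirac u) (- (a *: u)).
have : ip (dirac u) (dirac u) <= #|I|%:R * K * ip u u.
  rewrite dirac_norm -mulrA mulr_natl -sumr_const.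
  by apply: ler_sum => i _; exact: (dc_Dbnd H).
rewrite dirac_QE /N; move: (ip (dirac u - _) _) => x; rewrite !(ipE hip).
by move: (#|I|%:R) (ip u u) (ip (dirac u) _) => c d e h h'; lra.
Qed.

Lemma dirac_Q_sym u v : ip (dirac_Q u) v = ip (dirac_Q v) u.
Proof. by rewrite !dirac_QE (ipC hip u v) (ipC hip (dirac u - _)). Qed.

(** The energy norm lies between [b ^+ 2] and [N] times the original squared norm, so completeness
    carries over. [hilbert_form] is a predicate on the form so that the same space can carry both
    products. *)
Lemma dirac_Q_form : hilbert_form (fun u v => ip (dirac_Q u) v).
Proof.
split.
- exact: dirac_Q_sym.
- move=> u v w; rewrite dirac_Q_sym (ipE hip) dirac_Q_sym; congr (_ + _).
  exact: dirac_Q_sym.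
- by move=> c u w; rewrite dirac_Q_sym (ipE hip) dirac_Q_sym.
- by move=> u; apply: le_trans (dirac_Q_ge u); rewrite mulr_ge0 ?(ip_ge0 hip)// ltW.
- move=> u Qu; apply: (ip_eq0 hip); apply: le_anti; rewrite (ip_ge0 hip) andbT.
  by have := dirac_Q_ge u; rewrite Qu pmulr_rle0.
- move=> u uc; have [e e0|l ul] := ip_complete hip (u := u).
    have [M hM] := uc _ (mulr_gt0 b20 e0); exists M => m n Mm Mn.
    by have := hM _ _ Mm Mn; move=> /(le_lt_trans (dirac_Q_ge _)); rewrite ltr_pM2l.
  exists l; have : (N * ip (u n - l) (u n - l)) @[n --> \oo] --> N * 0 by exact: cvgMl_tmp.
  rewrite mulr0; apply: squeeze_cvgr; last exact: cvg_cst.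
  apply: nearW => n; rewrite dirac_Q_le andbT.
  by apply: le_trans (dirac_Q_ge _); rewrite mulr_ge0 ?(ip_ge0 hip)// ltW.
Qed.

Lemma dirac_Q_surj w : exists v, dirac_Q v = w.
Proof.
have [|m|v vw] := riesz dirac_Q_form (f := ip w) (C := ip w w / b ^+ 2).
- by move=> *; rewrite !(ipE hip).
- rewrite -mulrA; apply: le_trans (cauchy_schwarz hip _ _) _.
  by rewrite ler_wpM2l ?(ip_ge0 hip)// mulrC ler_pdivlMr// mulrC dirac_Q_ge.
- by exists v; exact: (ip_inj hip).
Qed.

(** Coercivity and Cauchy-Schwarz give [b ^+ 2 * |v|^2 <= |Q v| * |v|]. The constant is free of [K],
    hence uniform in the step. *)
Lemma dirac_Q_bound v : ip v v <= ip (dirac_Q v) (dirac_Q v) / b ^+ 4.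
Proof.
have [->|vn0] := eqVneq (ip v v) 0.
  by rewrite divr_ge0 ?(ip_ge0 hip)// exprn_even_ge0.
have vp : 0 < ip v v by rewrite lt_neqAle eq_sym vn0 (ip_ge0 hip).
rewrite ler_pdivlMr; last by rewrite exprn_even_gt0.
rewrite -(ler_pM2r vp); apply: le_trans (cauchy_schwarz hip _ _).
rewrite (_ : _ * _ * _ = (b ^+ 2 * ip v v) ^+ 2); last by ring.
have p : 0 <= b ^+ 2 * ip v v by rewrite mulr_ge0 ?(ip_ge0 hip)// ltW.
have q := dirac_Q_ge v.
by rewrite lerXn2r ?nnegrE// (le_trans p).
Qed.

(** Write [T] for [dirac]. Then [|T v|^2 <= 2 |T v - a v|^2 + 2 a^2 |v|^2], while
    [|T v - a v|^2 <= ip (Q v) v], and twice this product is at most [|Q v|^2 + |v|^2]. Again [K]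
    does not enter. *)
Lemma dirac_bound v : ip (dirac v) (dirac v) <=
  ip (dirac_Q v) (dirac_Q v) + (1 + 2 * a ^+ 2) * ip v v.
Proof.
have := ipD_le hip (dirac v - a *: v) (a *: v); rewrite subrK.
have := dirac_QE v v; have := ip_ge0 hip (dirac_Q v - v).
have : 0 <= b ^+ 2 * ip v v by rewrite mulr_ge0 ?(ip_ge0 hip)// ltW.
move: (ip (dirac v - _) _) (dirac_Q v) => x q; rewrite !(ipE hip) (ipC hip v q).
by move: (ip v v) (ip q v) (ip q q) (ip (dirac v) _) => c d e g *; lra.
Qed.

End discrete.

(* [S i] is the translation group in direction [i]; [Dt i phi phi'] says that [phi] is a
   test vector whose derivative in direction [i] is [phi']. *)
Record clifford_calculus (R : realType) (V : lmodType R) (ip : V -> V -> R) (I : finType)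
    (E : I -> V -> V) (S : I -> R -> V -> V) (Dt : I -> V -> V -> Prop) : Prop :=
  CliffordCalculus {
  cc_Elin : forall i a u v, E i (a *: u + v) = a *: E i u + E i v;
  cc_Eskew : forall i u v, ip (E i u) v = - ip u (E i v);
  cc_EE : forall i j u, E i (E j u) + E j (E i u) = - ((i == j)%:R * 2) *: u;
  cc_Slin : forall i t a u v, S i t (a *: u + v) = a *: S i t u + S i t v;
  cc_Sadj : forall i t u v, ip (S i t u) v = ip u (S i (- t) v);
  cc_SD : forall i s t u, S i s (S i t u) = S i (s + t) u;
  cc_S0 : forall i u, S i 0 u = u;
  cc_SS : forall i j s t u, S i s (S j t u) = S j t (S i s u);
  cc_SE : forall i j t u, S i t (E j u) = E j (S i t u);
  cc_Dsub : forall i, is_subspace [set phi | exists phi', Dt i phi phi'];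
  cc_Dtot : forall i, total_set (ip := ip) [set phi | exists phi', Dt i phi phi'];
  cc_SDt : forall i t phi phi', Dt i phi phi' -> Dt i (S i t phi) (S i t phi');
  cc_taylor : forall i phi phi', Dt i phi phi' -> exists C, forall t, `|t| <= 1 ->
    ip (S i t phi - phi - t *: phi') (S i t phi - phi - t *: phi') <= C * t ^+ 4 }.

(** Cutting [h] into [n.+1] equal steps, each of length at most 1 once [n] is large, reduces the
    accumulated quadratic error to [C * h ^+ 2 / n.+1], which tends to 0. *)
Lemma lipschitz_of_local (R : realType) (F : R -> R) (K C : R) : 0 <= K -> 0 <= C ->
  (forall t s, `|s| <= 1 -> `|F (t + s) - F t| <= K * `|s| + C * s ^+ 2) ->
  forall t h, `|F (t + h) - F t| <= K * `|h|.
Proof.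
move=> K0 C0 FKC t h.
have step n : `|h| <= n.+1%:R -> `|F (t + h) - F t| <= K * `|h| + C * h ^+ 2 * n.+1%:R^-1.
  move=> hn; have n0 : 0 < n.+1%:R :> R by [].
  have s1 : `|h / n.+1%:R| <= 1 by rewrite normrM normfV (ger0_norm (ltW n0)) ler_pdivrMr ?mul1r.
  set d := h / n.+1%:R in s1.
  have it k : `|F (t + k%:R * d) - F t| <= k%:R * (K * `|d| + C * d ^+ 2).
    elim: k => [|k IH]; first by rewrite !mul0r addr0 subrr normr0.
    have := FKC (t + k%:R * d) _ s1.
    rewrite -natr1 !mulrDl !mul1r addrA => hh1.
    apply: le_trans (ler_distD (F (t + k%:R * d)) _ _) _.
    by rewrite [leRHS]addrC lerD.
  have hd : h = n.+1%:R * d by rewrite /d mulrC divfK// gt_eqF.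
  clearbody d; rewrite hd.
  apply: le_trans (it n.+1) _; rewrite normrM (ger0_norm (ltW n0)).
  rewrite le_eqVlt; apply/orP; left; apply/eqP; field; rewrite gt_eqF//.
have c : (K * `|h| + C * h ^+ 2 * n.+1%:R^-1) @[n --> \oo] --> K * `|h| + C * h ^+ 2 * 0.
  by apply: cvgD; [exact: cvg_cst|apply: cvgMl_tmp; exact: cvg_harmonic].
rewrite mulr0 addr0 in c; apply: (cvgr_to_ge c).
near=> n; apply: step; apply: ltW; near: n.
exists (Num.bound `|h|) => // n /= hn.
have /lt_le_trans := archi_boundP (normr_ge0 h); apply.
by rewrite ler_nat ltnW.
Unshelve. all: by end_near.
Qed.

(** * Difference quotients and weak derivatives *)

Section calculus.
Context {R : realType} {V : lmodType R} {ip : V -> V -> R}.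
Hypothesis hip : hilbert_form ip.
Context {I : finType} {E : I -> V -> V} {S : I -> R -> V -> V} {Dt : I -> V -> V -> Prop}.
Hypothesis H : clifford_calculus ip E S Dt.
Context {U : set_system nat}.
Hypothesis UU : UltraFilter U.
Hypothesis Uoo : \oo `<=` U.
Let UP : ProperFilter U := ultra_proper.
Implicit Types (u v w : V) (n : nat) (i : I).

Definition weakd i v w := forall phi phi', Dt i phi phi' -> ip v phi' = - ip w phi.

Let h n : R := n.+1%:R^-1.
Let hp n : 0 < h n. Proof. by rewrite /h invr_gt0. Qed.
Let h1 n : `|h n| <= 1.
Proof. by rewrite ger0_norm ?(ltW (hp n))// /h invf_le1 ?ler1n. Qed.

(** The adjoint of [S i t] is [S i (- t)], so the centred quotient is exactly skew; a one-sided
    quotient would not be. *)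
Definition diffq n i u := (2 * h n)^-1 *: (S i (h n) u - S i (- h n) u).

Let SB i t u v : S i t (u - v) = S i t u - S i t v.
Proof. by have := cc_Slin H i t (-1) v u; rewrite !scaleN1r ![- _ + _]addrC. Qed.
Let S00 i t : S i t 0 = 0.
Proof. by have := SB i t 0 0; rewrite !subrr. Qed.
Let SZ i t a u : S i t (a *: u) = a *: S i t u.
Proof. by have := cc_Slin H i t a u 0; rewrite S00 !addr0. Qed.
Let E0 i : E i 0 = 0.
Proof. by have := cc_Elin H i (-1) 0 0; rewrite scaler0 addr0 scaleN1r addNr. Qed.
Let EZ i a u : E i (a *: u) = a *: E i u.
Proof. by have := cc_Elin H i a u 0; rewrite E0 !addr0. Qed.
Let EB i u v : E i (u - v) = E i u - E i v.
Proof. by have := cc_Elin H i (-1) v u; rewrite !scaleN1r ![- _ + _]addrC. Qed.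
Let Siso i t u : ip (S i t u) (S i t u) = ip u u.
Proof. by rewrite (cc_Sadj H) (cc_SD H) addNr (cc_S0 H). Qed.

(** The constant: translations are isometric, so the difference has norm at most [2 |u|], and it is
    divided by [2 * h n]. *)
Lemma diffq_clifford n : discrete_clifford ip E (diffq n) (h n ^- 2).
Proof.
split.
- exact: (cc_Elin H).
- move=> i a u v; rewrite /diffq !(cc_Slin H) opprD addrACA -scalerBr scalerDr.
  by rewrite !scalerA mulrC.
- exact: (cc_Eskew H).
- move=> i u v; rewrite /diffq !(ipE hip) !(cc_Sadj H) opprK; ring.
- move=> i j u; rewrite /diffq !SZ !SB !scalerBr !(cc_SS H i j).
  by rewrite !opprB addrACA [RHS]addrACA [X in _ + X = _]addrC.
- by move=> i j u; rewrite /diffq EZ EB !(cc_SE H).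
- exact: (cc_EE H).
- move=> i u; rewrite /diffq (ipZl hip) (ipZr hip) -exprVn invfM.
  have := ipD_le hip (S i (h n) u) (- S i (- h n) u).
  rewrite [X in _ <= _ + _ * X](ipNl hip) (ipNr hip) opprK !Siso.
  have : 0 <= (h n)^-1 ^+ 2 by rewrite sqr_ge0.
  move: (h n)^-1 (ip (_ - _) _) => x y x0 le.
  rewrite (_ : _ * (_ * y) = x ^+ 2 * (y / 4)); last by field.
  by rewrite ler_wpM2l//; lra.
Qed.

(** Subtracting the expansions at [h n] and [- h n] cancels [phi]. Each remainder has squared norm
    at most [C * h n ^+ 4], and division by [(2 * h n) ^+ 2] leaves [C * h n ^+ 2]. *)
Lemma diffq_strong i phi phi' : Dt i phi phi' ->
  ip (diffq n i phi - phi') (diffq n i phi - phi') @[n --> \oo] --> (0 : R).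
Proof.
move=> /(cc_taylor H)[C tC].
have : (C * h n * h n) @[n --> \oo] --> C * 0 * 0.
  by apply: cvgM; [apply: cvgMl_tmp|]; exact: cvg_harmonic.
rewrite mulr0; apply: squeeze_cvgr; last exact: cvg_cst.
apply: nearW => n; rewrite (ip_ge0 hip)/=.
have t1 := tC (h n) (h1 n); have := tC (- h n); rewrite normrN => /(_ (h1 n)) t2.
have hn0 : 2 * h n != 0 by rewrite gt_eqF// mulr_gt0.
have -> : diffq n i phi - phi' = (2 * h n)^-1 *:
    ((S i (h n) phi - phi - h n *: phi') + - (S i (- h n) phi - phi - (- h n) *: phi')).
  rewrite -[phi' in LHS](scalerK hn0) -scalerBr; congr (_ *: _).
  rewrite scaleNr opprK [in RHS]opprD [RHS]addrACA opprB (addrA (_ - phi)) subrK -opprD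
    -scalerDl; congr (_ - _ *: _); ring.
have := ipD_le hip (S i (h n) phi - phi - h n *: phi')
  (- (S i (- h n) phi - phi - (- h n) *: phi')).
rewrite [X in _ <= _ + _ * X](ipNl hip) (ipNr hip) opprK (ipZl hip) (ipZr hip) invfM.
have := hp n; move: t1 t2; move: (h n) (ip (_ + - (_ - _ - (- _) *: _)) _) => x y t1 t2 x0 le.
rewrite (_ : _ * (_ * y) = y / (4 * x ^+ 2)); last by field; rewrite gt_eqF.
rewrite ler_pdivrMr ?mulr_gt0 ?exprn_gt0//; move: t1 t2 le.
move: (ip (S i x _ - _ - _) _) (ip (S i (- x) _ - _ - _) _) => c d t1 t2 le.
rewrite (_ : (- x) ^+ 4 = x ^+ 4) in t2; last by ring.
rewrite (_ : C * x * x * (4 * x ^+ 2) = 4 * (C * x ^+ 4)); last by ring.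
by move: (C * _) t1 t2 => z t1 t2; lra.
Qed.

(** Skewness moves the quotient onto the test vector, where it converges in norm; a weakly
    convergent bounded factor can then be paired with it. *)
Lemma diffq_wlim i (x : nat -> V) l p : bdd (ip := ip) x ->
  wcvg (ip := ip) (U := U) x l -> wcvg (ip := ip) (U := U) (fun n => diffq n i (x n)) p ->
  weakd i l p.
Proof.
move=> bx xl xp phi phi' Dphi.
have c1 := wcvg_strong hip UU Uoo bx xl (diffq_strong Dphi).
have c2 := cvgN (xp phi).
apply: (cvg_unique _ c1) => //.
rewrite (_ : (fun n => ip (x n) (diffq n i phi)) = (fun n => - ip (diffq n i (x n)) phi)); first exact: c2.
apply/funext => n; by rewrite (dc_Dskew (diffq_clifford n)) opprK.
Qed.

(* The function [t |-> ip v (S i t phi)] has derivative [- ip w (S i t phi)], so it is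
   Lipschitz with constant [|w| |phi|]. *)
Lemma diffq_bound n i v w : weakd i v w -> ip (diffq n i v) (diffq n i v) <= ip w w.
Proof.
move=> vw; have := @total_bound _ _ _ hip _ (diffq n i v) _ (ip_ge0 hip w) (cc_Dsub H i) (cc_Dtot H (i := i)).
apply.
move=> phi [phi' Dphi].
pose F t := ip v (S i t phi).
pose K := Num.sqrt (ip w w * ip phi phi).
have [C0 tC0] := cc_taylor H Dphi.
pose C := Num.sqrt (ip v v * `|C0|).
have Klim t hh : `|F (t + hh) - F t| <= K * `|hh|.
  apply: (@lipschitz_of_local R F K C); rewrite ?sqrtr_ge0// => {}t s s1.
  (* First-order expansion of [F] at [t]. In the first term [S i t phi'] is the derivative of the
     test vector [S i t phi], so [weakd] applies; the second is the Taylor remainder of [phi], moved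
     back to the origin by adjunction. *)
  have -> : F (t + s) - F t = s * ip v (S i t phi') +
      ip (S i (- t) v) (S i s phi - phi - s *: phi').
    rewrite (cc_Sadj H) opprK !SB SZ !(ipE hip) (cc_SD H) /F; ring.
  apply: le_trans (ler_normD _ _) _; apply: lerD.
    rewrite normrM mulrC ler_wpM2r// (vw _ _ (cc_SDt H t Dphi)) normrN -sqrtr_sqr.
    rewrite ler_wsqrtr//; apply: le_trans (cauchy_schwarz hip _ _) _.
    by rewrite Siso.
  rewrite -sqrtr_sqr (_ : s ^+ 2 = `|s ^+ 2|); last by rewrite ger0_norm// sqr_ge0.
  rewrite -(sqrtr_sqr (s ^+ 2)) -sqrtrM; last by rewrite mulr_ge0// (ip_ge0 hip).
  rewrite ler_wsqrtr//; apply: le_trans (cauchy_schwarz hip _ _) _.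
  rewrite Siso -mulrA ler_wpM2l ?(ip_ge0 hip)//; apply: le_trans (tC0 _ s1) _.
  rewrite -exprM; apply: ler_wpM2r; [by rewrite exprn_even_ge0|exact: ler_norm].
have -> : ip (diffq n i v) phi = (2 * h n)^-1 * (F (- h n) - F (h n)).
  by rewrite /diffq /F !(ipE hip) !(cc_Sadj H) opprK.
have := Klim (h n) (- (2 * h n)).
rewrite (_ : h n + _ = - h n); last by ring.
rewrite normrN (ger0_norm (mulr_ge0 _ (ltW (hp n))))// => le.
rewrite -(sqr_sqrtr (mulr_ge0 (ip_ge0 hip w) (ip_ge0 hip phi))) -/K.
rewrite -real_normK ?num_real// lerXn2r ?nnegrE ?sqrtr_ge0//.
by rewrite normrM normfV (ger0_norm (mulr_ge0 _ (ltW (hp n))))// mulrC ler_pdivrMr// mulr_gt0.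
Qed.

Lemma weakd_uniq i v w w' : weakd i v w -> weakd i v w' -> w = w'.
Proof.
move=> vw vw'; apply/eqP; rewrite -subr_eq0; apply/eqP/(cc_Dtot H (i := i)).
by move=> phi [phi' Dphi]; rewrite !(ipE hip) -[ip w phi]opprK -(vw _ _ Dphi) (vw' _ _ Dphi) opprK subrr.
Qed.

(** The quotients are bounded by [w], any weak limit of them is a weak derivative of [v], and weak
    derivatives are unique. *)
Lemma diffq_wcvg i v w : weakd i v w -> wcvg (ip := ip) (U := U) (fun n => diffq n i v) w.
Proof.
move=> vw; have [|l vl] := weak_compact hip UU (x := fun n => diffq n i v).
  by exists (ip w w) => n; exact: diffq_bound.
rewrite (_ : w = l)//; apply: weakd_uniq vw _.
apply: (diffq_wlim (bdd_cst v)) vl => u; exact: cvg_cst.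
Qed.

(** For each [i] one vector stays fixed while the quotient of the other converges weakly, so the
    skewness of [diffq n i] passes to the limit on each side. *)
Lemma nabla_sym (p q : I -> V) u v : (forall i, weakd i v (p i)) -> (forall i, weakd i u (q i)) ->
  ip (\sum_i E i (p i)) u = ip v (\sum_i E i (q i)).
Proof.
move=> vp uq; rewrite (ip_suml hip) (ip_sumr hip); apply: eq_bigr => i _.
have wp : wcvg (ip := ip) (U := U) (fun n => diffq n i v) (p i) := diffq_wcvg (vp i).
have wq : wcvg (ip := ip) (U := U) (fun n => diffq n i u) (q i) := diffq_wcvg (uq i).
have c1 := wp (E i u); have c2 := wq (E i v).
rewrite (cc_Eskew H); apply/esym.
transitivity (- ip (q i) (E i v)); first by rewrite (ipC hip) (cc_Eskew H).
have {}c2 : - ip (diffq n i u) (E i v) @[n --> U] --> - ip (q i) (E i v) by exact: cvgN.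
apply: (cvg_unique _ c2) => //.
rewrite (_ : (fun n => - ip (diffq n i u) (E i v)) = (fun n => - ip (diffq n i v) (E i u))).
  exact: cvgN.
apply/funext => n; have dc := diffq_clifford n.
by rewrite (dc_Dskew dc i u) (dc_DE dc) (ipC hip u) (cc_Eskew H) opprK.
Qed.

(** Membership in the domain of the square asks for derivatives of [z] only. Hence [q] is taken as
    the weak limit of [diffq n i (T n (x n))], and mixed second differences of [x n] never have to
    be bounded. *)
Lemma nabla_solve (a b : R) w : b != 0 -> exists v (p q : I -> V),
  let z := \sum_i E i (p i) in
  [/\ forall i, weakd i v (p i), forall i, weakd i z (q i) &
      \sum_i E i (q i) - (2 * a) *: z + (a ^+ 2 + b ^+ 2) *: v = w].
Proof.
move=> b0.
pose T n := dirac (E := E) (D := diffq n).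
have /choice[x xw] : forall n, exists x,  dirac_Q (E := E) (D := diffq n) a b x = w.
  by move=> n; exact: (dirac_Q_surj hip (diffq_clifford n)).
have bx : bdd (ip := ip) x.
  by exists (ip w w / b ^+ 4) => n; have := dirac_Q_bound hip (diffq_clifford n) a b0 (x n); rewrite xw.
have bT : bdd (ip := ip) (fun n => T n (x n)).
  have [C xC] := bx; exists (ip w w + (1 + 2 * a ^+ 2) * C) => n.
  apply: le_trans (dirac_bound hip (diffq_clifford n) a b0 (x n)) _.
  rewrite xw lerD2l ler_wpM2l// addr_ge0// mulr_ge0// sqr_ge0//.
(* The equation expresses the second-order term through [w] and the bounded lower-order terms. *)
have eTT n : T n (T n (x n)) = w + ((2 * a) *: T n (x n) + (- (a ^+ 2 + b ^+ 2)) *: x n).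
  by rewrite -(xw n) /dirac_Q -/(T n _) scaleNr addrACA subrr addr0 subrK.
have bTT : bdd (ip := ip) (fun n => T n (T n (x n))).
  have -> := funext eTT.
  exact: (bddD hip (bdd_cst w) (bddD hip (bddZ hip _ bT) (bddZ hip _ bx))).
have bd i (y : nat -> V) : bdd (ip := ip) (fun n => T n (y n)) -> bdd (ip := ip) (fun n => diffq n i (y n)).
  move=> [C yC]; exists C => n; apply: le_trans (yC n).
  exact: (dirac_ge hip (diffq_clifford n)).
have [v xv] := weak_compact hip UU bx.
have /choice[p xp] : forall i, exists l, wcvg (ip := ip) (U := U) (fun n => diffq n i (x n)) l.
  by move=> i; exact: (weak_compact hip UU (bd i _ bT)).
have /choice[q xq] : forall i, exists l,
    wcvg (ip := ip) (U := U) (fun n => diffq n i (T n (x n))) l.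
  by move=> i; exact: (weak_compact hip UU (bd i (fun n => T n (x n)) bTT)).
have wE i (y : nat -> V) l : wcvg (ip := ip) (U := U) y l ->
    wcvg (ip := ip) (U := U) (fun n => E i (y n)) (E i l).
  move=> yl; apply: (wcvg_adjoint (A := E i) (B := fun u => - E i u)) yl => u u'.
  by rewrite (cc_Eskew H) (ipNr hip).
have wz : wcvg (ip := ip) (U := U) (fun n => T n (x n)) (\sum_i E i (p i)).
  by apply: (wcvg_sum hip UU) => i; exact: wE.
have wTT : wcvg (ip := ip) (U := U) (fun n => T n (T n (x n))) (\sum_i E i (q i)).
  by apply: (wcvg_sum hip UU) => i; exact: wE.
exists v, p, q; split.
- by move=> i; exact: (diffq_wlim bx xv).
- by move=> i; exact: (diffq_wlim bT wz).
(* The discrete left-hand sides are constantly [w] and converge weakly to the left-hand side of the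
   limit equation. *)
- apply: (wcvg_cst_unique hip UU); rewrite -scaleNr.
  have := wcvgD hip UU (wcvgD hip UU wTT (wcvgZ hip UU (a := - (2 * a)) wz))
    (wcvgZ hip UU (a := a ^+ 2 + b ^+ 2) xv).
  rewrite [X in wcvg X _](_ : _ = fun=> w)//.
  by apply/funext => n; rewrite -[RHS](xw n) /dirac_Q scaleNr.
Qed.

End calculus.

(** * The Hilbert space of square-integrable quaternionic functions *)

Section L2_real.
Context d (X : measurableType d) (R : realType) (mu : {measure set X -> \bar R}).
Implicit Types f g : X -> R.

Definition sqint f : \bar R := (\int[mu]_x ((f x) ^+ 2 : R)%:E)%E.

Lemma Lfun2_measurable f : f \in Lfun mu 2%:E -> measurable_fun setT f.
Proof. by rewrite inE => /andP[+ _]; rewrite inE. Qed.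

Lemma Lfun2_sqint f : f \in Lfun mu 2%:E -> (sqint f < +oo)%E.
Proof. by move=> /Lfun2_integrable_sqr/integral_fune_lt_pinfty; exact. Qed.

Lemma measurable_sq f : measurable_fun setT f ->
  measurable_fun setT (EFin \o (fun x => f x ^+ 2 : R)).
Proof. by move=> mf; apply/measurable_EFinP; exact: measurable_funX. Qed.

Lemma sqint_Lfun2 f : measurable_fun setT f -> (sqint f < +oo)%E -> f \in Lfun mu 2%:E.
Proof.
move=> mf f2; rewrite inE; apply/andP; split; rewrite inE//= /finite_norm unlock.
apply: poweR_lty; rewrite (le_lt_trans _ f2)//.
rewrite ge0_le_integral//.
- by move=> x _; exact: poweR_ge0.
- apply/measurable_EFinP/(@measurableT_comp _ _ _ _ _ _ (fun x : R => x `^ 2)) => //.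
  exact: measurableT_comp.
- exact: measurable_sq.
- by move=> x _/=; rewrite lee_fin powR_mulrn// real_normK// num_real.
Qed.

Lemma sqintD_le f g : measurable_fun setT f -> measurable_fun setT g ->
  (sqint (f \+ g)%R <= 2%:E * sqint f + 2%:E * sqint g)%E.
Proof.
move=> mf mg.
rewrite /sqint -!ge0_integralZl//; do ?[exact: measurable_sq|by move=> *; rewrite lee_fin sqr_ge0].
rewrite -ge0_integralD//; last 4 first.
- by move=> x _; rewrite mule_ge0// lee_fin sqr_ge0.
- by apply: emeasurable_funM => //; exact: measurable_sq.
- by move=> x _; rewrite mule_ge0// lee_fin sqr_ge0.
- by apply: emeasurable_funM => //; exact: measurable_sq.
apply: ge0_le_integral => //.
- by move=> x _; rewrite lee_fin sqr_ge0.
- by apply: measurable_sq; exact: measurable_funD.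
- by apply: emeasurable_funD; apply: emeasurable_funM => //; exact: measurable_sq.
- move=> x _; rewrite -!EFinM -EFinD lee_fin /=.
  by have := sqr_ge0 (f x - g x); rewrite !expr2 => ?; lra.
Qed.

(* With [sqint (g k.+1 - g k) <= 8^-k] the integrand [\sum_k 4^k (g k.+1 - g k)^2] is
   integrable, so [|g k.+1 - g k| = O(2^-k)] almost everywhere. *)
Lemma fast_cauchy_cvg (g : nat -> X -> R) : (forall k, g k \in Lfun mu 2%:E) ->
  (forall k, sqint (g k.+1 \- g k)%R <= (8 ^- k)%:E)%E ->
  exists f, measurable_fun setT f /\ \forall x \ae mu, g k x @[k --> \oo] --> f x.
Proof.
move=> gL g8.
have mg k := Lfun2_measurable (gL k).
pose D k x := g k.+1 x - g k x.
have mD k : measurable_fun setT (D k) by exact: measurable_funB.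
pose S : X -> \bar R := fun x => (\sum_(0 <= k <oo) ((4 ^+ k) * (D k x) ^+ 2 : R)%:E)%E.
have t0 k x : (0 <= ((4 ^+ k) * (D k x) ^+ 2)%:E)%E by rewrite lee_fin mulr_ge0 ?sqr_ge0// exprn_ge0.
have mt k : measurable_fun setT (EFin \o (fun x => (4 ^+ k) * (D k x) ^+ 2 : R)).
  by apply/measurable_EFinP/measurable_funM => //; exact: measurable_funX.
have mS : measurable_fun setT S.
  by apply: (ge0_emeasurable_sum (P := xpredT)) => [k x _ _|k _]; [exact: t0|exact: mt].
have iS : mu.-integrable setT S.
  apply/integrableP; split; first exact: mS.
  have -> : (\int[mu]_x `|S x| = \int[mu]_x S x)%E.
    by apply: eq_integral => x _; rewrite gee0_abs//; exact: nneseries_ge0.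
  rewrite integral_nneseries//.
  apply: (@le_lt_trans _ _ (\sum_(0 <= k <oo) ((1/2) ^+ k)%:E)%E).
    apply: lee_nneseries => [k _ _|k _]; first exact: integral_ge0.
    under eq_integral do rewrite EFinM.
    rewrite ge0_integralZl//; last 2 first.
    - exact: measurable_sq.
    - by move=> *; rewrite lee_fin sqr_ge0.
    apply: (@le_trans _ _ ((4 ^+ k)%:E * (8 ^- k)%:E)%E).
      by rewrite lee_pmul2l ?lte_fin ?exprn_gt0//; exact: g8.
    have e : 4 * 8^-1 = 1 / 2 :> R by field.
    by rewrite -EFinM lee_fin -exprVn -exprMn e.
  rewrite (_ : (fun n => _) = EFin \o series (geometric 1 (1 / 2 : R))); last first.
    apply/funext => n /=; rewrite sumEFin; congr EFin.
    by apply: eq_bigr => k _ /=; rewrite [RHS]mul1r.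
  rewrite EFin_lim ?ltry//; apply: is_cvg_geometric_series.
  by rewrite ger0_norm; lra.
have Sfin := integrable_ae measurableT iS.
pose G := [set x | (S x < +oo)%E].
have mG : measurable G.
  by rewrite -[G]setTI; exact: emeasurable_fun_infty_o.
have gcvg x : G x -> cvgn (g ^~ x).
  move=> Gx; have S0 : (0 <= S x)%E by exact: nneseries_ge0.
  have Sf : S x = (fine (S x))%:E by rewrite fineK// ge0_fin_numE.
  pose c := Num.sqrt (fine (S x)); have c0 : 0 <= c by exact: sqrtr_ge0.
  have Dc k : `|D k x| <= c * (1 / 2) ^+ k.
    have : (((4 ^+ k) * (D k x) ^+ 2)%:E <= S x)%E.
      apply: le_trans (nneseries_lim_ge k.+1 _) => //.
      by rewrite big_nat_recr//= leeDr// sume_ge0.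
    rewrite Sf lee_fin => h.
    have h2 : (2 ^+ k * `|D k x|) ^+ 2 <= c ^+ 2.
      rewrite exprMn real_normK ?num_real// -exprM mulnC exprM -natrX.
      by rewrite sqr_sqrtr ?fine_ge0.
    have {}h2 : 2 ^+ k * `|D k x| <= c.
      by move: h2; rewrite ler_pXn2r// nnegrE mulr_ge0 ?exprn_ge0.
    by rewrite div1r exprVn ler_pdivlMr ?exprn_gt0// mulrC.
  have : cvgn (series (fun k => D k x)).
    apply: normed_cvg; apply: (@series_le_cvg _ _ (geometric c (1 / 2))) => [n|n|n|].
    - exact: normr_ge0.
    - by rewrite /geometric/= mulr_ge0 ?c0// exprn_ge0//; lra.
    - exact: Dc.
    - by apply: is_cvg_geometric_series; rewrite ger0_norm; lra.
  move=> cD; rewrite (_ : g ^~ x = (fun n => g 0%N x + series (fun k => D k x) n)).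
    by apply: is_cvgD => //; exact: is_cvg_cst.
  by apply/funext => n; rewrite (eq_sum_telescope (g ^~ x) n).
(* The factor [\1_G] makes the sequence converge at every point, so that its pointwise limit is
   measurable. *)
pose f x := limn (fun k => g k x * \1_G x).
have fcvg x : cvgn (fun k => g k x * \1_G x).
  have [Gx|nGx] := pselect (G x).
    rewrite (_ : (fun k => _) = g ^~ x); first exact: gcvg.
    by apply/funext => k; rewrite indicE mem_set// mulr1.
  rewrite (_ : (fun k => _) = cst 0); first exact: is_cvg_cst.
  by apply/funext => k; rewrite indicE memNset// mulr0.
exists f; split.
  apply: (@measurable_fun_cvg _ _ _ _ (fun k x => g k x * \1_G x)) => [k|x _]//.
  by apply: measurable_funM => //; exact: measurable_indic.
apply: filterS Sfin => x /(_ I) Sx.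
have Gx : G x by rewrite /G/= -ge0_fin_numE//; exact: nneseries_ge0.
have -> : g ^~ x = (fun k => g k x * \1_G x); last exact: fcvg.
by apply/funext => k; rewrite indicE mem_set// mulr1.
Qed.

End L2_real.

Section L2_complete.
Context d (X : measurableType d) (R : realType) (mu : {measure set X -> \bar R}).
Implicit Types f g : X -> R.

Lemma sqintBC f g : sqint mu (f \- g) = sqint mu (g \- f).
Proof. by apply: eq_integral => x _; congr EFin; rewrite /= -sqrrN opprB. Qed.

(** Riesz-Fischer: a rapidly converging subsequence has a limit almost everywhere, and Fatou's lemma
    turns this into convergence in mean of the whole sequence. *)
Lemma sqint_complete (u : nat -> X -> R) : (forall n, u n \in Lfun mu 2%:E) ->
  (forall e : R, 0 < e -> exists N, forall m n, (N <= m)%N -> (N <= n)%N ->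
     (sqint mu (u m \- u n)%R < e%:E)%E) ->
  exists2 f, f \in Lfun mu 2%:E & forall e : R, 0 < e -> exists N, forall n, (N <= n)%N ->
     (sqint mu (u n \- f)%R <= e%:E)%E.
Proof.
move=> uL uC; have mu_ n := Lfun2_measurable (uL n).
have /choice[N NP] : forall k, exists N, forall m n, (N <= m)%N -> (N <= n)%N ->
    (sqint mu (u m \- u n)%R < (8 ^- k : R)%:E)%E.
  by move=> k; apply: uC; rewrite invr_gt0 exprn_gt0.
(* Summing the thresholds gives a nondecreasing sequence of indices that dominates every [N j] with
   [j <= k]. *)
pose phi k := (\sum_(j < k.+1) N j)%N.
have phiS k : (phi k <= phi k.+1)%N by rewrite /phi [in leqRHS]big_ord_recr/= leq_addr.
have phiN k m : (k <= m)%N -> (N k <= phi m)%N.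
  by move=> km; rewrite /phi (bigD1 (inord k))//= inordK ?ltnS// leq_addr.
have [|k|f [mf uf]] := @fast_cauchy_cvg _ _ _ mu (fun k => u (phi k)).
- by move=> k; exact: uL.
- by apply: ltW; apply: NP; exact: phiN.
have key k n : (N k <= n)%N -> (sqint mu (u n \- f)%R <= (8 ^- k : R)%:E)%E.
  (* Fatou is applied in [m] with [n] fixed. The shift by [k] keeps [phi (m + k)] beyond [N k], so
     that every integral is below [8 ^- k]. *)
  move=> kn; pose h m x := ((u n x - u (phi (m + k)) x) ^+ 2 : R)%:E.
  have mh m : measurable_fun setT (h m) by apply: measurable_sq; exact: measurable_funB.
  have h0 m x : (0 <= h m x)%E by rewrite lee_fin sqr_ge0.
  have hf : \forall x \ae mu, limn_einf (h ^~ x) = ((u n x - f x) ^+ 2)%:E.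
    apply: filterS uf => x ufx; apply: (cvg_limn_einf_sup _).1.
    apply: cvg_EFin; first exact: nearW.
    rewrite expr2; under eq_fun do rewrite /h/= expr2.
    have c : u n x - u (phi (m + k)) x @[m --> \oo] --> u n x - f x.
      by apply: cvgB; [exact: cvg_cst|rewrite (cvg_shiftn k (fun m => u (phi m) x))].
    exact: cvgM.
  rewrite /sqint (ae_eq_integral (fun x => limn_einf (h ^~ x)))//; last 3 first.
  - by apply: measurable_sq; exact: measurable_funB.
  - rewrite (_ : (fun x => limn_einf (h ^~ x)) = -%E \o (fun x => limn_esup (fun m => - h m x)%E)).
      apply: measurableT_comp => //; apply: measurable_fun_limn_esup => m.
      exact: measurableT_comp.
    apply/funext => x /=; rewrite -limn_einfN; congr limn_einf.
    by apply/funext => m; rewrite /= /h opprK.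
  - by apply: filterS hf => x hx _; rewrite hx.
  apply: le_trans (fatou mu measurableT mh (fun m x _ => h0 m x)) _.
  rewrite limn_einf_lim; apply: lime_le; first exact: is_cvg_einfs.
  apply: nearW => m; apply: (@le_trans _ _ (\int[mu]_x h m x)%E).
    by apply: ereal_inf_lbound; exists m => //=.
  by apply/ltW/NP => //; apply: phiN; rewrite leq_addl.
exists f; last first.
  move=> e e0; have [k ke] : exists k, 8 ^- k <= e.
    have [k _ hk] := near_infty_natSinv_lt (PosNum e0); exists k.
    apply: le_trans (ltW (hk k (leqnn k))); rewrite lef_pV2 ?posrE ?exprn_gt0//.
    by rewrite -natrX ler_nat ltn_expl.
  exists (N k) => n kn; apply: le_trans (key k n kn) _; by rewrite lee_fin.
apply: sqint_Lfun2 => //.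
(* Square-integrability of [f] comes from its finite distance to the single member [u (N 0)]. *)
rewrite (_ : f = (u (N 0) \+ (f \- u (N 0)))); last first.
  by apply/funext => x /=; rewrite addrC subrK.
apply: le_lt_trans (sqintD_le _ _ _) _ => //; first exact: measurable_funB.
have e1 : (sqint mu (f \- u (N 0%N))%R < +oo)%E.
  by rewrite sqintBC; apply: le_lt_trans (key 0%N _ _) _ => //; rewrite ltry.
by rewrite lte_add_pinfty// lte_mul_pinfty ?lee_fin// Lfun2_sqint.
Qed.

End L2_complete.

Lemma mulq_algr (R : realType) (t : R) (q : quat R) : q * t%:A = t *: q.
Proof. by apply: quatP => /=; ring. Qed.

Section L2_hilbert.
Context d (X : measurableType d) (R : realType) (mu : {measure set X -> \bar R}).
Notation H := (quat R).
Notation L2 := (L2 mu).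
Implicit Types (f g : X -> H) (v w : L2).

(* The real Hilbert space underlying the quaternionic one. *)
Definition realL2 : Type := Defs.L2 mu.
HB.instance Definition _ := GRing.Zmodule.on realL2.

Definition rscaleL2 (t : R) (v : realL2) : realL2 := ((t%:A : H) : H^c) *: (v : L2).

Fact rscaleL2A s t v : rscaleL2 s (rscaleL2 t v) = rscaleL2 (s * t) v.
Proof.
rewrite /rscaleL2 scalerA; congr (_ *: _).
by rewrite [RHS](_ : _ = (t%:A : H) * s%:A)// mulr_algl scalerA mulrC.
Qed.
Fact rscaleL21 : left_id 1 rscaleL2.
Proof. by move=> v; rewrite /rscaleL2 scale1r [LHS]scale1r. Qed.
Fact rscaleL2Dr : right_distributive rscaleL2 +%R.
Proof. by move=> t v w; exact: scalerDr. Qed.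
Fact rscaleL2Dl v : {morph rscaleL2^~ v : s t / s + t}.
Proof. by move=> s t; rewrite /rscaleL2 scalerDl [LHS]scalerDl. Qed.
HB.instance Definition _ :=
  GRing.Zmodule_isLmodule.Build R realL2 rscaleL2A rscaleL21 rscaleL2Dr rscaleL2Dl.

(** The real part of the quaternionic scalar product, by [qre_conjM]. *)
Definition rip (v w : realL2) : R := \int[mu]_x qdot (L2_fun v x) (L2_fun w x).

Lemma L2_subE v w : \forall x \ae mu, L2_fun (v - w) x = v x - w x.
Proof.
apply: filterS (L2_addE (v - w) w) => x; rewrite subrK => ->.
by rewrite addrK.
Qed.

Lemma rscaleL2E t (v : realL2) : \forall x \ae mu, L2_fun (t *: v : realL2) x = t *: L2_fun v x.
Proof. by apply: filterS (L2_rmulE (t%:A : H) (v : L2)) => x; rewrite mulq_algr. Qed.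

Lemma ripE f g (v w : realL2) : f \in qL2 mu -> g \in qL2 mu ->
  (\forall x \ae mu, L2_fun v x = f x) -> (\forall x \ae mu, L2_fun w x = g x) ->
  rip v w = \int[mu]_x qdot (f x) (g x).
Proof. by move=> *; apply: eq_idot => //; exact: L2_funP. Qed.

Lemma qL2D f g : f \in qL2 mu -> g \in qL2 mu -> (fun x => f x + g x) \in qL2 mu.
Proof. by move=> fL gL; exact: rpredD. Qed.

Lemma qL2B f g : f \in qL2 mu -> g \in qL2 mu -> (fun x => f x - g x) \in qL2 mu.
Proof. by move=> fL gL; exact: rpredB. Qed.

Lemma qL2Z t f : f \in qL2 mu -> (fun x => t *: f x) \in qL2 mu.
Proof.
move=> /(qL2_mulr (t%:A)); under eq_fun do rewrite mulq_algr.
by [].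
Qed.

Lemma qdot_sqint f : f \in qL2 mu -> ((\int[mu]_x qdot (f x) (f x))%:E =
  sqint mu (qre \o f) + sqint mu (qim1 \o f) + sqint mu (qim2 \o f) + sqint mu (qim3 \o f))%E.
Proof.
move=> fL; rewrite /Rintegral fineK; last exact: (integrable_fin_num _ (qdot_integrable fL fL)).
move: fL => /and4P[/Lfun2_measurable m0 /Lfun2_measurable m1 /Lfun2_measurable m2 /Lfun2_measurable m3].
have m00 := measurable_sq m0; have m11 := measurable_sq m1.
have m22 := measurable_sq m2; have m33 := measurable_sq m3.
have s0 (p : H -> R) : forall x, [set: X] x -> (0 <= ((p \o f) x ^+ 2)%:E)%E.
  by move=> x _; rewrite lee_fin sqr_ge0.
rewrite /sqint -ge0_integralD//; do ?exact: s0.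
rewrite -ge0_integralD//; do ?exact: s0; last 2 first.
- by move=> x _; apply: adde_ge0; exact: s0.
- exact: emeasurable_funD.
rewrite -ge0_integralD//; do ?exact: s0; last 2 first.
- by move=> x _; do ?apply: adde_ge0; exact: s0.
- by do ?apply: emeasurable_funD.
Qed.

Let refl_ae v : \forall x \ae mu, v x = v x. Proof. exact: aeW. Qed.

Lemma ripB f g (v w : realL2) : f \in qL2 mu -> g \in qL2 mu ->
  (\forall x \ae mu, L2_fun v x = f x) -> (\forall x \ae mu, L2_fun w x = g x) ->
  rip (v - w) (v - w) = \int[mu]_x qdot (f x - g x) (f x - g x).
Proof.
move=> fL gL vf wg.
suff e : \forall x \ae mu, L2_fun (v - w) x = f x - g x by apply: ripE => //; exact: qL2B.
by apply: filterS3 (L2_subE v w) vf wg => x -> -> ->.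
Qed.

Lemma sqint_proj_le (p : H -> R) (v w : realL2) :
  (forall f, f \in qL2 mu -> p \o f \in Lfun mu 2%:E) ->
  (forall q q', p (q - q') = p q - p q') -> (forall q, p q ^+ 2 <= qdot q q) ->
  (sqint mu ((p \o L2_fun v) \- (p \o L2_fun w))%R <= (rip (v - w) (v - w))%:E)%E.
Proof.
move=> pL pB p2; have vL := L2_funP v; have wL := L2_funP w.
rewrite (ripB vL wL (refl_ae _) (refl_ae _)).
have iq := qdot_integrable (qL2B vL wL) (qL2B vL wL).
rewrite /Rintegral fineK; last exact: (integrable_fin_num _ iq).
apply: ge0_le_integral => //.
- by move=> x _; rewrite lee_fin sqr_ge0.
- by apply: measurable_sq; apply: measurable_funB; apply: (Lfun2_measurable (mu := mu)); exact: pL.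
- exact: measurable_int iq.
- by move=> x _; rewrite lee_fin /= -pB.
Qed.

Lemma rip_complete (u : nat -> realL2) :
  (forall e, 0 < e -> exists N, forall m n, (N <= m)%N -> (N <= n)%N ->
     rip (u m - u n) (u m - u n) < e) ->
  exists l, rip (u n - l) (u n - l) @[n --> \oo] --> (0 : R).
Proof.
move=> uC.
have cmp (p : H -> R) : (forall f, f \in qL2 mu -> p \o f \in Lfun mu 2%:E) ->
    (forall q q', p (q - q') = p q - p q') -> (forall q, p q ^+ 2 <= qdot q q) ->
    exists2 f, f \in Lfun mu 2%:E & forall e : R, 0 < e -> exists N, forall n, (N <= n)%N ->
     (sqint mu ((p \o L2_fun (u n)) \- f)%R <= e%:E)%E.
  move=> pL pB p2.
  apply: (sqint_complete (u := fun n => p \o L2_fun (u n))) => [n|e e0].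
    by apply: pL; exact: L2_funP.
  have [N NP] := uC e e0; exists N => m n Nm Nn.
  by apply: le_lt_trans (sqint_proj_le _ _ pL pB p2) _; rewrite lte_fin NP.
have sq0 (a b c e : R) : a ^+ 2 <= a ^+ 2 + b ^+ 2 + c ^+ 2 + e ^+ 2.
  by rewrite -!addrA lerDl !addr_ge0 ?sqr_ge0.
have [|//||f0 f0L f0P] := cmp qre; first by move=> f /and4P[].
  by move=> [a b c e]; rewrite /qdot/= -!expr2.
have [|//||f1 f1L f1P] := cmp qim1; first by move=> f /and4P[].
  by move=> [a b c e]; rewrite /qdot/= -!expr2 (addrC (a ^+ 2)).
have [|//||f2 f2L f2P] := cmp qim2; first by move=> f /and4P[].
  by move=> [a b c e]; rewrite /qdot/= -!expr2 (addrC (_ + _) (c ^+ 2)) !addrA.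
have [|//||f3 f3L f3P] := cmp qim3; first by move=> f /and4P[].
  by move=> [a b c e]; rewrite /qdot/= -!expr2 (addrC _ (e ^+ 2)) !addrA.
pose F x := Quat (f0 x) (f1 x) (f2 x) (f3 x).
have FL : F \in qL2 mu by apply/and4P; split.
exists (L2_class FL); apply/cvgrPdist_le => e e0.
have e4 : 0 < e / 4 by rewrite divr_gt0.
have [N0 N0P] := f0P _ e4; have [N1 N1P] := f1P _ e4.
have [N2 N2P] := f2P _ e4; have [N3 N3P] := f3P _ e4.
exists (maxn (maxn N0 N1) (maxn N2 N3)) => // n /=.
rewrite !geq_max => /andP[/andP[n0 n1] /andP[n2 n3]].
have uL := L2_funP (u n).
rewrite sub0r normrN (ripB uL FL (refl_ae _) (L2_classE FL)).
rewrite ger0_norm; last by apply: Rintegral_ge0 => x _; exact: qdot_ge0.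
rewrite -lee_fin (qdot_sqint (qL2B uL FL)).
rewrite (_ : e = e / 4 + e / 4 + e / 4 + e / 4); last by field.
rewrite !EFinD; apply: leeD; last exact: N3P.
apply: leeD; last exact: N2P.
by apply: leeD; [exact: N0P|exact: N1P].
Qed.

Lemma rip_hilbert : hilbert_form rip.
Proof.
split.
- by move=> u v; apply: eq_Rintegral => x _; rewrite /qdot; ring.
- move=> u v w; have uL := L2_funP u; have vL := L2_funP v; have wL := L2_funP w.
  rewrite (ripE (qL2D uL vL) wL (L2_addE _ _) (refl_ae _)).
  rewrite -RintegralD//; do ?exact: qdot_integrable.
  by apply: eq_Rintegral => x _; rewrite /qdot /=; ring.
- move=> a u w; have uL := L2_funP u; have wL := L2_funP w.
  rewrite (ripE (qL2Z a uL) wL (rscaleL2E _ _) (refl_ae _)).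
  rewrite -RintegralZl//; do ?exact: qdot_integrable.
  by apply: eq_Rintegral => x _; rewrite /qdot /=; ring.
- by move=> u; apply: Rintegral_ge0 => x _; exact: qdot_ge0.
- move=> u u0; apply: L2_norm0_eq0; rewrite L2_normE /= -/(rip u u) u0.
  exact: sqrtr0.
- exact: rip_complete.
Qed.

Lemma rip_norm (v : realL2) : rip v v = qnorm (v : L2) ^+ 2.
Proof. by rewrite [qnorm _]L2_normE sqr_sqrtr//; exact: (ip_ge0 rip_hilbert). Qed.

End L2_hilbert.

(** * Translations and left multiplications *)

Section measure_preserving.
Context d (X : measurableType d) (R : realType) (mu : {measure set X -> \bar R}).
Variable tau : X -> X.
Hypothesis mtau : measurable_fun setT tau.
Hypothesis tau_mu : forall A, measurable A -> mu (tau @^-1` A) = mu A.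

Lemma mp_ae (P : X -> Prop) : (\forall x \ae mu, P x) -> \forall x \ae mu, P (tau x).
Proof.
move=> [N [mN N0 PN]]; exists (tau @^-1` N); split.
- by rewrite -[X in measurable X]setTI; exact: mtau.
- by rewrite tau_mu.
- by move=> x /= nP; apply: PN.
Qed.

Lemma mp_ge0_integral (f : X -> \bar R) : measurable_fun setT f -> (forall x, 0 <= f x)%E ->
  (\int[mu]_x f (tau x) = \int[mu]_x f x)%E.
Proof.
move=> mf f0.
have := @ge0_integral_pushforward _ _ _ _ _ _ mtau mu setT f measurableT mf (fun x _ => f0 x).
rewrite preimage_setT => <-; apply: eq_measure_integral => // A mA _.
exact: tau_mu.
Qed.

Lemma mp_Lfun2 (f : X -> R) : f \in Lfun mu 2%:E -> f \o tau \in Lfun mu 2%:E.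
Proof.
move=> fL; have mf := Lfun2_measurable fL.
apply: sqint_Lfun2; first exact: measurableT_comp.
rewrite /sqint (mp_ge0_integral (f := fun x => ((f x) ^+ 2)%:E)).
- exact: Lfun2_sqint.
- exact: measurable_sq.
- by move=> x; rewrite lee_fin sqr_ge0.
Qed.

Lemma mp_qL2 (f : X -> quat R) : f \in qL2 mu -> f \o tau \in qL2 mu.
Proof.
move=> /and4P[f0 f1 f2 f3]; apply/and4P; split.
- exact: (mp_Lfun2 f0).
- exact: (mp_Lfun2 f1).
- exact: (mp_Lfun2 f2).
- exact: (mp_Lfun2 f3).
Qed.

Lemma mp_qdot (f g : X -> quat R) : f \in qL2 mu -> g \in qL2 mu ->
  \int[mu]_x qdot (f (tau x)) (g (tau x)) = \int[mu]_x qdot (f x) (g x).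
Proof.
move=> fL gL; have ifg := qdot_integrable fL gL.
have itau := qdot_integrable (mp_qL2 fL) (mp_qL2 gL).
congr fine; have mfg := measurable_int _ ifg.
have := @integral_pushforward _ _ _ _ _ _ mtau mu setT _ mfg itau measurableT.
rewrite preimage_setT => /esym ->; apply: eq_measure_integral => // A mA _.
exact: tau_mu.
Qed.

End measure_preserving.

Section translation.
Variable R : realType.

Lemma lebesgue_shift (a : R) (A : set (measurableTypeR R)) : measurable A ->
  lebesgue_measure ((fun x : measurableTypeR R => (x + a)%R : measurableTypeR R) @^-1` A) =
  lebesgue_measure A.
Proof.
move=> mA; apply/esym.
have ms : measurable_fun setT (fun x : measurableTypeR R => (x + a)%R : measurableTypeR R).
  by apply: measurable_funD.
apply: (@lebesgue_measure_unique R (pushforward lebesgue_measure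
  (fun x : measurableTypeR R => (x + a)%R : measurableTypeR R))) => //.
move=> _ [[b c] _ <-]; transitivity (lebesgue_measure (`]b - a, c - a]%classic : set R)).
  rewrite !lebesgue_measure_itv/= !lte_fin ltrD2r; case: ifP => // _.
  by rewrite -!EFinB; congr EFin; ring.
congr (lebesgue_measure _); apply/seteqP.
by split => x /=; rewrite !in_itv/= ltrBlDr lerBrDr.
Qed.

End translation.

Section product_preserving.
Context d1 d2 (X1 : measurableType d1) (X2 : measurableType d2) (R : realType).
Variables (m1 : {measure set X1 -> \bar R}) (m2 : {sigma_finite_measure set X2 -> \bar R}).
Variables (f1 : X1 -> X1) (f2 : X2 -> X2).
Hypotheses (mf1 : measurable_fun setT f1) (mf2 : measurable_fun setT f2).
Hypotheses (pf1 : forall A, measurable A -> m1 (f1 @^-1` A) = m1 A)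
           (pf2 : forall A, measurable A -> m2 (f2 @^-1` A) = m2 A).

Definition prod_map (x : X1 * X2) := (f1 x.1, f2 x.2).

Lemma measurable_prod_map : measurable_fun setT prod_map.
Proof.
by apply: measurable_fun_pair; apply: measurableT_comp.
Qed.

(** The section at [x] of the preimage is the preimage under [f2] of the section of [A] at [f1 x].
    So [f2] is used inside the integral of section measures and [f1] on the integral itself. *)
Lemma prod_map_preserving A : measurable A -> (m1 \x m2)%E (prod_map @^-1` A) = (m1 \x m2)%E A.
Proof.
move=> mA; rewrite /product_measure1.
transitivity (\int[m1]_x (m2 \o xsection A) (f1 x))%E; last first.
  by apply: (mp_ge0_integral mf1 pf1); first exact: measurable_fun_xsection.
apply: eq_integral => x _ /=.
rewrite -[RHS]pf2; last exact: measurable_xsection.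
by congr (m2 _); apply/seteqP; split => y; rewrite /xsection/= !inE.
Qed.

End product_preserving.

Section translation3.
Variable R : realType.
Notation R1 := (measurableTypeR R).
Notation R3 := (R1 * R1 * R1)%type.
Notation mu := (@lebesgue3 R).

Definition shift3 (a : R * R * R) (x : R3) : R3 := ((x : R * R * R) + a)%R.

Let sh (a : R) (x : R1) : R1 := (x + a)%R.

Let msh a : measurable_fun setT (sh a).
Proof. by apply: measurable_funD. Qed.

Let shiftE a : shift3 a = prod_map (prod_map (sh a.1.1) (sh a.1.2)) (sh a.2).
Proof. by []. Qed.

Lemma measurable_shift a : measurable_fun setT (shift3 a).
Proof. by rewrite shiftE; do ?apply: measurable_prod_map; exact: msh. Qed.

Let shp a (A : set R1) : measurable A -> lebesgue_measure (sh a @^-1` A) = lebesgue_measure A.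
Proof. exact: lebesgue_shift. Qed.

Lemma shift_preserving a A : measurable A -> mu (shift3 a @^-1` A) = mu A.
Proof.
have p2 := prod_map_preserving (m2 := @lebesgue_measure R)
  (msh a.1.1) (@shp a.1.1) (@shp a.1.2).
have m2 := measurable_prod_map (msh a.1.1) (msh a.1.2).
have p3 := prod_map_preserving (m2 := @lebesgue_measure R) m2 p2 (@shp a.2).
exact: p3.
Qed.

End translation3.

Section ae.
Context d (X : measurableType d) (R : realType) (mu : {measure set X -> \bar R}).

Lemma aeI (P Q : X -> Prop) : (\forall x \ae mu, P x) -> (\forall x \ae mu, Q x) ->
  \forall x \ae mu, P x /\ Q x.
Proof. exact: filterI. Qed.

Lemma aeS (P Q : X -> Prop) : (forall x, P x -> Q x) ->
  (\forall x \ae mu, P x) -> \forall x \ae mu, Q x.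
Proof. exact: filterS. Qed.

End ae.

Section operators.
Variable R : realType.
Notation mu := (@lebesgue3 R).
Notation V := (realL2 mu).
Implicit Types (u v : V) (a b : R * R * R) (p q : quat R).

Definition trans a v : V :=
  L2_class (mp_qL2 (measurable_shift a) (shift_preserving a) (L2_funP v)).

Lemma transE a v : \forall x \ae mu, L2_fun (trans a v) x = L2_fun v (shift3 a x).
Proof. exact: L2_classE. Qed.

Lemma ae_shift a (P : R * R * R -> Prop) :
  (\forall x \ae mu, P x) -> \forall x \ae mu, P (shift3 a x).
Proof. by apply: mp_ae; [exact: measurable_shift|exact: shift_preserving]. Qed.

Lemma realL2_addE u v : \forall x \ae mu, L2_fun (u + v) x = L2_fun u x + L2_fun v x.
Proof. exact: L2_addE. Qed.

Lemma realL2_lcE t u v : \forall x \ae mu, L2_fun (t *: u + v) x = t *: L2_fun u x + L2_fun v x.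
Proof. by apply: aeS (aeI (realL2_addE (t *: u) v) (rscaleL2E t u)) => x [-> ->]. Qed.

Lemma trans_lin a t u v : trans a (t *: u + v) = t *: trans a u + trans a v.
Proof.
apply: L2_eqP.
have := aeI (aeI (transE a (t *: u + v)) (@ae_shift a _ (realL2_lcE t u v)))
  (aeI (realL2_lcE t (trans a u) (trans a v)) (aeI (transE a u) (transE a v))).
by apply: aeS => x [[-> ->] [-> [-> ->]]].
Qed.

Lemma trans_trans a b v : trans a (trans b v) = trans (a + b) v.
Proof.
apply: L2_eqP.
have := aeI (transE a (trans b v)) (aeI (@ae_shift a _ (transE b v)) (transE (a + b) v)).
by apply: aeS => x [-> [-> ->]]; rewrite /shift3 addrA.
Qed.

Lemma trans0 v : trans 0 v = v.
Proof. by apply: L2_eqP; apply: aeS (transE 0 v) => x ->; rewrite /shift3 addr0. Qed.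

Lemma trans_rip a u v : rip (trans a u) (trans a v) = rip u v.
Proof.
have mp := mp_qL2 (measurable_shift a) (shift_preserving a).
rewrite (ripE (mp _ (L2_funP u)) (mp _ (L2_funP v)) (transE a u) (transE a v)).
exact: (mp_qdot (measurable_shift a) (shift_preserving a) (L2_funP u) (L2_funP v)).
Qed.

Lemma trans_adj a u v : rip (trans a u) v = rip u (trans (- a) v).
Proof. by rewrite -[in LHS](trans0 v) -(subrr a) -trans_trans trans_rip. Qed.

Definition lmul q v : V := L2_lmul q (v : L2 mu).

Lemma lmulE q v : \forall x \ae mu, L2_fun (lmul q v) x = q * L2_fun v x.
Proof. exact: L2_lmulE. Qed.

Lemma lmul_lin q t u v : lmul q (t *: u + v) = t *: lmul q u + lmul q v.
Proof.
apply: L2_eqP.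
have := aeI (aeI (lmulE q (t *: u + v)) (realL2_lcE t u v))
  (aeI (realL2_lcE t (lmul q u) (lmul q v)) (aeI (lmulE q u) (lmulE q v))).
apply: aeS => x [[-> ->] [-> [-> ->]]].
by rewrite mulrDr; congr (_ + _); apply: quatP => /=; ring.
Qed.

Lemma lmul_adj q u v : rip (lmul q u) v = rip u (lmul (conjq q) v).
Proof.
have uL := L2_funP u; have vL := L2_funP v.
rewrite (ripE (qL2_mull q uL) vL (lmulE q u) (aeW _ (fun x => erefl))).
rewrite (ripE uL (qL2_mull (conjq q) vL) (aeW _ (fun x => erefl)) (lmulE _ v)).
by apply: eq_Rintegral => x _; rewrite /qdot /=; ring.
Qed.

Lemma trans_lmul a q v : trans a (lmul q v) = lmul q (trans a v).
Proof.
apply: L2_eqP.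
have := aeI (aeI (transE a (lmul q v)) (@ae_shift a _ (lmulE q v)))
  (aeI (lmulE q (trans a v)) (transE a v)).
by apply: aeS => x [[-> ->] [-> ->]].
Qed.

Lemma lmul_lmul p q v : lmul p (lmul q v) = lmul (p * q) v.
Proof.
apply: L2_eqP.
have := aeI (lmulE p (lmul q v)) (aeI (lmulE q v) (lmulE (p * q) v)).
by apply: aeS => x [-> [-> ->]]; rewrite mulrA.
Qed.

Lemma lmulD p q v : lmul (p + q) v = lmul p v + lmul q v.
Proof.
apply: L2_eqP.
have := aeI (lmulE (p + q) v) (aeI (realL2_addE (lmul p v) (lmul q v)) (aeI (lmulE p v) (lmulE q v))).
by apply: aeS => x [-> [-> [-> ->]]]; rewrite mulrDl.
Qed.

Lemma lmul_real t v : lmul (t%:A) v = t *: v.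
Proof.
apply: L2_eqP; apply: aeS (aeI (lmulE (t%:A) v) (rscaleL2E t v)) => x [-> ->].
by rewrite mulr_algl.
Qed.

Lemma lmulN q v : lmul (- q) v = - lmul q v.
Proof.
apply/eqP; rewrite -subr_eq0 opprK -lmulD addNr; apply/eqP.
by have := lmul_real 0 v; rewrite !scale0r.
Qed.

Definition eE (i : 'I_3) : quat R := nth 0 [:: e1; e2; e3] i.
Definition bB (i : 'I_3) : R * R * R := nth 0 [:: @b1 R; @b2 R; @b3 R] i.

Lemma conj_eE i : conjq (eE i) = - eE i.
Proof. by case: i => [[|[|[|?]]]] // ?; apply: quatP; rewrite /eE /= ?oppr0. Qed.

Lemma eE_clifford (i j : 'I_3) : eE i * eE j + eE j * eE i = (- ((i == j)%:R * 2))%:A.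
Proof.
case: i => [[|[|[|?]]]] // ?; case: j => [[|[|[|?]]]] // ?; apply: quatP; rewrite /eE /=; ring.
Qed.

End operators.

(** * Smooth functions and test functions *)

Section smooth.
Variable R : realType.
Notation T3 := (R * R * R)%type.
Notation dirs := [:: @b1 R; @b2 R; @b3 R].
Implicit Types (phi psi : T3 -> R) (u x a : T3) (n : nat).

Lemma CnS n phi : Cn n.+1 phi -> Cn n phi.
Proof.
elim: n phi => [phi [c _]//|n IH phi [c h]]; split => // u ud.
by have [dphi /IH] := h u ud.
Qed.

Lemma CnW n phi : Cn n phi -> continuous phi.
Proof. by case: n => [|n] []. Qed.

Lemma CnD n phi psi : Cn n phi -> Cn n psi -> Cn n (phi + psi).
Proof.
elim: n phi psi => [phi psi [cp _] [cq _]|n IH phi psi [cp hp] [cq hq]].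
  by split => // x; apply: continuousD; [exact: cp|exact: cq].
split => [x|u ud]; first by apply: continuousD; [exact: cp|exact: cq].
have [dp np] := hp u ud; have [dq nq] := hq u ud.
split => [x|]; first exact: derivableD.
have -> : 'D_u (phi + psi) = 'D_u phi + 'D_u psi by apply/funext => x; exact: deriveD.
exact: IH.
Qed.

Lemma Cn_cst n (c : R) : Cn n (cst c : T3 -> R).
Proof.
elim: n c => [|n IH] c; first by split => // x; exact: cvg_cst.
split => [x|u ud]; first exact: cvg_cst.
split => [x|]; first exact: derivable_cst.
have -> : 'D_u (cst c : T3 -> R) = cst 0 by apply/funext => x; exact: derive_cst.
exact: IH.
Qed.

Lemma CnM n phi psi : Cn n phi -> Cn n psi -> Cn n (phi * psi).
Proof.
elim: n phi psi => [phi psi [cp _] [cq _]|n IH phi psi Cp Cq].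
  by split => // x; apply: continuousM; [exact: cp|exact: cq].
have [cp hp] := Cp; have [cq hq] := Cq.
split => [x|u ud]; first by apply: continuousM; [exact: cp|exact: cq].
have [dp np] := hp u ud; have [dq nq] := hq u ud.
split => [x|]; first exact: derivableM.
have -> : 'D_u (phi * psi) = phi * 'D_u psi + psi * 'D_u phi.
  by apply/funext => x; exact: deriveM.
by apply: CnD; apply: IH => //; exact: CnS.
Qed.

Lemma CnZ n (c : R) phi : Cn n phi -> Cn n (fun x => c * phi x).
Proof. exact: (CnM (Cn_cst n c)). Qed.

Lemma derivable_translate phi a x u :
  derivable phi (x + a) u -> derivable (fun y => phi (y + a)) x u.
Proof. by rewrite /derivable /=; under eq_fun do rewrite addrA. Qed.

Lemma derive_translate phi a x u : 'D_u (fun y => phi (y + a)) x = 'D_u phi (x + a).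
Proof.
rewrite /derive /=.
have -> : (fun h : R => h^-1 *: (phi (h *: u + x + a) - phi (x + a))) =
    (fun h : R => h^-1 *: (phi (h *: u + (x + a)) - phi (x + a))).
  by apply/funext => h; rewrite addrA.
by [].
Qed.

Lemma Cn_shift n phi a : Cn n phi -> Cn n (fun x => phi (x + a)).
Proof.
have cs : continuous (fun x : T3 => x + a).
  by move=> x; apply: continuousD; [exact: cvg_id|exact: cvg_cst].
elim: n phi => [phi [cp _]|n IH phi [cp hp]].
  by split => // x; exact: (@continuous_comp _ _ _ (fun x : T3 => x + a) phi x (cs x) (cp _)).
split => [x|u ud].
  exact: (@continuous_comp _ _ _ (fun x : T3 => x + a) phi x (cs x) (cp _)).
have [dp np] := hp u ud.
split => [x|]; first exact: derivable_translate.
rewrite (_ : 'D_u _ = (fun x => 'D_u phi (x + a))); first exact: (IH _ np).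
by apply/funext => x; exact: derive_translate.
Qed.

(** The successive derivatives are part of the data: [cos] and [flat 1] supply theirs in closed
    form, and composition with a coordinate or an affine map transports the whole sequence. *)
Definition smooth1 (g : R -> R) := exists2 gs : nat -> R -> R, gs 0%N = g &
  forall n (t : R), is_derive t 1 (gs n) (gs n.+1 t).

Definition pr (i : 'I_3) (x : T3) : R := nth 0 [:: x.1.1; x.1.2; x.2] i.

Lemma continuous_pr i : continuous (pr i).
Proof.
case: i => [[|[|[|?]]]] // hi x; rewrite /pr/=.
- exact: (@continuous_comp _ _ _ fst fst _ cvg_fst cvg_fst).
- exact: (@continuous_comp _ _ _ fst snd _ cvg_fst cvg_snd).
- exact: cvg_snd.
Qed.

Lemma pr_dir i u : u \in dirs -> pr i u = 1 \/ pr i u = 0.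
Proof.
rewrite !inE => /or3P[] /eqP ->; case: i => [[|[|[|?]]]] // hi; rewrite /pr/=;
  by [left|right].
Qed.

Lemma pr_lin i (h : R) u x : pr i (h *: u + x) = h * pr i u + pr i x.
Proof. by case: i => [[|[|[|?]]]]. Qed.

Lemma derive_pr i (g : R -> R) (dg : R) x u : is_derive (pr i x) 1 g dg ->
  u \in dirs -> is_derive x u (g \o pr i) (pr i u * dg).
Proof.
move=> [dgx dgE] ud; have [u1|u0] := pr_dir i ud; last first.
  have -> : g \o pr i = (fun x => g (pr i x)) by [].
  rewrite u0 mul0r; split.
    apply/cvg_ex; exists 0; apply: cvg_near_cst; apply: nearW => h /=.
    by rewrite pr_lin u0 mulr0 add0r subrr scaler0.
  apply: cvg_lim => //; apply: cvg_near_cst; apply: nearW => h /=.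
  by rewrite pr_lin u0 mulr0 add0r subrr scaler0.
have e : (fun h : R => h^-1 *: (g (pr i (h *: u + x)) - g (pr i x))) =
    (fun h : R => h^-1 *: (g (h *: 1 + pr i x) - g (pr i x))).
  by apply/funext => h; rewrite pr_lin u1.
rewrite u1 mul1r; split.
  by rewrite /derivable /= e; exact: dgx.
by rewrite -dgE /derive /= e.
Qed.

Lemma Cn_pr n i g : smooth1 g -> Cn n (g \o pr i).
Proof.
move=> [gs <- gsD].
have cg m : continuous (gs m).
  by move=> t; exact/differentiable_continuous/derivable1_diffP/ex_derive.
elim: n 0%N => [|n IH] m.
  split => // x; apply: continuous_comp; [exact: continuous_pr|exact: cg].
split => [x|u ud].
  apply: continuous_comp; [exact: continuous_pr|exact: cg].
have dx x := derive_pr (gsD m (pr i x)) ud.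
split => [x|]; first exact: ex_derive.
rewrite (_ : 'D_u _ = (fun x => pr i u * (gs m.+1 \o pr i) x)).
  by apply: CnZ; exact: IH.
by apply/funext => x; exact: derive_val.
Qed.

Definition smooth phi := forall n, Cn n phi.

Lemma smoothD phi psi : smooth phi -> smooth psi -> smooth (fun x => phi x + psi x).
Proof. by move=> hp hq n; exact: CnD. Qed.

Lemma smoothM phi psi : smooth phi -> smooth psi -> smooth (fun x => phi x * psi x).
Proof. by move=> hp hq n; exact: CnM. Qed.

Lemma smoothZ c phi : smooth phi -> smooth (fun x => c * phi x).
Proof. by move=> hp n; exact: CnZ. Qed.

Lemma smooth_derive u phi : u \in dirs -> smooth phi -> smooth ('D_u phi).
Proof. by move=> ud hp n; have [_ /(_ u ud)[]] := hp n.+1. Qed.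

Lemma smooth_is_derive u phi x : u \in dirs -> smooth phi -> is_derive x u phi ('D_u phi x).
Proof. by move=> ud hp; have [_ /(_ u ud)[dp _]] := hp 1%N; exact: derivableP. Qed.

End smooth.

(** * Measurability of Caratheodory functions *)

Section caratheodory.
Context d (X : measurableType d) (R : realType).
Notation R1 := (measurableTypeR R).

Lemma caratheodory_measurable (f : X -> R -> R) :
  (forall y, measurable_fun setT (f ^~ y)) -> (forall x, continuous (f x)) ->
  measurable_fun setT (fun z : X * R1 => f z.1 z.2).
Proof.
move=> mf cf.
(* [q n] rounds down to the grid of mesh [1 / n.+1]. Continuity in [y] gives [f x (q n y)] the limit
   [f x y]. *)
pose q n (y : R) : R := (Num.floor (y * n.+1%:R))%:~R / n.+1%:R.
have qP n y : `|y - q n y| <= n.+1%:R^-1.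
  have n0 : 0 < n.+1%:R :> R by [].
  have /andP[h1 h2] := mem_rg1_floor (y * n.+1%:R).
  have e : y - q n y = (y * n.+1%:R - (Num.floor (y * n.+1%:R))%:~R) * n.+1%:R^-1.
    by rewrite mulrBl mulfK// gt_eqF.
  rewrite e normrM (ger0_norm (ltW _ : 0 <= n.+1%:R^-1)) ?invr_gt0//.
  rewrite -[leRHS]mul1r ler_wpM2r ?invr_ge0 ?(ltW n0)//.
  by rewrite ger0_norm; move: h1 h2; move: (_%:~R) => z; lra.
apply: (@measurable_fun_cvg _ _ _ _ (fun n z => f z.1 (q n z.2))) => [n|[x y] _] /=; last first.
  have qc : q n y @[n --> \oo] --> y.
    apply/subr_cvg0/norm_cvg0P; apply: (squeeze_cvgr _ (cvg_cst 0) cvg_harmonic).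
    by apply: nearW => n; rewrite normr_ge0/= distrC; exact: qP.
  exact: (cvg_comp _ _ qc (cf x y)).
have n0 : 0 < n.+1%:R :> R by [].
move=> _ B mB; rewrite setTI.
(* On each strip between neighbouring grid values the function depends on the first variable only,
   so the preimage is a countable union of rectangles. *)
rewrite (_ : _ @^-1` B = \bigcup_(k : int)
    (((f ^~ (k%:~R / n.+1%:R)) @^-1` B) `*` (`[k%:~R / n.+1%:R, (k + 1)%:~R / n.+1%:R[%classic : set R))).
  apply: countable_bigcupT_measurable; first exact: countableP.
  move=> k; apply: measurableX => //.
  by rewrite -[X in measurable X]setTI; exact: mf.
apply/seteqP; split => [[x y] /= Bxy|[x y] [k _] [/= Bx]].
  exists (Num.floor (y * n.+1%:R)) => //; split => //=.
  by rewrite in_itv/= ler_pdivrMr// ltr_pdivlMr// floor_itv.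
rewrite in_itv/= ler_pdivrMr// ltr_pdivlMr// => /floor_def.
by rewrite /q => ->.
Qed.

End caratheodory.

Section bounded_support.
Variable R : realType.
Notation T3 := (R * R * R)%type.
Notation R1 := (measurableTypeR R).
Notation R3 := (R1 * R1 * R1)%type.
Notation mu := (@lebesgue3 R).
Notation dirs := [:: @b1 R; @b2 R; @b3 R].
Implicit Types (phi psi : T3 -> R) (u x a : T3) (n : nat).

Lemma continuous_measurable2 (psi : R * R -> R) : continuous psi ->
  measurable_fun setT (psi : R1 * R1 -> R).
Proof.
move=> cpsi.
have -> : psi = (fun w : R1 * R1 => (fun (x : R1) (y : R) => psi (x, y)) w.1 w.2).
  by apply/funext => -[x y].
apply: (@caratheodory_measurable _ R1 R (fun (x : R1) (y : R) => psi (x, y))) => [y|x y].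
  apply: continuous_measurable_fun => x.
  apply: (@continuous_comp _ _ _ (fun x : R => (x, y)) psi); last exact: cpsi.
  exact: (cvg_pair cvg_id (cvg_cst _)).
apply: (@continuous_comp _ _ _ (fun y : R => (x, y)) psi); last exact: cpsi.
exact: (cvg_pair (cvg_cst _) cvg_id).
Qed.

Lemma continuous_measurable3 phi : continuous phi -> measurable_fun setT (phi : R3 -> R).
Proof.
move=> cphi.
have -> : phi = (fun z : R3 => (fun (xy : R1 * R1) (z : R) => phi (xy, z)) z.1 z.2).
  by apply/funext => -[[x y] z].
apply: (@caratheodory_measurable _ (R1 * R1)%type R (fun xy z => phi (xy, z))) => [z|xy z].
  apply: (continuous_measurable2 (psi := fun xy => phi (xy, z))) => xy.
  apply: (@continuous_comp _ _ _ (fun xy : R * R => (xy, z)) phi); last exact: cphi.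
  exact: (cvg_pair cvg_id (cvg_cst _)).
apply: (@continuous_comp _ _ _ (fun z : R => (xy : R * R, z)) phi); last exact: cphi.
exact: (cvg_pair (cvg_cst _) cvg_id).
Qed.

Definition box (M : R) : set R3 := (`[- M, M]%classic `*` `[- M, M]%classic) `*` `[- M, M]%classic.

(** The norm of the product space is the maximum norm, whose closed balls are cubes. *)
Lemma boxP M (x : T3) : box M x <-> `|x| <= M.
Proof.
rewrite /box !prod_normE !ge_max /= !in_itv/= !ler_norml.
by split => [[[-> ->] ->]//|/andP[/andP[-> ->] ->]].
Qed.

Lemma measurable_box M : measurable (box M).
Proof. by do ?apply: measurableX. Qed.

Lemma box_compact M : compact (box M : set T3).
Proof. by do ?apply: compact_setX; exact: segment_compact. Qed.

Lemma lebesgue_segment M : 0 <= M -> lebesgue_measure (`[- M, M]%classic : set R) = (2 * M)%:E.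
Proof.
move=> M0; rewrite lebesgue_measure_itv/= lte_fin.
case: ltP => [_|h]; first by rewrite -EFinB; congr EFin; ring.
by congr EFin; lra.
Qed.

Lemma mu_box M : 0 <= M -> mu (box M) = ((2 * M) ^+ 3)%:E.
Proof.
move=> M0; pose I : set R1 := `[- M, M]%classic.
have mI : measurable I by exact: measurable_itv.
have eI : lebesgue_measure I = (2 * M)%:E by exact: lebesgue_segment.
have e2 : (lebesgue_measure \x lebesgue_measure)%E (I `*` I) = ((2 * M) ^+ 2)%:E.
  transitivity (lebesgue_measure I * lebesgue_measure I)%E; first exact: product_measure1E.
  by rewrite eI -EFinM.
transitivity ((lebesgue_measure \x lebesgue_measure)%E (I `*` I) * lebesgue_measure I)%E.
  by apply: product_measure1E => //; exact: measurableX.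
by rewrite e2 eI -EFinM -exprSr.
Qed.

(** Equivalent to compact support here, as [testP] uses, but stable under derivatives, products and
    shifts by direct estimates without closures. *)
Definition bsupp phi := exists M, forall x, M < `|x| -> phi x = 0.

Lemma bsupp_compact phi : bsupp phi -> compact (closure [set x | phi x != 0]).
Proof.
move=> [M phiM]; apply: (@subclosed_compact _ _ (box M)).
- exact: closed_closure.
- exact: box_compact.
- have -> : box M = closure (box M : set T3).
    apply/closure_id; have -> : box M = (fun x : T3 => `|x|) @^-1` [set y | y <= M].
      by apply/seteqP; split => x /boxP.
    by apply: preimage_closed => [x _|]; [exact: norm_continuous|exact: closed_le].
  apply: closureS => x /= /eqP phix; apply/boxP; rewrite leNgt; apply/negP.
  by move=> /phiM.
Qed.

Lemma compact_bsupp phi : compact (closure [set x | phi x != 0]) -> bsupp phi.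
Proof.
move=> /compact_bounded[M [_ hM]]; exists (M + 1) => x xM; apply/eqP/negPn/negP => phix.
have cx : closure [set x | phi x != 0] x by exact: subset_closure.
have := hM (M + 1) (ltac:(by rewrite ltrDl)) x cx.
by rewrite /= leNgt xM.
Qed.

Lemma testP phi : test_function phi <-> smooth phi /\ bsupp phi.
Proof.
split=> -[sphi cphi]; split => //; first exact: compact_bsupp.
exact: bsupp_compact.
Qed.

Lemma derive_eq0 phi u M : (forall x, M < `|x| -> phi x = 0) ->
  forall x, M < `|x| -> 'D_u phi x = 0.
Proof.
move=> phiM x xM; rewrite (@near_eq_derive _ _ _ _ (cst 0)) ?derive_cst//.
have h : \forall y \near x, M < `|y| by exact: (cvgr_norm_gt x cvg_id).
near=> y; apply: phiM; near: y; exact: h.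
Unshelve. all: by end_near.
Qed.

Lemma bsupp_derive phi u : bsupp phi -> bsupp ('D_u phi).
Proof. by move=> [M phiM]; exists M; exact: derive_eq0. Qed.

Lemma test_derive phi u : u \in dirs -> test_function phi -> test_function ('D_u phi).
Proof.
move=> ud /testP[sphi bphi]; apply/testP; split; first exact: smooth_derive.
exact: bsupp_derive.
Qed.

Lemma test_bounded phi : test_function phi -> exists2 M, 0 <= M & forall x, `|phi x| <= M.
Proof.
move=> /testP[sphi [N phiN]]; have cphi := CnW (sphi 0%N).
have /compact_bounded[M [_ hM]] : compact (phi @` box N).
  apply: continuous_compact; last exact: box_compact.
  exact: continuous_subspaceT.
exists (`|M| + 1); first by rewrite addr_ge0.
move=> x; have [xN|/phiN ->] := leP `|x| N; last by rewrite normr0 addr_ge0.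
apply: hM; last by exists x => //; apply/boxP.
by rewrite (le_lt_trans (ler_norm _))// ltrDl.
Qed.

Lemma sqint_box_le (f : R3 -> R) M N : 0 <= N -> (forall x, `|f x| <= M) ->
  (forall x : T3, N < `|x| -> f x = 0) -> measurable_fun setT f ->
  (sqint mu f <= (M ^+ 2 * (2 * N) ^+ 3)%:E)%E.
Proof.
move=> N0 fM fN mf.
have mb := measurable_box N.
apply: (@le_trans _ _ (\int[mu]_x ((M ^+ 2)%:E * (\1_(box N) x)%:E))%E).
  apply: ge0_le_integral => //.
  - by move=> x _; rewrite lee_fin sqr_ge0.
  - exact: measurable_sq.
  - by apply: emeasurable_funM => //; apply/measurable_EFinP; exact: measurable_indic.
  - move=> x _; rewrite -EFinM lee_fin.
    have [xN|xN] := leP `|x : T3| N.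
      rewrite indicE mem_set ?mulr1; last by apply/boxP.
      by rewrite -real_normK ?num_real// lerXn2r ?nnegrE// (le_trans _ (fM x)).
    by rewrite fN// expr0n mulr_ge0 ?sqr_ge0.
rewrite ge0_integralZl//; last 2 first.
- by apply/measurable_EFinP; exact: measurable_indic.
- by rewrite lee_fin sqr_ge0.
by rewrite integral_indic// setIT mu_box// -EFinM.
Qed.

Lemma test_Lfun2 phi : test_function phi -> (phi : R3 -> R) \in Lfun mu 2%:E.
Proof.
move=> tphi; have [M M0 phiM] := test_bounded tphi.
have /testP[sphi [N phiN]] := tphi.
have mphi := continuous_measurable3 (CnW (sphi 0%N)).
apply: sqint_Lfun2 => //.
apply: le_lt_trans (sqint_box_le (N := `|N|) _ phiM _ mphi) _ => //.
- by move=> x xN; apply: phiN; rewrite (le_lt_trans (ler_norm _)).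
- exact: ltry.
Qed.

Lemma test_add phi psi : test_function phi -> test_function psi ->
  test_function (fun x => phi x + psi x).
Proof.
move=> /testP[s1 [M1 h1]] /testP[s2 [M2 h2]]; apply/testP; split; first exact: smoothD.
exists (Num.max M1 M2) => x; rewrite gt_max => /andP[x1 x2].
by rewrite h1// h2// addr0.
Qed.

Lemma test_scale c phi : test_function phi -> test_function (fun x => c * phi x).
Proof.
move=> /testP[s1 [M1 h1]]; apply/testP; split; first exact: smoothZ.
by exists M1 => x xM; rewrite h1// mulr0.
Qed.

Lemma test_mul phi psi : smooth phi -> test_function psi ->
  test_function (fun x => phi x * psi x).
Proof.
move=> s1 /testP[s2 [M h]]; apply/testP; split; first exact: smoothM.
by exists M => x xM; rewrite h// mulr0.
Qed.

Lemma test_shift a phi : test_function phi -> test_function (fun x => phi (x + a)).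
Proof.
move=> /testP[s1 [M h]]; apply/testP; split; first by move=> n; exact: Cn_shift.
exists (M + `|a|) => x xM; apply: h.
have := ler_normB (x + a) a; rewrite addrK.
by move: xM (`|x + a|) => xM z h; rewrite -(ltrD2r `|a|); exact: lt_le_trans h.
Qed.

End bounded_support.

Section taylor.
Variable R : realType.
Notation T3 := (R * R * R)%type.
Notation R1 := (measurableTypeR R).
Notation R3 := (R1 * R1 * R1)%type.
Notation mu := (@lebesgue3 R).
Notation dirs := [:: @b1 R; @b2 R; @b3 R].
Implicit Types (phi : T3 -> R) (u : T3).

Lemma mean_value (g dg : R -> R) : (forall s : R, is_derive s 1 g (dg s)) ->
  forall s t, exists2 c, `|c - s| <= `|t - s| & g t - g s = dg c * (t - s).
Proof.
move=> gd; have cg : continuous g.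
  by move=> t; exact/differentiable_continuous/derivable1_diffP/ex_derive.
move=> s t; have [st|/ltW ts] := leP s t.
  have [|c] := @MVT_segment R g dg s t st (fun x _ => gd x).
    exact: continuous_subspaceT.
  rewrite in_itv/= => /andP[sc ct] e; exists c => //.
  by rewrite !ger0_norm ?subr_ge0// lerD2r.
have [|c] := @MVT_segment R g dg t s ts (fun x _ => gd x).
  exact: continuous_subspaceT.
rewrite in_itv/= => /andP[tc cs] e; exists c.
  by rewrite !ler0_norm ?subr_le0// lerN2 lerD2r.
by rewrite -[LHS]opprB e -mulrN opprB.
Qed.

Lemma smooth_line u phi (x : T3) (s : R) : u \in dirs -> smooth phi ->
  is_derive s 1 (fun s : R => phi (s *: u + x)) ('D_u phi (s *: u + x)).
Proof.
move=> ud sphi; have [dp dE] := smooth_is_derive (s *: u + x) ud sphi.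
have e : (fun h : R => h^-1 *: (phi ((h *: 1 + s) *: u + x) - phi (s *: u + x))) =
    (fun h : R => h^-1 *: (phi (h *: u + (s *: u + x)) - phi (s *: u + x))).
  by apply/funext => h; rewrite [h *: 1]mulr1 scalerDl addrA.
by split; rewrite ?/derivable ?/derive /= e.
Qed.

(** The mean value theorem is applied to [phi] along the line and then to its derivative. This gives
    [M] instead of the sharp [M / 2]. *)
Lemma smooth_taylor phi u (x : T3) (t M : R) : u \in dirs -> smooth phi ->
  (forall y, `|'D_u ('D_u phi) y| <= M) ->
  `|phi (x + t *: u) - phi x - t * 'D_u phi x| <= M * t ^+ 2.
Proof.
move=> ud sphi DM.
have [c c1 e1] := mean_value (fun s => smooth_line x s ud sphi) 0 t.
have [c' _ e2] := mean_value (fun s => smooth_line x s ud (smooth_derive ud sphi)) 0 c.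
rewrite scale0r add0r !subr0 in e1 e2 c1.
rewrite (_ : _ - _ = t * ('D_u ('D_u phi) (c' *: u + x) * c)); last first.
  by rewrite -e2 [x + _]addrC e1; ring.
rewrite !normrM mulrCA -(real_normK (num_real t)) expr2 ler_pM ?mulr_ge0//.
by rewrite ler_wpM2l.
Qed.

Lemma dir_norm u : u \in dirs -> `|u| = 1.
Proof.
by rewrite !inE => /or3P[] /eqP ->; rewrite !prod_normE /= ?normr0 ?normr1
  ?maxxx ?(max_l ler01) ?(max_r ler01) ?(max_l ler01).
Qed.

Lemma sqint_taylor phi u : u \in dirs -> test_function phi -> exists C, forall t : R, `|t| <= 1 ->
  (sqint mu (fun x : R3 => phi (shift3 (t *: u) x) - phi x - t * 'D_u phi x)%R <= (C * t ^+ 4)%:E)%E.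
Proof.
move=> ud tphi; have [sphi [N0 phiN0]] := (testP phi).1 tphi.
(* For [t] of modulus at most 1 the shifted function still vanishes outside this enlarged box. *)
pose N := `|N0| + 1; have N_ge0 : 0 <= N by rewrite addr_ge0.
have tD := test_derive ud tphi; have [M M0 DM] := test_bounded (test_derive ud tD).
exists (M ^+ 2 * (2 * N) ^+ 3) => t t1.
have cphi := CnW (sphi 0%N); have cD := CnW (smooth_derive ud sphi 0%N).
have phi0 (x : T3) : `|N0| < `|x| -> phi x = 0.
  by move=> xN; apply: phiN0; rewrite (le_lt_trans (ler_norm _)).
have D0 (x : T3) : `|N0| < `|x| -> 'D_u phi x = 0.
  move=> xN; rewrite (@near_eq_derive _ _ _ _ (cst 0)) ?derive_cst//.
  have h : \forall y \near x, `|N0| < `|y| by exact: (cvgr_norm_gt x cvg_id).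
  by near=> y; apply: phi0; near: y; exact: h.
apply: le_trans (sqint_box_le (M := M * t ^+ 2) N_ge0 _ _ _) _.
- by move=> x; exact: smooth_taylor.
- move=> x xN.
  have x1 : `|N0| < `|x : T3| by apply: le_lt_trans xN; rewrite lerDl.
  rewrite phi0; last first.
    have tu : `|t *: u| <= 1 by rewrite normrZ dir_norm// mulr1.
    have := ler_normB ((x : T3) + t *: u) (t *: u); rewrite addrK => h.
    rewrite -(ltrD2r 1); apply: lt_le_trans xN _.
    by apply: le_trans h _; rewrite lerD2l.
  by rewrite phi0// D0// mulr0 !subr0.
- apply: measurable_funB; first apply: measurable_funB.
  + exact: (continuous_measurable3 (CnW (Cn_shift (t *: u) (sphi 0%N)))).
  + exact: continuous_measurable3.
  + by apply: measurable_funM => //; exact: continuous_measurable3.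
- by rewrite lee_fin exprMn -exprM mulrAC.
Unshelve. all: by end_near.
Qed.

End taylor.

Section coordinates.
Variable R : realType.
Notation H := (quat R).
Implicit Types p q : H.

(** Indexing the components by a finite type lets real-valued facts extend to quaternionic functions
    by sums over [k]. *)
Definition co (k : 'I_4) q : R := nth 0 [:: qre q; qim1 q; qim2 q; qim3 q] k.
Definition ofco (c : 'I_4 -> R) : H :=
  Quat (c 0) (c 1) (c (inord 2)) (c (inord 3)).

Lemma ord4P (P : 'I_4 -> Prop) : P 0 -> P 1 -> P (inord 2) -> P (inord 3) -> forall k, P k.
Proof.
move=> p0 p1 p2 p3 [[|[|[|[|?]]]]] // hk.
- by rewrite (_ : Ordinal hk = 0)//; exact: val_inj.
- by rewrite (_ : Ordinal hk = 1)//; exact: val_inj.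
- by rewrite (_ : Ordinal hk = inord 2)//; apply: val_inj; rewrite /= inordK.
- by rewrite (_ : Ordinal hk = inord 3)//; apply: val_inj; rewrite /= inordK.
Qed.

Lemma co_ofco c k : co k (ofco c) = c k.
Proof. by move: k; apply: ord4P; rewrite /co /= ?inordK. Qed.

Lemma coP p q : (forall k, co k p = co k q) -> p = q.
Proof.
move=> pq; apply: quatP; [exact: (pq 0)|exact: (pq 1)| |].
- by have := pq (inord 2); rewrite /co inordK.
- by have := pq (inord 3); rewrite /co inordK.
Qed.

Lemma coD k p q : co k (p + q) = co k p + co k q.
Proof. by move: k; apply: ord4P; rewrite /co /= ?inordK. Qed.

Lemma coB k p q : co k (p - q) = co k p - co k q.
Proof. by move: k; apply: ord4P; rewrite /co /= ?inordK. Qed.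

Lemma coZ k t q : co k (t *: q) = t * co k q.
Proof. by move: k; apply: ord4P; rewrite /co /= ?inordK. Qed.

Lemma sum4 (V : zmodType) (F : 'I_4 -> V) :
  \sum_k F k = F 0 + F 1 + F (inord 2) + F (inord 3).
Proof.
rewrite !big_ord_recl big_ord0 addr0 !addrA; congr (_ + F _ + F _ + F _);
  by apply: val_inj; rewrite /= ?inordK.
Qed.

Lemma qdot_co p q : qdot p q = \sum_k co k p * co k q.
Proof. by rewrite sum4 /qdot /co /= !inordK. Qed.

Context d (X : measurableType d) (mu : {measure set X -> \bar R}).
Implicit Types f g : X -> H.

Lemma qL2_co f : f \in qL2 mu <-> forall k, co k \o f \in Lfun mu 2%:E.
Proof.
split=> [/and4P[f0 f1 f2 f3]|fk].
  by apply: ord4P; rewrite /co/= ?inordK.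
apply/and4P; split; [exact: (fk 0)|exact: (fk 1)| |].
- by have := fk (inord 2); rewrite /co inordK.
- by have := fk (inord 3); rewrite /co inordK.
Qed.

Lemma Lfun2_mul_integrable (a b : X -> R) : a \in Lfun mu 2%:E -> b \in Lfun mu 2%:E ->
  mu.-integrable setT (EFin \o (fun x => a x * b x)).
Proof. by move=> aL bL; apply/Lfun1_integrable/Lfun2_mul_Lfun1. Qed.

Lemma Rintegral_sum (I : finType) (F : I -> X -> R) :
  (forall k, mu.-integrable setT (EFin \o F k)) ->
  \int[mu]_x (\sum_k F k x) = \sum_k \int[mu]_x F k x.
Proof.
move=> iF; elim: (index_enum I) => [|k s IH].
  by rewrite big_nil; under eq_Rintegral do rewrite big_nil; rewrite Rintegral_cst// mul0r.
rewrite big_cons -IH; under eq_Rintegral do rewrite big_cons.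
rewrite RintegralD//.
rewrite (_ : _ \o _ = (fun x => \sum_(j <- s) (EFin \o F j) x)%E); last first.
  by apply/funext => x /=; rewrite sumEFin.
exact: integrable_sum.
Qed.

Lemma Rintegral_qdot f g : f \in qL2 mu -> g \in qL2 mu ->
  \int[mu]_x qdot (f x) (g x) = \sum_k \int[mu]_x (co k (f x) * co k (g x)).
Proof.
move=> /qL2_co fL /qL2_co gL; rewrite -Rintegral_sum.
  by apply: eq_Rintegral => x _; exact: qdot_co.
by move=> k; apply: (Lfun2_mul_integrable (fL k) (gL k)).
Qed.

Lemma sqint_qdot f : f \in qL2 mu ->
  ((\int[mu]_x qdot (f x) (f x))%:E = \sum_(k < 4) sqint mu (co k \o f))%E.
Proof.
move=> fL; rewrite qdot_sqint// !big_ord_recr big_ord0/= add0e.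
by [].
Qed.

End coordinates.

(** * Quaternion-valued test functions *)

Section tests.
Variable R : realType.
Notation T3 := (R * R * R)%type.
Notation R1 := (measurableTypeR R).
Notation R3 := (R1 * R1 * R1)%type.
Notation mu := (@lebesgue3 R).
Notation H := (quat R).
Notation V := (realL2 mu).
Notation dirs := [:: @b1 R; @b2 R; @b3 R].
Implicit Types (f g : T3 -> H) (u : T3) (v w : V) (i : 'I_3).

Definition qtest f := forall k, test_function (co k \o f).
Definition dq u f : T3 -> H := fun x => ofco (fun k => 'D_u (co k \o f) x).

Lemma bB_dir i : bB R i \in dirs.
Proof. by case: i => [[|[|[|?]]]] // hi; rewrite /bB/= !inE eqxx ?orbT. Qed.

Lemma co_dq k u f : co k \o dq u f = 'D_u (co k \o f).
Proof. by apply/funext => x /=; rewrite co_ofco. Qed.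

Lemma qtest_L2 f : qtest f -> (f : R3 -> H) \in qL2 mu.
Proof. by move=> tf; apply/qL2_co => k; exact: test_Lfun2 (tf k). Qed.

Lemma qtest_dq u f : u \in dirs -> qtest f -> qtest (dq u f).
Proof. by move=> ud tf k; rewrite co_dq; exact: test_derive. Qed.

Lemma qtest_lc t f g : qtest f -> qtest g -> qtest (fun x => t *: f x + g x).
Proof.
move=> tf tg k.
rewrite (_ : _ \o _ = (fun x => t * (co k \o f) x + (co k \o g) x)).
  by apply: test_add => //; exact: test_scale.
by apply/funext => x /=; rewrite coD coZ.
Qed.

Lemma qtest0 : qtest (fun=> 0).
Proof.
move=> k; apply/testP; rewrite (_ : _ \o _ = cst 0); last first.
  by apply/funext => x; move: k; apply: ord4P; rewrite /co /= ?inordK.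
by split; [move=> n; exact: Cn_cst|exists 0].
Qed.

Lemma qtest_shift a f : qtest f -> qtest (fun x => f (x + a)).
Proof. by move=> tf k; exact: (test_shift a (tf k)). Qed.

Definition Dt i v w := exists f, [/\ qtest f,
  \forall x \ae mu, L2_fun v x = f x & \forall x \ae mu, L2_fun w x = dq (bB R i) f x].

Lemma DtP i f v : qtest f -> (\forall x \ae mu, L2_fun v x = f x) -> exists w, Dt i v w.
Proof.
move=> tf vf; have tdf := qtest_dq (bB_dir i) tf.
exists (L2_class (qtest_L2 tdf)), f; split => //.
exact: L2_classE.
Qed.

Lemma Dt_subspace i : is_subspace [set phi | exists phi', Dt i phi phi'].
Proof.
split.
  apply: (DtP i qtest0).
  apply: aeS (rscaleL2E 0 (0 : V)) => x; rewrite !scale0r.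
  by [].
move=> t v w [v' [f [tf vf _]]] [w' [g [tg wg _]]].
apply: (DtP i (qtest_lc t tf tg)).
by apply: aeS (aeI (realL2_lcE t v w) (aeI vf wg)) => x [-> [-> ->]].
Qed.

Lemma Dt_trans i a v w : Dt i v w -> Dt i (trans a v) (trans a w).
Proof.
move=> [f [tf vf wf]]; exists (fun x => f (x + a)); split.
- exact: qtest_shift.
- by apply: aeS (aeI (transE a v) (@ae_shift _ a _ vf)) => x [-> ->].
- apply: aeS (aeI (transE a w) (@ae_shift _ a _ wf)) => x [-> ->].
  apply: coP => k; rewrite !co_ofco.
  have e : co k \o (fun y => f (y + a)) = (fun y => (co k \o f) (y + a)) by [].
  by rewrite e derive_translate.
Qed.

Lemma Dt_taylor i v w : Dt i v w -> exists C, forall t : R, `|t| <= 1 ->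
  rip (trans (t *: bB R i) v - v - t *: w) (trans (t *: bB R i) v - v - t *: w) <= C * t ^+ 4.
Proof.
move=> [f [tf vf wf]].
have /choice[C CP] := fun k => sqint_taylor (bB_dir i) (tf k).
exists (\sum_k C k) => t t1.
have fL := qtest_L2 tf; have dfL := qtest_L2 (qtest_dq (bB_dir i) tf).
have sfL := qtest_L2 (qtest_shift (t *: bB R i) tf).
pose F (x : R3) := f (shift3 (t *: bB R i) x) - f x - t *: dq (bB R i) f x.
have FL : F \in qL2 mu.
  by apply: qL2B; [exact: qL2B|exact: qL2Z].
have eF : \forall x \ae mu, L2_fun (trans (t *: bB R i) v - v - t *: w) x = F x.
  have h1 := L2_subE (trans (t *: bB R i) v - v : L2 mu) (t *: w : V).
  have h2 := L2_subE (trans (t *: bB R i) v : L2 mu) (v : L2 mu).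
  have h3 := aeI (transE (t *: bB R i) v) (@ae_shift _ (t *: bB R i) _ vf).
  have h4 := aeI (rscaleL2E t w) wf.
  by apply: aeS (aeI (aeI h1 h2) (aeI vf (aeI h3 h4))) => x [[-> ->] [-> [[-> ->] [-> ->]]]].
rewrite (ripE FL FL eF eF) -lee_fin (sqint_qdot FL) big_distrl/= -sumEFin.
apply: lee_sum => k _; apply: le_trans _ (CP k t t1).
rewrite le_eqVlt; apply/orP; left; apply/eqP; congr sqint; apply/funext => x.
by rewrite /= !coB coZ co_ofco.
Qed.

End tests.

(** * Test functions are total *)

Section flat_exponential.
Variable R : realType.
Implicit Types (p : {poly R}) (s t : R).

(* The polynomial factor makes the family closed under differentiation, see [flat_step]. *)
Definition flat p t : R := if 0 < t then p.[t^-1] * expR (- t^-1) else 0.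

(** Monomial by monomial: [s ^+ i <= i! * expR s], from the exponential series. *)
Lemma poly_expR_bounded p : exists C, forall s, 0 < s -> `|p.[s]| * expR (- s) <= C.
Proof.
exists (\sum_(i < size p) `|p`_i| * i`!%:R) => s s0.
rewrite horner_coef; apply: (@le_trans _ _ ((\sum_(i < size p) `|p`_i * s ^+ i|) * expR (- s))).
  by rewrite ler_wpM2r ?ler_norm_sum// ltW// expR_gt0.
rewrite mulr_suml; apply: ler_sum => i _.
rewrite normrM normrX (gtr0_norm s0) -mulrA ler_wpM2l// expRN ler_pdivrMr ?expR_gt0//.
case: i => -[|k] _ /=.
  by rewrite fact0 expr0 mul1r; apply: le_trans (expR_ge1Dx s); rewrite lerDl ltW.
rewrite -ler_pdivrMl ?ltr0n ?fact_gt0// mulrC.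
by apply: le_trans (expR_ge1Dxn k (ltW s0)); rewrite lerDr.
Qed.

(** With [s = 1/t], the derivative of [p(s) exp(-s)] in [t] is [s^2 (p(s) - p'(s)) exp(-s)]. *)
Definition flat_step p : {poly R} := 'X ^+ 2 * (p - p^`()).

Lemma flat_is_derive p t : is_derive t 1 (flat p) (flat (flat_step p) t).
Proof.
have [t0|t0|->] := ltgtP t 0.
- have e : \forall x \near t, cst 0 x = flat p x.
    near=> x; rewrite /flat ltNge (_ : x <= 0)//; apply: ltW; near: x.
    by apply: lt_nbhsl.
  rewrite [X in is_derive _ _ _ X]/flat ltNge (ltW t0)/=.
  split; first by apply: near_eq_derivable e _; exact: derivable_cst.
  by rewrite -(near_eq_derive _ e) derive_cst.
- have e : \forall x \near t, (fun x => p.[x^-1] * expR (- x^-1)) x = flat p x.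
    near=> x; rewrite /flat ifT//; near: x.
    by apply: lt_nbhsr.
  have d : is_derive t 1 (fun x => p.[x^-1] * expR (- x^-1)) (flat (flat_step p) t).
    have tn0 : t != 0 by rewrite gt_eqF.
    have dV : is_derive t 1 (fun x : R => x^-1) (- t ^- 2).
      split; first by apply: (@derivableV _ _ id) => //; exact: derivable_id.
      by rewrite (@deriveV _ _ id)// derive_id [_ *: _]mulr1.
    have dp := is_derive1_comp (is_derive_poly p t^-1) dV.
    have dN : is_derive t 1 (fun x : R => - x^-1) (- - t ^- 2) by exact: is_deriveN.
    have de := @is_derive1_comp R expR (fun x : R => - x^-1) t _ _ (is_derive_expR (- t^-1)) dN.
    apply: is_derive_eq (is_deriveM dp de) _.
    rewrite /flat t0 /flat_step !hornerE /GRing.scale /= -exprVn.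
    by ring.
  split; first by apply: near_eq_derivable e _; exact: ex_derive.
  by rewrite -(near_eq_derive _ e); exact: derive_val.
(* At 0 the difference quotient for [h > 0] is [h] times the value of ['X ^+ 2 * p] at [1/h] times
   [exp(-1/h)], hence at most [C * h] in modulus. *)
- have [C CP] := poly_expR_bounded ('X ^+ 2 * p).
  have c : (h^-1 *: (flat p (h *: 1 + 0) - flat p 0)) @[h --> 0^'] --> (0 : R).
    apply/cvgr0Pnorm_lt => e e0.
    have C1 : 0 < `|C| + 1 by rewrite ltr_wpDl.
    near=> h.
    have h0 : h != 0 by near: h; exact: nbhs_dnbhs_neq.
    have he : `|h| < e / (`|C| + 1) by near: h; apply: dnbhs0_lt; rewrite divr_gt0.
    rewrite [h *: 1]mulr1 addr0 /flat ltxx subr0 /GRing.scale /=.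
    case: (ltP 0 h) => [hp|_]; last by rewrite mulr0 normr0.
    have := CP h^-1; rewrite invr_gt0 => /(_ hp).
    rewrite hornerM hornerXn (normrM (h^-1 ^+ 2)) (ger0_norm (sqr_ge0 _)) => CP1.
    rewrite (normrM h^-1) (normrM p.[h^-1]) (gtr0_norm (expR_gt0 _)).
    have hV : 0 < h^-1 by rewrite invr_gt0.
    rewrite (gtr0_norm hV); rewrite gtr0_norm// in he.
    move: CP1; move: (`|p.[_]|) (expR _) => x y.
    rewrite -mulrA exprVn ler_pdivrMl ?exprn_gt0// => le.
    apply: (@le_lt_trans _ _ (h^-1 * (h ^+ 2 * C))); first by rewrite ler_wpM2l// ltW// invr_gt0.
    rewrite expr2 -mulrA mulKf//.
    apply: le_lt_trans (_ : _ <= h * (`|C| + 1)) _.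
      by rewrite ler_pM2l// (le_trans (ler_norm _))// lerDl.
    by rewrite -ltr_pdivlMr.
  rewrite [X in is_derive _ _ _ X]/flat ltxx.
  by split; [apply/cvg_ex; exists 0|exact: cvg_lim c].
Unshelve. all: by end_near.
Qed.

Lemma smooth1_flat : smooth1 (flat 1).
Proof.
by exists (fun n => flat (iter n flat_step 1)) => // n t; exact: flat_is_derive.
Qed.

End flat_exponential.

(** * Cutoff functions *)

Section cutoff.
Variable R : realType.
Notation T3 := (R * R * R)%type.
Notation dirs := [:: @b1 R; @b2 R; @b3 R].
Implicit Types (x u : T3) (s t : R).

Lemma flat_ge0 t : 0 <= flat (1 : {poly R}) t.
Proof. by rewrite /flat; case: ifP => // _; rewrite hornerE ?mul1r expR_ge0. Qed.

Lemma flat_gt0 t : 0 < t -> 0 < flat (1 : {poly R}) t.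
Proof. by move=> t0; rewrite /flat t0 hornerE ?mul1r expR_gt0. Qed.

Lemma flat_eq0 t : t <= 0 -> flat (1 : {poly R}) t = 0.
Proof. by move=> t0; rewrite /flat ltNge t0. Qed.

Lemma flat_le1 t : flat (1 : {poly R}) t <= 1.
Proof.
rewrite /flat; case: ifP => // t0; rewrite hornerE ?mul1r expRN invf_le1 ?expR_gt0//.
by rewrite -expR0 ler_expR invr_ge0 ltW.
Qed.

Lemma flat_mono s t : s <= t -> flat (1 : {poly R}) s <= flat 1 t.
Proof.
move=> st; have [s0|s0] := lerP s 0; first by rewrite (flat_eq0 s0) flat_ge0.
have t0 := lt_le_trans s0 st.
by rewrite /flat s0 t0 !hornerE ?mul1r ler_expR lerN2 lef_pV2 ?posrE.
Qed.

Lemma smooth1_affine c d (g : R -> R) : smooth1 g -> smooth1 (fun t => g (c * t + d)).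
Proof.
move=> [gs <- gsD]; exists (fun n t => c ^+ n * gs n (c * t + d)).
  by apply/funext => t; rewrite expr0 mul1r.
move=> n t.
have da : is_derive t 1 (fun t : R => c * t + d) c.
  apply: is_derive_eq (is_deriveD (is_deriveZ c (is_derive_id t 1)) (is_derive_cst d t 1)) _.
  by rewrite addr0 [_ *: _]mulr1.
have := is_deriveZ (c ^+ n) (@is_derive1_comp R (gs n) (fun t : R => c * t + d) t _ _ (gsD n (c * t + d)) da).
by move=> h; apply: is_derive_eq h _; rewrite /GRing.scale/= exprSr; ring.
Qed.

(** Supported in [[-2, 2]] and not normalised to a plateau of height 1: its positive lower bound on
    [[-1, 1]] serves all later estimates. *)
Definition bump t : R := flat 1 (2 - t) * flat 1 (2 + t).

Definition cutoff n x : R := \prod_(i < 3) bump (n.+1%:R^-1 * pr i x).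

Lemma smooth_prod (F : 'I_3 -> T3 -> R) : (forall i, smooth (F i)) ->
  smooth (fun x => \prod_(i < 3) F i x).
Proof.
move=> sF; rewrite (_ : (fun x => _) = (fun x => F ord0 x * F (lift ord0 ord0) x * F ord_max x)).
  by do !apply: smoothM.
apply/funext => x; rewrite !big_ord_recl big_ord0 mulr1 mulrA.
by congr (_ * F _ x); apply: val_inj.
Qed.

Lemma norm_pr x M : (`|x| <= M) = [forall i : 'I_3, `|pr i x| <= M].
Proof.
rewrite !prod_normE !ge_max; apply/andP/forallP => [[/andP[h1 h2] h3]|h].
  by case=> [[|[|[|?]]]].
have i1 : (1 < 3)%N by [].
by split; [apply/andP; split; [exact: (h ord0)|exact: (h (Ordinal i1))]|exact: (h ord_max)].
Qed.

Lemma smooth_flat_pr i c d : smooth (fun x => flat 1 (c * pr i x + d)).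
Proof.
move=> k; have := @Cn_pr _ k i _ (smooth1_affine c d (@smooth1_flat R)).
by congr Cn.
Qed.

Lemma smooth_cutoff n : smooth (cutoff n).
Proof.
apply: smooth_prod => i; apply: smoothM.
  rewrite (_ : (fun x => _) = (fun x => flat 1 (- n.+1%:R^-1 * pr i x + 2))).
    exact: smooth_flat_pr.
  by apply/funext => x; rewrite mulNr addrC.
rewrite (_ : (fun x => _) = (fun x => flat 1 (n.+1%:R^-1 * pr i x + 2))).
  exact: smooth_flat_pr.
by apply/funext => x; rewrite addrC.
Qed.

Lemma bump_eq0 t : 2 < `|t| -> bump t = 0.
Proof.
rewrite /bump ltr_normr => /orP[] h.
  by rewrite flat_eq0 ?mul0r//; lra.
by rewrite [X in _ * X]flat_eq0 ?mulr0//; lra.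
Qed.

Lemma bump_ge t : `|t| <= 1 -> flat (1 : {poly R}) 1 ^+ 2 <= bump t.
Proof.
rewrite ler_norml => /andP[h1 h2].
by rewrite expr2 ler_pM ?flat_ge0// flat_mono//; lra.
Qed.

Lemma cutoff_eq0 n x : 2 * n.+1%:R < `|x| -> cutoff n x = 0.
Proof.
rewrite ltNge norm_pr negb_forall => /existsP[i]; rewrite -ltNge => h.
apply/eqP; rewrite prodf_seq_eq0; apply/hasP; exists i; first exact: mem_index_enum.
rewrite /= bump_eq0// normrM normfV normr_nat mulrC ltr_pdivlMr//.
Qed.

Lemma cutoff_ge n x : `|x| <= n.+1%:R -> (flat (1 : {poly R}) 1 ^+ 2) ^+ 3 <= cutoff n x.
Proof.
rewrite norm_pr => /forallP h.
rewrite (_ : _ ^+ 3 = \prod_(i < 3) flat (1 : {poly R}) 1 ^+ 2); last first.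
  by rewrite prodr_const card_ord.
apply: ler_prod => i _; rewrite exprn_ge0 ?flat_ge0//= bump_ge//.
by rewrite normrM normfV normr_nat mulrC ler_pdivrMr// mul1r.
Qed.

Lemma cutoff_test n : test_function (cutoff n).
Proof.
apply/testP; split; first exact: smooth_cutoff.
by exists (2 * n.+1%:R) => x; exact: cutoff_eq0.
Qed.

Lemma pr_scale i c x : pr i (c *: x) = c * pr i x.
Proof. by case: i => [[|[|[|?]]]]. Qed.

Lemma cutoffE n x : cutoff n x = cutoff 0 (n.+1%:R^-1 *: x).
Proof. by apply: eq_bigr => i _; rewrite invr1 mul1r pr_scale. Qed.

Lemma derive_cutoff n u x : u \in dirs ->
  'D_u (cutoff n) x = n.+1%:R^-1 * 'D_u (cutoff 0) (n.+1%:R^-1 *: x).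
Proof.
move=> ud; set c := n.+1%:R^-1.
(* Both sides are read as derivatives along a line, where [cutoff n] is [cutoff 0] after the
   substitution [s -> c * s], so the one-variable chain rule applies. *)
have l1 := smooth_line x 0 ud (smooth_cutoff n).
have l2 := smooth_line (c *: x) 0 ud (smooth_cutoff 0).
rewrite scale0r add0r in l1.
rewrite -(mulr0 c) in l2.
have ds : is_derive (0 : R) 1 (fun s => c * s) c.
  by apply: is_derive_eq (is_deriveZ c (is_derive_id _ _)) _; rewrite [_ *: _]mulr1.
have := @is_derive1_comp R (fun s => cutoff 0 (s *: u + c *: x)) (fun s => c * s) 0 _ _ l2 ds.
rewrite mulr0 scale0r add0r => l3.
rewrite (_ : (fun s => cutoff n (s *: u + x)) =
  (fun s => cutoff 0 (s *: u + c *: x)) \o *%R c) in l1; last first.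
  by apply/funext => s; rewrite cutoffE /= scalerDr scalerA.
by rewrite -[LHS](@derive_val _ _ _ _ _ _ _ l1) mulrC -[RHS](@derive_val _ _ _ _ _ _ _ l3).
Qed.

Lemma derive_cutoff_le : exists2 K, 0 <= K &
  forall n u x, u \in dirs -> `|'D_u (cutoff n) x| <= K / n.+1%:R.
Proof.
have h u : u \in dirs -> exists2 M, 0 <= M & forall x, `|'D_u (cutoff 0) x| <= M.
  by move=> ud; exact: test_bounded (test_derive ud (cutoff_test 0)).
have [M1 M10 h1] := h (b1 R) (ltac:(by rewrite !inE eqxx)).
have [M2 M20 h2] := h (b2 R) (ltac:(by rewrite !inE eqxx orbT)).
have [M3 M30 h3] := h (b3 R) (ltac:(by rewrite !inE eqxx !orbT)).
exists (M1 + M2 + M3); first by rewrite !addr_ge0.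
move=> n u x ud; rewrite derive_cutoff// normrM normfV normr_nat mulrC.
rewrite ler_wpM2r// ?invr_ge0//.
move: ud; rewrite !inE => /or3P[] /eqP ->.
- by apply: le_trans (h1 _) _; rewrite -addrA lerDl addr_ge0.
- by apply: le_trans (h2 _) _; rewrite addrAC lerDr addr_ge0.
- by apply: le_trans (h3 _) _; rewrite lerDr addr_ge0.
Qed.

End cutoff.

(** * Generators of the product sigma-algebra and their smooth approximation *)

Section rays.
Variable R : realType.
Notation R1 := (measurableTypeR R).

(** As both generating families contain the whole space, the cylinders over generators are
    rectangles of the family, which makes the two projections measurable. *)
Lemma measurable_prod_generated d1 d2 (T1 : measurableType d1) (T2 : measurableType d2)
    (G1 : set (set T1)) (G2 : set (set T2)) :
  @measurable _ T1 = <<s G1 >> -> @measurable _ T2 = <<s G2 >> -> G1 setT -> G2 setT ->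
  @measurable _ (T1 * T2)%type = <<s [set A `*` B | A in G1 & B in G2] >>.
Proof.
move=> e1 e2 G1T G2T; set G := [set _ | _ in _ & _ in _].
rewrite measurable_prod_measurableType eqEsubset; split.
  apply: smallest_sub; first exact: smallest_sigma_algebra.
  move=> _ [A mA] [B mB] <-.
  have m1 : @measurable_fun _ _ (g_sigma_algebraType G) T1 setT fst.
    apply: (@measurability _ _ (g_sigma_algebraType G) _ _ _ _ e1) => _ [C G1C <-]; apply: sub_sigma_algebra.
    by exists C => //; exists setT => //; rewrite setTI; apply/seteqP; split=> [x []|x]//; split.
  have m2 : @measurable_fun _ _ (g_sigma_algebraType G) T2 setT snd.
    apply: (@measurability _ _ (g_sigma_algebraType G) _ _ _ _ e2) => _ [C G2C <-]; apply: sub_sigma_algebra.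
    by exists setT => //; exists C => //; rewrite setTI; apply/seteqP; split=> [x []|x]//; split.
  have := measurableI _ _ (m1 measurableT _ mA) (m2 measurableT _ mB).
  rewrite !setTI => h; suff -> : A `*` B = fst @^-1` A `&` snd @^-1` B by exact: h.
  by apply/seteqP; split=> x [].
apply: sub_smallest2r => // ? [A G1A] [B G2B] <-.
exists A; first by rewrite e1; exact: sub_sigma_algebra.
by exists B => //; rewrite e2; exact: sub_sigma_algebra.
Qed.

(** An intersection-stable generating family whose indicators are limits of smooth functions; the
    whole line is included for [measurable_prod_generated]. *)
Definition rays : set (set R1) := [set A | A = setT \/ exists a, A = `]a, +oo[%classic].

Lemma measurable_rays : @measurable _ R1 = <<s rays >>.
Proof.
rewrite -[LHS]/(@ocitv R).-sigma.-measurable RGenOInfty.measurableE eqEsubset; split.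
  by apply: sub_smallest2r => // A [a ->]; right; exists a.
apply: smallest_sub; first exact: smallest_sigma_algebra.
by move=> A [->|[a ->]]; [exact: measurableT|apply: sub_sigma_algebra; exists a].
Qed.

Lemma raysI : setI_closed rays.
Proof.
move=> A B [->|[a ->]] [->|[b ->]]; rewrite ?setTI ?setIT.
- by left.
- by right; exists b.
- by right; exists a.
- right; exists (Num.max a b); apply/seteqP; split=> x /=;
    rewrite !in_itv/= !andbT gt_max => /andP//.
Qed.

(** For [t > a] the functions are [exp (- 1 / (n.+1 * (t - a)))], which tend to 1; for [t <= a] they
    vanish. Openness of the ray matches the value 0 at [a]. *)
Lemma ray_approx A : rays A -> exists h : nat -> R -> R,
  [/\ forall n i, smooth (h n \o pr i), forall n t, 0 <= h n t <= 1 &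
      forall t, h n t @[n --> \oo] --> (\1_A t : R)].
Proof.
move=> [->|[a ->]].
  exists (fun _ _ => 1); split => [n i k|n t|t].
  - exact: Cn_cst.
  - by rewrite ler01 lexx.
  - by rewrite indicT; exact: cvg_cst.
exists (fun n t => flat 1 (n.+1%:R * t + - (n.+1%:R * a))); split => [n i|n t|t].
- exact: smooth_flat_pr.
- by rewrite flat_ge0 flat_le1.
rewrite indicE; have [ta|ta] := boolP (t \in _); last first.
  apply: cvg_near_cst; apply: nearW => n; rewrite flat_eq0//.
  rewrite -mulrBr pmulr_rle0// subr_le0 leNgt.
  by apply: contra ta => at_; rewrite inE/= in_itv/= at_.
have {}ta : 0 < t - a by move: ta; rewrite inE/= in_itv/= andbT subr_gt0.
rewrite (_ : (fun n : nat => _) = (fun n : nat => expR (- (n.+1%:R^-1 * (t - a)^-1)))).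
  rewrite (_ : true%:R = expR (- (0 * (t - a)^-1)) :> R); last by rewrite mul0r oppr0 expR0.
  apply: continuous_cvg; first exact: continuous_expR.
  by apply: cvgN; apply: cvgMr_tmp; exact: cvg_harmonic.
apply/funext => n; rewrite /flat -mulrBr pmulr_rgt0// ta hornerE.
by rewrite ?mul1r invfM.
Qed.

End rays.

(** * Integrable functions orthogonal to smooth functions *)

Section totality.
Variable R : realType.
Notation T3 := (R * R * R)%type.
Notation R1 := (measurableTypeR R).
Notation R3 := (R1 * R1 * R1)%type.
Notation mu := (@lebesgue3 R).

Let boxes : set (set R3) := [set A `*` B |
  A in [set A `*` B | A in @rays R & B in @rays R] & B in @rays R].

Let rays_setT : @rays R setT. Proof. by left. Qed.

Let measurable_boxes : @measurable _ R3 = <<s boxes >>.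
Proof.
apply: measurable_prod_generated => //; last 1 first.
- by exists setT => //; exists setT => //; rewrite setXTT.
- by apply: measurable_prod_generated => //; exact: measurable_rays.
- exact: measurable_rays.
Qed.

Let boxesI : setI_closed boxes.
Proof.
move=> _ _ [_ [A Ar [B Br <-]] [C Cr <-]] [_ [A' Ar' [B' Br' <-]] [C' Cr' <-]].
rewrite -!setXI; exists ((A `&` A') `*` (B `&` B')); last first.
  by exists (C `&` C') => //; exact: raysI.
by exists (A `&` A'); [exact: raysI|exists (B `&` B') => //; exact: raysI].
Qed.

Lemma box_approx S : boxes S -> exists h : nat -> T3 -> R,
  [/\ forall n, smooth (h n), forall n x, 0 <= h n x <= 1 &
      forall x, h n x @[n --> \oo] --> (\1_S x : R)].
Proof.
move=> [_ [A Ar [B Br <-]] [C Cr <-]].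
have [a [sa a01 la]] := ray_approx Ar; have [b [sb b01 lb]] := ray_approx Br.
have [c [sc c01 lc]] := ray_approx Cr.
exists (fun n x => a n x.1.1 * b n x.1.2 * c n x.2); split => [n|n x|x].
- have i1 : (1 < 3)%N by [].
  apply: smoothM; last exact: (sc n ord_max).
  by apply: smoothM; [exact: (sa n ord0)|exact: (sb n (Ordinal i1))].
- have /andP[? ?] := a01 n x.1.1; have /andP[? ?] := b01 n x.1.2.
  have /andP[? ?] := c01 n x.2.
  by rewrite !mulr_ge0//= !mulr_ile1// mulr_ge0.
- rewrite (_ : \1_ _ x = \1_A x.1.1 * \1_B x.1.2 * \1_C x.2 :> R).
    by apply: cvgM; [apply: cvgM; [exact: la|exact: lb]|exact: lc].
  by rewrite !indicE !in_setX/= -!natrM !mulnb.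
Qed.

Variable g : R3 -> R.
Hypothesis ig : mu.-integrable setT (EFin \o g).
Hypothesis g0 : forall psi, smooth psi -> (forall x, 0 <= psi x <= 1) ->
  (\int[mu]_x (g x * psi x)%:E = 0)%E.

Let mg : measurable_fun setT g.
Proof. by apply/measurable_EFinP; exact: measurable_int ig. Qed.

(** Dominated convergence with majorant [|g|]: since [g] is integrable, the smooth factors may have
    unbounded support. *)
Let integral_boxes S : boxes S -> (\int[mu]_(x in S) (g x)%:E = 0)%E.
Proof.
move=> bS; have [h [sh h01 hS]] := box_approx bS.
have mS : measurable S by rewrite measurable_boxes; exact: sub_sigma_algebra.
have mh n : measurable_fun setT (h n : R3 -> R).
  exact: continuous_measurable3 (CnW (sh n 0%N)).
have mgS : measurable_fun setT (fun x => (g x * \1_S x)%:E).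
  by apply/measurable_EFinP; apply: measurable_funM => //; exact: measurable_indic.
have hae : {ae mu, forall x, setT x -> (g x * h n x)%:E @[n --> \oo] --> (g x * \1_S x)%:E}.
  apply: aeW => x _; apply: cvg_EFin; first exact: nearW.
  by apply: cvgMl_tmp; exact: hS.
have hle : {ae mu, forall x n, setT x -> (`|(g x * h n x)%:E| <= (abse \o (EFin \o g)) x)%E}.
  apply: aeW => x n _; rewrite lee_fin normrM; have /andP[p q] := h01 n x.
  by rewrite (ger0_norm p) ler_piMr.
have [_ _] := @dominated_convergence _ _ R mu setT measurableT
  (fun n x => (g x * h n x)%:E) (fun x => (g x * \1_S x)%:E) (abse \o (EFin \o g))
  (fun n => (measurable_EFinP _ _).2 (measurable_funM mg (mh n)))
  mgS hae (integrable_abse ig) hle.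

rewrite [X in X @ _ --> _](_ : _ = cst 0%E); last first.
  by apply/funext => n; rewrite /= g0.
move=> /(cvg_unique _ (cvg_cst _)) z.
transitivity (\int[mu]_x (g x * \1_S x)%:E)%E; last exact/esym/(z (@ereal_hausdorff R)).
rewrite integral_mkcond; apply: eq_integral => x _.
by rewrite patchE indicE; case: ifP => _; rewrite ?mulr1 ?mulr0.
Qed.

(** Dynkin's pi-lambda argument, starting from the intersection-stable family [boxes]. *)
Let integral_all S : measurable S -> (\int[mu]_(x in S) (g x)%:E = 0)%E.
Proof.
have T0 : (\int[mu]_(x in setT) (g x)%:E = 0)%E.
  apply: integral_boxes; exists setT => //; last by exists setT => //; rewrite setXTT.
  by exists setT => //; exists setT => //; rewrite setXTT.
rewrite measurable_boxes; move: S.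
apply: (dynkin_induction measurable_boxes boxesI T0 integral_boxes).
  move=> S mS S0.
  have := @integral_setU _ _ _ mu S (~` S) (EFin \o g) mS (measurableC mS).
  rewrite setUv T0 /= S0 add0e => <- //; first exact: measurable_int ig.
  exact/disj_setPCl.
move=> F mF tF F0; rewrite integral_bigcup//.
  by apply: eseries0 => n _ _; rewrite F0.
by apply: integrableS ig => //; exact: bigcup_measurable.
Qed.

Lemma ae_eq0_of_smooth : \forall x \ae mu, g x = 0.
Proof.
have h E : E `<=` setT -> measurable E ->
    (\int[mu]_(x in E) (EFin \o g) x = \int[mu]_(x in E) cst 0 x)%E.
  by move=> _ mE; rewrite integral_all// integral0.
have := integral_ae_eq measurableT ig (measurable_cst _) h.
by apply: aeS => x /(_ I)[].
Qed.

End totality.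

Section test_functions_total.
Variable R : realType.
Notation T3 := (R * R * R)%type.
Notation R1 := (measurableTypeR R).
Notation R3 := (R1 * R1 * R1)%type.
Notation mu := (@lebesgue3 R).

(** A square-integrable [f] need not be integrable, but [f * cutoff n] is, and [cutoff n] times a
    smooth function is a test function. So each [f * cutoff n] vanishes almost everywhere. *)
Lemma test_ae_eq0 (f : R3 -> R) : f \in Lfun mu 2%:E ->
  (forall phi, test_function phi -> \int[mu]_x (f x * phi x) = 0) ->
  \forall x \ae mu, f x = 0.
Proof.
move=> fL f0.
have fN n : \forall x \ae mu, f x * cutoff n x = 0.
  have cL : (cutoff n : R3 -> R) \in Lfun mu 2%:E := test_Lfun2 (cutoff_test R n).
  apply: ae_eq0_of_smooth; first exact: Lfun2_mul_integrable.
  move=> psi spsi psi01; have tp := test_mul spsi (cutoff_test R n).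
  have := f0 _ tp; rewrite /Rintegral => e.
  rewrite -[LHS]fineK; last first.
    apply: integrable_fin_num => //.
    have := Lfun2_mul_integrable fL (test_Lfun2 tp).
    by congr integrable; apply/funext => x /=; rewrite mulrA mulrAC.
  congr (_%:E); rewrite -[RHS]e; congr fine; apply: eq_integral => x _.
  by rewrite mulrA mulrAC.
have := negligible_bigcup fN.
(* With [n] the integer part of [|x|] one has [|x| <= n.+1], where [cutoff n] is positive. *)
apply: negligibleS => x /= fx; exists (Num.truncn `|x|) => // /eqP.
rewrite mulf_eq0 => /orP[/eqP//|/eqP c0]; have := @cutoff_ge R (Num.truncn `|x|) x.
rewrite c0 => /(_ _)/wrap[|]; first by rewrite ltW// truncnS_gt.
by rewrite leNgt !exprn_gt0// flat_gt0.
Qed.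

Notation V := (realL2 mu).
Notation H := (quat R).
Implicit Types (u v w : V) (i : 'I_3) (k : 'I_4) (phi : T3 -> R).

Lemma coN k (q : H) : co k (- q) = - co k q.
Proof. by rewrite -scaleN1r coZ mulN1r. Qed.

Lemma co0 k : co k (0 : H) = 0.
Proof. by rewrite -[X in co k X](scale0r 0) coZ mul0r. Qed.

Lemma co_qintegral k (f : R3 -> H) : co k (qintegral mu f) = \int[mu]_x co k (f x).
Proof. by move: k; apply: ord4P; rewrite /co /= ?inordK. Qed.

Definition single k phi (x : T3) : H := ofco (fun j => if j == k then phi x else 0).

Lemma qdot_single q k phi x : qdot q (single k phi x) = co k q * phi x.
Proof.
rewrite qdot_co (bigD1 k)//= co_ofco eqxx big1 ?addr0// => j jk.
by rewrite co_ofco (negPf jk) mulr0.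
Qed.

Lemma qtest_single k phi : test_function phi -> qtest (single k phi).
Proof.
move=> tphi j; rewrite (_ : _ \o _ = if j == k then phi else cst 0).
  case: ifP => // _; have := @qtest0 R k; congr test_function.
  by apply/funext => x; rewrite /= co0.
by apply/funext => x /=; rewrite co_ofco; case: ifP.
Qed.

Lemma dq_single (a : T3) k phi x : dq a (single k phi) x = single k ('D_a phi) x.
Proof.
apply: coP => j; rewrite !co_ofco.
rewrite (_ : _ \o _ = if j == k then phi else cst 0).
  by case: ifP => // _; rewrite derive_cst.
by apply/funext => y /=; rewrite co_ofco; case: ifP.
Qed.

Lemma co_L2 k v : co k \o L2_fun v \in Lfun mu 2%:E.
Proof. by have /qL2_co := L2_funP v. Qed.

Lemma Dt_single i k phi : test_function phi -> exists p q, [/\ Dt i p q,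
  forall v, rip v p = \int[mu]_x (co k (L2_fun v x) * phi x) &
  forall v, rip v q = \int[mu]_x (co k (L2_fun v x) * 'D_(bB R i) phi x)].
Proof.
move=> tphi; have tf := qtest_single k tphi; have tD := qtest_dq (bB_dir R i) tf.
exists (L2_class (qtest_L2 tf)), (L2_class (qtest_L2 tD)); split.
- by exists (single k phi); split => //; exact: L2_classE.
- move=> v; rewrite (ripE (L2_funP v) (qtest_L2 tf) (aeW _ (fun=> erefl)) (L2_classE _)).
  by apply: eq_Rintegral => x _; rewrite qdot_single.
- move=> v; rewrite (ripE (L2_funP v) (qtest_L2 tD) (aeW _ (fun=> erefl)) (L2_classE _)).
  by apply: eq_Rintegral => x _; rewrite dq_single qdot_single.
Qed.

Lemma Dt_total i : total_set (ip := @rip _ _ _ mu) [set p | exists q, Dt i p q].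
Proof.
move=> u u0.
have uk k : \forall x \ae mu, co k (L2_fun u x) = 0.
  apply: (test_ae_eq0 (co_L2 k u)) => phi tphi.
  by have [p [q [Dpq <- _]]] := Dt_single i k tphi; apply: u0; exists q.
apply: (@L2_eqP _ _ _ mu u 0).
have h := aeI (aeI (uk 0) (uk 1)) (aeI (uk (inord 2)) (uk (inord 3))).
have z := rscaleL2E 0 (0 : V).
apply: aeS (aeI h z) => x [[[k0 k1] [k2 k3]]]; rewrite !scale0r => ->.
by apply: coP; apply: ord4P; rewrite ?k0 ?k1 ?k2 ?k3 co0.
Qed.

Lemma weak_derivP i v w : weak_deriv (bB R i) v w <-> forall k phi, test_function phi ->
  \int[mu]_x (co k (L2_fun v x) * 'D_(bB R i) phi x) = - \int[mu]_x (co k (L2_fun w x) * phi x).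
Proof.
have e k psi (a : V) : co k (qintegral mu (fun x => psi x *: L2_fun a x)) =
    \int[mu]_x (co k (L2_fun a x) * psi x).
  by rewrite co_qintegral; apply: eq_Rintegral => x _; rewrite coZ mulrC.
split=> [vw k phi tphi|vw phi tphi].
  by have /(congr1 (co k)) := vw phi tphi; rewrite coN !e.
by apply: coP => k; rewrite coN !e vw.
Qed.

(** The abstract notion pairs with quaternion-valued tests in the real product, the concrete one
    integrates against real-valued tests with values in H. Both amount to the same identities
    between the four components. *)
Lemma weakdP i v w : weakd (ip := @rip _ _ _ mu) (Dt := @Dt R) i v w <-> weak_deriv (bB R i) v w.
Proof.
rewrite weak_derivP; split=> [vw k phi tphi|vw p q [f [tf pf qf]]].
  by have [p [q [Dpq <- <-]]] := Dt_single i k tphi; exact: vw.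
have fL := qtest_L2 tf; have dL := qtest_L2 (qtest_dq (bB_dir R i) tf).
rewrite (ripE (L2_funP v) dL (aeW _ (fun=> erefl)) qf) (ripE (L2_funP w) fL (aeW _ (fun=> erefl)) pf).
rewrite !Rintegral_qdot ?L2_funP// -sumrN; apply: eq_bigr => k _.
rewrite -[RHS](vw k _ (tf k)); apply: eq_Rintegral => x _.
by rewrite -[co k (dq _ _ x)]/((co k \o dq _ _) x) co_dq.
Qed.

End test_functions_total.

(** * The nabla operator *)

(** Integration by parts between test vectors: the quotients are skew and converge in norm on both
    vectors. *)
Lemma Dt_weakd (R : realType) (V : lmodType R) (ip : V -> V -> R) (I : finType)
    (E : I -> V -> V) (S : I -> R -> V -> V) (Dt : I -> V -> V -> Prop) i v w :
  hilbert_form ip -> clifford_calculus ip E S Dt -> Dt i v w ->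
  weakd (ip := ip) (Dt := Dt) i v w.
Proof.
move=> hip H Dvw phi phi' Dphi.
have c1 := cvg_ipl hip (w := v) (diffq_strong hip H Dphi).
have c2 := cvgN (cvg_ipl hip (w := phi) (diffq_strong hip H Dvw)).
rewrite (ipC hip); apply: (cvg_unique _ c1) => //.
rewrite (_ : (fun n => ip _ v) = (fun n => - ip (diffq (S := S) n i v) phi)); first exact: c2.
by apply/funext => n; rewrite (ipC hip) (dc_Dskew (diffq_clifford hip H n)) opprK.
Qed.

Section nabla_operator.
Variable R : realType.
Notation R1 := (measurableTypeR R).
Notation R3 := (R1 * R1 * R1)%type.
Notation mu := (@lebesgue3 R).
Notation V := (realL2 mu).
Notation H := (quat R).
Implicit Types (u v w : V) (i : 'I_3) (k : 'I_4) (p q : 'I_3 -> V).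

Let hip := @rip_hilbert _ _ R mu.

Lemma L2_clifford : clifford_calculus (@rip _ _ R mu) (fun i => lmul (eE R i))
  (fun i t => trans (t *: bB R i)) (@Dt R).
Proof.
split.
- by move=> i; exact: lmul_lin.
- by move=> i u v; rewrite lmul_adj conj_eE lmulN (ipNr hip).
- by move=> i j u; rewrite !lmul_lmul -lmulD eE_clifford lmul_real.
- by move=> i t; exact: trans_lin.
- by move=> i t u v; rewrite trans_adj scaleNr.
- by move=> i s t u; rewrite trans_trans scalerDl.
- by move=> i u; rewrite scale0r trans0.
- by move=> i j s t u; rewrite !trans_trans addrC.
- by move=> i j t u; rewrite trans_lmul.
- exact: Dt_subspace.
- exact: Dt_total.
- by move=> i t v w; exact: Dt_trans.
- exact: Dt_taylor.
Qed.

Notation wd i v w := (weak_deriv (bB R i) v w).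

Lemma wd_uniq i v w w' : wd i v w -> wd i v w' -> w = w'.
Proof. by move=> /weakdP a /weakdP b; exact: (weakd_uniq hip L2_clifford a b). Qed.

Lemma pderivE i v w : wd i v w -> pderiv (bB R i) v = w.
Proof. by move=> vw; apply: (wd_uniq _ vw); exact: (xgetPex 0 (ex_intro _ w vw)). Qed.

Definition nab p : V := \sum_i lmul (eE R i) (p i).

Lemma pdom_nablaP v : pdom (nabla R) v <-> exists p, forall i, wd i v (p i).
Proof.
split=> [h|[p vp] u].
  have /choice[p vp] : forall i, exists w, wd i v w by move=> i; exact: h (bB_dir R i).
  by exists p.
rewrite !inE => /or3P[] /eqP ->; [exists (p ord0); exact: (vp ord0)| |exists (p ord_max); exact: (vp ord_max)].
by have i1 : (1 < 3)%N by []; exists (p (Ordinal i1)); exact: (vp (Ordinal i1)).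
Qed.

Lemma nablaE v p : (forall i, wd i v (p i)) -> papp (nabla R) v = nab p.
Proof.
have i1 : (1 < 3)%N by [].
move=> vp; rewrite /= (pderivE (vp ord0)) (pderivE (vp (Ordinal i1))) (pderivE (vp ord_max)).
rewrite /nab !big_ord_recl big_ord0 addr0 addrA; congr (_ + lmul _ (p _) + lmul _ (p _));
  exact: val_inj.
Qed.

Lemma nabla_symmetric v w : pdom (nabla R) v -> pdom (nabla R) w ->
  rip (papp (nabla R) v : V) w = rip v (papp (nabla R) w : V).
Proof.
move=> /pdom_nablaP[p vp] /pdom_nablaP[q wq]; rewrite (nablaE vp) (nablaE wq).
have [U [UU Uoo]] := ultraFilterLemma eventually_filter.
apply: (nabla_sym hip L2_clifford UU Uoo) => i; exact/weakdP.
Qed.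

Lemma co_sum k (F : 'I_4 -> H) : co k (\sum_j F j) = \sum_j co k (F j).
Proof. by rewrite !sum4 !coD. Qed.

(** The matrix of right multiplication by [a]. It mixes components with constant coefficients, so
    the componentwise form of weak derivatives is compatible with it. *)
Definition coef k (a : H) (j : 'I_4) : R := co k (ofco (fun m => (m == j)%:R) * a).

Lemma co_mulr k (q a : H) : co k (q * a) = \sum_j coef k a j * co j q.
Proof.
have {1}-> : q = \sum_j co j q *: ofco (fun m => (m == j)%:R).
  apply: coP => m; rewrite co_sum (bigD1 m)//= coZ co_ofco eqxx mulr1 big1 ?addr0// => j jm.
  by rewrite coZ co_ofco eq_sym (negPf jm) mulr0.
by rewrite mulr_suml co_sum; apply: eq_bigr => j _; rewrite -scaleqAl coZ mulrC.
Qed.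

Lemma Rintegral_rlin k (psi : R3 -> R) u v v' (a : H) : psi \in Lfun mu 2%:E ->
  (\forall x \ae mu, L2_fun u x = L2_fun v x * a + L2_fun v' x) ->
  \int[mu]_x (co k (L2_fun u x) * psi x) =
  \sum_j coef k a j * \int[mu]_x (co j (L2_fun v x) * psi x) +
  \int[mu]_x (co k (L2_fun v' x) * psi x).
Proof.
move=> psiL uE.
have iv j := Lfun2_mul_integrable (co_L2 j v) psiL.
have iZ j := integrableZl measurableT (coef k a j) (iv j).
pose F j (x : R3) := coef k a j * (co j (L2_fun v x) * psi x).
have iF j : mu.-integrable setT (EFin \o F j) by exact: iZ.
have iS : mu.-integrable setT (EFin \o (fun x => \sum_j F j x)).
  rewrite (_ : _ \o _ = (fun x => \sum_(j < 4) (EFin \o F j) x)%E).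
    exact: integrable_sum.
  by apply/funext => x /=; rewrite sumEFin.
have iv' := Lfun2_mul_integrable (co_L2 k v') psiL.
have iD : mu.-integrable setT (EFin \o (fun x => \sum_j F j x + co k (L2_fun v' x) * psi x)).
  by have := integrableD measurableT iS iv'.
have e j : coef k a j * \int[mu]_x (co j (L2_fun v x) * psi x) = \int[mu]_x F j x.
  by rewrite -RintegralZl//; exact: iv.
rewrite (eq_bigr _ (fun j _ => e j)).
rewrite -(Rintegral_sum iF) -RintegralD//.
congr fine; apply: ae_eq_integral => //.
- by have /measurable_int := Lfun2_mul_integrable (co_L2 k u) psiL.
- exact: measurable_int iD.
apply: aeS uE => x -> _ /=.
by rewrite coD mulrDl co_mulr mulr_suml; congr ((_ + _)%:E); apply: eq_bigr => j _; rewrite /F mulrA.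
Qed.

Lemma realL2_rlinE (a : H) v v' :
  \forall x \ae mu, L2_fun ((v : L2 mu) <* a + v' : V) x = L2_fun v x * a + L2_fun v' x.
Proof. by apply: aeS (aeI (realL2_addE ((v : L2 mu) <* a : V) v') (L2_rmulE a v)) => x [-> ->]. Qed.

Lemma wd_rlin i (a : H) v w v' w' : wd i v w -> wd i v' w' ->
  wd i ((v : L2 mu) <* a + v' : V) ((w : L2 mu) <* a + w' : V).
Proof.
move=> /weak_derivP vw /weak_derivP vw'; apply/weak_derivP => k phi tphi.
have L1 := test_Lfun2 tphi; have L2 := test_Lfun2 (test_derive (bB_dir R i) tphi).
rewrite (Rintegral_rlin k L1 (realL2_rlinE a w w')).
rewrite (Rintegral_rlin k L2 (realL2_rlinE a v v')).
rewrite vw'// opprD -sumrN; congr (_ + _); apply: eq_bigr => j _.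
by rewrite vw// mulrN.
Qed.

Lemma lmul_rlin (q a : H) v v' :
  lmul q ((v : L2 mu) <* a + v' : V) = (lmul q v : L2 mu) <* a + lmul q v' :> V.
Proof.
apply: (@L2_eqP _ _ _ mu).
have := aeI (aeI (lmulE q v) (lmulE q v'))
  (aeI (realL2_rlinE a (lmul q v) (lmul q v')) (aeI (realL2_rlinE a v v') (lmulE q ((v : L2 mu) <* a + v' : V)))).
by apply: aeS => x [[e1 e2] [-> [e3 ->]]]; rewrite e3 e1 e2 mulrDr mulrA.
Qed.

Lemma nabla_rlin (a : H) (v v' : L2 mu) : pdom (nabla R) v -> pdom (nabla R) v' ->
  pdom (nabla R) (v <* a + v') /\
  papp (nabla R) (v <* a + v') = papp (nabla R) v <* a + papp (nabla R) v'.
Proof.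
move=> /pdom_nablaP[p vp] /pdom_nablaP[p' vp'].
have d i := wd_rlin a (vp i) (vp' i).
split; first by apply/pdom_nablaP; exists (fun i => (p i : L2 mu) <* a + p' i).
rewrite (nablaE d) (nablaE vp) (nablaE vp') /nab.
rewrite /rscale [X in X + _]scaler_sumr -big_split/=.
by apply: eq_bigr => i _; rewrite -lmul_rlin.
Qed.

End nabla_operator.

(** Meant for [z = T v] and [y = T z] with [T] symmetric. Here [b] stands for the square of the norm
    of Im(s), and [ip w v] equals [|z - a v|^2 + b |v|^2]. *)
Lemma quadratic_coercive (R : realType) (V : lmodType R) (ip : V -> V -> R) (v y z : V) (a b : R) :
  hilbert_form ip -> 0 <= b -> ip y v = ip z z ->
  b ^+ 2 * ip v v <= ip (y - (2 * a) *: z + (a ^+ 2 + b) *: v) (y - (2 * a) *: z + (a ^+ 2 + b) *: v).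
Proof.
move=> hip b0 e; set w := _ + _.
have key : b * ip v v <= ip w v.
  have := ip_ge0 hip (z - a *: v).
  rewrite /w !(ipE hip) e (ipC hip v z); move: (ip z z) (ip z v) (ip v v) => p q r h.
  by rewrite -subr_ge0; apply: le_trans h _; rewrite le_eqVlt; apply/orP; left; apply/eqP; ring.
have := ip_ge0 hip v; rewrite le_eqVlt => /orP[/eqP<-|vp].
  by rewrite mulr0; exact: ip_ge0.
rewrite -(ler_pM2r vp); apply: le_trans _ (cauchy_schwarz hip w v).
rewrite -mulrA -expr2 -exprMn ler_pXn2r// nnegrE.
  by rewrite mulr_ge0// ltW.
by apply: le_trans key; rewrite mulr_ge0// ltW.
Qed.

(** * Non-real points belong to the resolvent set *)

Section resolvent.
Variable R : realType.
Notation mu := (@lebesgue3 R).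
Notation L := (L2 mu).
Notation V := (realL2 mu).
Notation H := (quat R).
Notation T := (nabla R).
Implicit Types (u v w : L) (s a : H).

Let hip := @rip_hilbert _ _ R mu.

Lemma sqr_normq s : `|s| ^+ 2 = qre s ^+ 2 + (qim1 s ^+ 2 + qim2 s ^+ 2 + qim3 s ^+ 2).
Proof.
rewrite -[`|s|]/(normq s) sqr_sqrtr; last by rewrite !addr_ge0// sqr_ge0.
by rewrite !addrA.
Qed.

Lemma QsE s v : papp (Qs T s) v = (papp T (papp T v) : V) - (2 * qre s) *: (papp T v : V) +
  (`|s| ^+ 2) *: (v : V) :> V.
Proof. by []. Qed.

Lemma Qs_rlin s a v v' : pdom (Qs T s) v -> pdom (Qs T s) v' ->
  pdom (Qs T s) (v <* a + v') /\
  papp (Qs T s) (v <* a + v') = papp (Qs T s) v <* a + papp (Qs T s) v'.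
Proof.
move=> [v1 v2] [v'1 v'2]; have [d1 e1] := nabla_rlin a v1 v'1.
have [d2 e2] := nabla_rlin a v2 v'2; split; first by split; rewrite ?e1.
have comm (t : R) u : (u <* a) <* t%:A = u <* t%:A <* a.
  rewrite /rscale !scalerA; congr (_ *: _).
  by rewrite [LHS](_ : _ = (a : H) * t%:A)// [RHS](_ : _ = (t%:A : H) * a)// mulq_algr mulr_algl.
have D (t : R) u u' : (u + u') <* t%:A = u <* t%:A + u' <* t%:A by exact: scalerDr.
have Da u u' : (u + u') <* a = u <* a + u' <* a by exact: scalerDr.
have Na u : (- u) <* a = - (u <* a) by exact: scalerN.
have E u : papp (Qs T s) u = papp T (papp T u) - papp T u <* (2 * qre s)%:A + u <* (`|s| ^+ 2)%:A.
  by [].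
rewrite !E e1 e2; move: (papp T (papp T v)) (papp T (papp T v')) => x x'.
move: (papp T v) (papp T v') => y y'.
by rewrite !D !comm opprD (addrACA (x <* a)) [LHS]addrACA !Da Na.
Qed.

Lemma Qs_coercive s v : pdom (Qs T s) v ->
  (qim1 s ^+ 2 + qim2 s ^+ 2 + qim3 s ^+ 2) ^+ 2 * rip (v : V) v <=
  rip (papp (Qs T s) v : V) (papp (Qs T s) v).
Proof.
move=> [v1 v2]; rewrite QsE sqr_normq; 
apply: quadratic_coercive => //; first by rewrite !addr_ge0// sqr_ge0.
exact: nabla_symmetric.
Qed.

Lemma nonreal_resolvent s : qim1 s ^+ 2 + qim2 s ^+ 2 + qim3 s ^+ 2 != 0 -> rho_S T s.
Proof.
move=> bn0; set b := _ + _ + _ in bn0 *.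
have b0 : 0 <= b by rewrite !addr_ge0// sqr_ge0.
have bp : 0 < b by rewrite lt_neqAle eq_sym bn0.
have inj v v' : pdom (Qs T s) v -> pdom (Qs T s) v' ->
    papp (Qs T s) v = papp (Qs T s) v' -> v = v'.
  move=> dv dv' e; have [] := Qs_rlin (- 1) dv' dv.
  rewrite -e /rscale !scaleN1r [X in _ = X]addNr => d e0; have := Qs_coercive d.
  rewrite e0 (ip0l hip) pmulr_rle0 ?exprn_gt0// => h.
  apply/eqP; rewrite -subr_eq0 addrC; apply/eqP/(ip_eq0 hip).
  by apply/le_anti; rewrite h (ip_ge0 hip).
have ex w : exists v, pdom (Qs T s) v /\ papp (Qs T s) v = w.
  have [U [UU Uoo]] := ultraFilterLemma eventually_filter.
  (* [nabla_solve] takes the norm of Im(s), while [b] is its square. *)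
  have sb : Num.sqrt b != 0 by rewrite gt_eqF// sqrtr_gt0.
  have [v [p [q [vp zq e]]]] := nabla_solve hip (@L2_clifford R) UU Uoo (qre s) w sb.
  have {}vp i : weak_deriv (bB R i) v (p i) by apply/weakdP.
  have {}zq i : weak_deriv (bB R i) (nab p) (q i) by apply/weakdP.
  exists v; have e1 := nablaE vp; have e2 := nablaE zq; split.
    by split; apply/pdom_nablaP; [exists p|rewrite e1; exists q].
  by rewrite QsE e1 e2 sqr_normq -e sqr_sqrtr.
have /choice[B BP] := ex.
(* [B] is merely chosen pointwise; injectivity of Q_s forces it to be linear, and a left inverse as
   well. *)
have Blin : linear (B : L -> L).
  move=> a w w'; have [d1 e1] := BP w; have [d2 e2] := BP w'.
  have [d e] := Qs_rlin a d1 d2; have [d3 e3] := BP (a *: w + w').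
  apply: (inj _ _ d3 d); apply: etrans e3 _; apply/esym; apply: etrans e _.
  by congr (_ + _); [congr (_ *: _)|].
pose BL := GRing.isLinear.Build _ _ _ _ B Blin.
pose Bl : {linear L -> L} := HB.pack B BL.
exists Bl; split.
  exists b^-1 => w; have [d e] := BP w.
  have n0 (u : L) : 0 <= qnorm u by exact: sqrtr_ge0.
  have := Qs_coercive d; rewrite !rip_norm e -exprMn ler_pXn2r ?nnegrE ?mulr_ge0// => h.
  by rewrite mulrC ler_pdivlMr// mulrC.
split=> [w|v dv]; first exact: BP.
by have [d e] := BP (papp (Qs T s) v); apply: inj.
Qed.

End resolvent.

(** * Approximate eigenvectors *)

(** Meant for [v = B w], [z = A v] and [x = A w] with [A] symmetric and [A (A v) = w]. The bound of
    [v] gives [|z|^2 <= C |w|^2], which is inserted into [|w|^2 <= |z| |x|]. *)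
Lemma resolvent_bound_below (R : realType) (V : lmodType R) (ip : V -> V -> R) (v w z x : V) (C : R) :
  hilbert_form ip -> 0 <= C -> ip z z = ip w v -> ip w w = ip z x ->
  ip v v <= C ^+ 2 * ip w w -> ip w w <= C * ip x x.
Proof.
move=> hip C0 ez ew hv.
have p0 := ip_ge0 hip; have := p0 w; rewrite le_eqVlt => /orP[/eqP<-|wp].
  by rewrite mulr_ge0.
have hz : ip z z <= C * ip w w.
  rewrite -(@ler_pXn2r _ 2)// ?nnegrE ?mulr_ge0// ?(ltW wp)//.
  rewrite {1}ez; apply: le_trans (cauchy_schwarz hip w v) _.
  by rewrite exprMn expr2 mulrCA ler_pM2l// mulrC -expr2.
rewrite -(ler_pM2r wp) -expr2 {1}ew.
apply: le_trans (cauchy_schwarz hip z x) _.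
by rewrite mulrAC ler_wpM2r.
Qed.

Lemma scaler_square (R : realType) (V : lmodType R) (r : R) (x y z : V) :
  x - r *: y - r *: (y - r *: z) = x - (2 * r) *: y + (r ^+ 2) *: z.
Proof.
rewrite scalerBr opprB scalerA -expr2 addrA addrAC; congr (_ + _).
by rewrite mulr_natl mulr2n scalerDl opprD addrA.
Qed.

Section approximate_eigenvectors.
Variable R : realType.
Notation T3 := (R * R * R)%type.
Notation mu := (@lebesgue3 R).
Notation L := (L2 mu).
Notation V := (realL2 mu).
Notation H := (quat R).
Notation T := (nabla R).
Notation dirs := [:: @b1 R; @b2 R; @b3 R].

Let hip := @rip_hilbert _ _ R mu.

Lemma real_resolvent_bound_below (r : R) : rho_S T (r%:A : H) ->
  exists2 C, 0 <= C & forall w : V, pdom T w ->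
  rip w w <= C * rip ((papp T w : V) - r *: w) ((papp T w : V) - r *: w).
Proof.
(* The constant in [qbounded] may be negative, hence the absolute value. *)
move=> [B [[C BC] [BR _]]]; exists `|C| => // w dw.
pose v : V := B w; have [[d1 d2] e] := BR w.
pose A (u : V) : V := (papp T u : V) - r *: u.
have Asym u u' : pdom T u -> pdom T u' -> rip (A u) u' = rip u (A u').
  by move=> du du'; rewrite /A (ipDl hip) (ipNl hip) (ipZl hip) (ipDr hip) (ipNr hip) (ipZr hip)
    (nabla_symmetric du du').
have rl (u u' : V) : pdom T u -> pdom T u' -> pdom T (u' - r *: u : V) /\
    papp T (u' - r *: u : V) = (papp T u' : V) - r *: (papp T u : V) :> V.
  move=> du du'; have [da ea] := nabla_rlin ((- r)%:A) du du'.
  have N (x y : V) : x - r *: y = (y : L) <* (- r)%:A + x :> V.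
    by rewrite addrC -scaleNr.
  by rewrite !N.
(* [v] and [T v] lie in the domain, so [A v] does too and [A] can be applied and moved once more. *)
have [dz ez] := rl _ _ d1 d2.
have wE : A (A v) = w.
  rewrite /A ez -[RHS]e QsE sqr_normq /= mulr1 mulr0 expr0n /= !addr0.
  exact: scaler_square.
apply: (@resolvent_bound_below _ _ _ v w (A v) (A w) `|C| hip) => //.
- by rewrite -{1}Asym// wE.
- by rewrite -Asym// wE.
rewrite !rip_norm -exprMn ler_pXn2r ?nnegrE ?mulr_ge0 ?sqrtr_ge0//.
by apply: le_trans (BC w) _; rewrite ler_wpM2r ?ler_norm ?sqrtr_ge0.
Qed.

(* exp (- e1 r x1), which satisfies nabla (wave r) = r (wave r). *)
Definition wave (r : R) (x : T3) : H := Quat (cos (r * pr ord0 x)) (- sin (r * pr ord0 x)) 0 0.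

Lemma smooth1_cos : smooth1 (@cos R).
Proof.
exists (fun n t => cos (t + n%:R * (pi / 2))).
  by apply/funext => t; rewrite mul0r addr0.
move=> n t; have d : is_derive t 1 (fun t : R => t + n%:R * (pi / 2)) 1.
  by apply: is_derive_eq; rewrite addr0.
have := @is_derive1_comp R (@cos R) (fun t : R => t + n%:R * (pi / 2)) t _ _ (is_derive_cos _) d.
move=> h; apply: is_derive_eq h _.
have -> : t + n.+1%:R * (pi / 2) = t + n%:R * (pi / 2) + pi / 2.
  by rewrite -addrA -natr1; ring.
by rewrite mulr1 cosDpihalf.
Qed.

(** With both components written as shifted cosines, one computation for an arbitrary phase covers
    smoothness and derivatives. *)
Lemma wave_cos r x : wave r x =
  Quat (cos (r * pr ord0 x + 0)) (cos (r * pr ord0 x + pi / 2)) 0 0.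
Proof. by rewrite /wave addr0 cosDpihalf. Qed.

Lemma smooth_wave r k : smooth (co k \o wave r).
Proof.
have h d : smooth (fun x : T3 => cos (r * pr ord0 x + d)).
  by move=> n; have := @Cn_pr _ n ord0 _ (smooth1_affine r d smooth1_cos); congr Cn.
have e q : co q \o wave r = (fun x => nth 0 [:: cos (r * pr ord0 x + 0);
    cos (r * pr ord0 x + pi / 2); 0; 0] q).
  by apply/funext => x; rewrite /= wave_cos.
move: k; apply: ord4P; rewrite e /= ?inordK//;
  by move=> n; exact: Cn_cst.
Qed.

Lemma derive_wave r k (u x : T3) : u \in dirs ->
  'D_u (co k \o wave r) x = - (r * pr ord0 u) * co k (e1 * wave r x).
Proof.
move=> ud.
have da d : is_derive (pr ord0 x) 1 (fun t : R => r * t + d) r.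
  apply: is_derive_eq; by rewrite addr0 [_ *: _]mulr1.
have dc d : is_derive x u (fun x : T3 => cos (r * pr ord0 x + d))
    (- (r * pr ord0 u) * sin (r * pr ord0 x + d)).
  have := @is_derive1_comp R (@cos R) (fun t : R => r * t + d) _ _ _ (is_derive_cos _) (da d).
  by move=> /derive_pr /(_ ud) h; apply: is_derive_eq h _; ring.
have e q : co q \o wave r = (fun x => nth 0 [:: cos (r * pr ord0 x + 0);
    cos (r * pr ord0 x + pi / 2); 0; 0] q).
  by apply/funext => y; rewrite /= wave_cos.
move: k; apply: ord4P; rewrite e /= ?inordK//.
- by rewrite (derive_val (is_derive := dc 0)) /co/= addr0; ring.
- by rewrite (derive_val (is_derive := dc (pi / 2))) sinDpihalf /co/=; ring.
- by rewrite derive_cst /co /= inordK//=; ring.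
- by rewrite derive_cst /co /= inordK//=; ring.
Qed.

Lemma norm_wave r x : `|wave r x| = 1.
Proof.
rewrite -[LHS]/(normq _) /normq /= sqrrN cos2Dsin2 expr0n /= !addr0.
exact: sqrtr1.
Qed.

Definition packet r n (x : T3) : H := cutoff n x *: wave r x.

Lemma co_packet r n k : co k \o packet r n = (fun x => (co k \o wave r) x * cutoff n x).
Proof. by apply/funext => x; rewrite /= coZ mulrC. Qed.

Lemma packet_test r n : qtest (packet r n).
Proof. by move=> k; rewrite co_packet; apply: test_mul; [exact: smooth_wave|exact: (cutoff_test R n)]. Qed.

Lemma dq_packet r n (u x : T3) : u \in dirs -> dq u (packet r n) x =
  'D_u (cutoff n) x *: wave r x - (r * pr ord0 u * cutoff n x) *: (e1 * wave r x).
Proof.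
move=> ud; apply: coP => k; rewrite co_ofco co_packet coB !coZ.
have d1 := smooth_is_derive x ud (smooth_wave r k).
have d2 := smooth_is_derive x ud (smooth_cutoff R n).
rewrite (derive_val (is_derive := is_deriveM d1 d2)) derive_wave// /GRing.scale /=.
by ring.
Qed.

Lemma scaleqAr (t : R) (p q : H) : t *: (p * q) = p * (t *: q).
Proof. by apply: quatP => /=; ring. Qed.

Lemma packet_eq r n (x : T3) :
  \sum_i eE R i * dq (bB R i) (packet r n) x - r *: packet r n x =
  \sum_i 'D_(bB R i) (cutoff n) x *: (eE R i * wave r x).
Proof.
under eq_bigr => i _.
  rewrite (dq_packet _ _ _ (bB_dir R i)) mulrBr -!scaleqAr.
  over.
rewrite /= sumrB -addrA -[RHS]addr0; congr (_ + _).
(* Only the first direction contributes here, and [e1 * e1 = -1] turns its term into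
   [r *: packet r n x], which cancels. *)
rewrite !big_ord_recl big_ord0 /=.
by apply: quatP; rewrite /eE /pr /packet /=; ring.
Qed.

Lemma norm_co k (q : H) : `|co k q| <= `|q|.
Proof.
rewrite -(@ler_pXn2r _ 2)// ?nnegrE// real_normK ?num_real// sqr_normq.
move: k; apply: ord4P; rewrite /co /= ?inordK//=;
  have := (sqr_ge0 (qre q), sqr_ge0 (qim1 q), sqr_ge0 (qim2 q), sqr_ge0 (qim3 q));
  by move=> [[[]]]; lra.
Qed.

Lemma packet_residual_le (K : R) r n k (x : T3) :
  (forall u y, u \in dirs -> `|'D_u (cutoff n) y| <= K) ->
  `|co k (\sum_i 'D_(bB R i) (cutoff n) x *: (eE R i * wave r x))| <= 3 * K.
Proof.
move=> hK; apply: le_trans (norm_co _ _) _; apply: le_trans (ler_norm_sum _ _ _) _.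
rewrite (_ : 3 * K = \sum_(i < 3) K); last by rewrite sumr_const card_ord mulr_natl.
apply: ler_sum => i _.
rewrite -[leLHS]/(normq _) normqZ normqM -[normq (wave _ _)]/(`|wave r x|) norm_wave mulr1.
rewrite (_ : normq _ = 1); first by rewrite mulr1 hK// bB_dir.
case: i => [[|[|[|?]]]] // hi; rewrite /normq /eE /= !expr0n /= expr1n ?addr0 ?add0r;
  exact: sqrtr1.
Qed.

End approximate_eigenvectors.

(** * Real points belong to the S-spectrum *)

Section real_spectrum.
Variable R : realType.
Notation T3 := (R * R * R)%type.
Notation R1 := (measurableTypeR R).
Notation R3 := (R1 * R1 * R1)%type.
Notation mu := (@lebesgue3 R).
Notation V := (realL2 mu).
Notation H := (quat R).
Notation T := (nabla R).

Let hip := @rip_hilbert _ _ R mu.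

Lemma sqint_box_ge (f : R3 -> R) M N : 0 <= N -> 0 <= M ->
  (forall x : T3, `|x| <= N -> M <= f x) -> measurable_fun setT f ->
  ((M ^+ 2 * (2 * N) ^+ 3)%:E <= sqint mu f)%E.
Proof.
move=> N0 M0 fM mf; have mb := measurable_box N.
apply: (@le_trans _ _ (\int[mu]_x ((M ^+ 2)%:E * (\1_(box N) x)%:E))%E).
  rewrite ge0_integralZl//; last 2 first.
  - by apply/measurable_EFinP; exact: measurable_indic.
  - by rewrite lee_fin sqr_ge0.
  by rewrite integral_indic// setIT mu_box// -EFinM.
apply: ge0_le_integral => //.
- by move=> x _; rewrite -EFinM lee_fin mulr_ge0 ?sqr_ge0.
- by apply: emeasurable_funM => //; apply/measurable_EFinP; exact: measurable_indic.
- exact: measurable_sq.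
- move=> x _; rewrite -EFinM lee_fin indicE.
  have [/set_mem/boxP xN|_] := boolP (x \in _); last by rewrite mulr0 sqr_ge0.
  by rewrite mulr1 ler_pXn2r ?nnegrE// ?fM// (le_trans M0)// fM.
Qed.

Lemma nab_ae (p : 'I_3 -> V) :
  \forall x \ae mu, L2_fun (nab p) x = \sum_i eE R i * L2_fun (p i) x.
Proof.
rewrite /nab !big_ord_recl big_ord0 addr0.
set a := lmul _ _; set b := lmul _ _; set c := lmul _ _.
have h1 := aeI (realL2_addE a (b + c)) (realL2_addE b c).
have h2 := aeI (lmulE (eE R ord0) (p ord0)) (aeI (lmulE _ _ : \forall x \ae mu, L2_fun b x = _)
  (lmulE _ _ : \forall x \ae mu, L2_fun c x = _)).
apply: aeS (aeI h1 h2) => x [[-> ->] [-> [-> ->]]].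
by rewrite !big_ord_recl big_ord0 addr0.
Qed.

Variable r : R.

Lemma packet_L2 n : (packet r n : R3 -> H) \in qL2 mu.
Proof. exact: qtest_L2 (packet_test r n). Qed.

Definition vpacket n : V := L2_class (packet_L2 n).

Definition dpacket n i : V := L2_class (qtest_L2 (qtest_dq (bB_dir R i) (packet_test r n))).

Lemma vpacket_weak n i : weak_deriv (bB R i) (vpacket n) (dpacket n i).
Proof.
apply/weakdP; apply: (Dt_weakd hip (L2_clifford R)).
by exists (packet r n); split; [exact: packet_test|exact: L2_classE|exact: L2_classE].
Qed.

Lemma vpacket_norm_ge n :
  ((flat (1 : {poly R}) 1 ^+ 2) ^+ 3) ^+ 2 * (2 * n.+1%:R) ^+ 3 <= rip (vpacket n) (vpacket n).
Proof.
have pL := packet_L2 n.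
have e : \forall x \ae mu, L2_fun (vpacket n) x = packet r n x := L2_classE (packet_L2 n).
rewrite (ripE pL pL e e) -lee_fin.
rewrite /Rintegral fineK; last first.
  by apply: integrable_fin_num => //; exact: qdot_integrable.
have -> : (\int[mu]_x (qdot (packet r n x) (packet r n x))%:E = sqint mu (cutoff n))%E.
  apply: eq_integral => x _; congr (_%:E); rewrite /packet /qdot /=.
  by rewrite -[RHS]mulr1 -(cos2Dsin2 (r * pr ord0 x)); ring.
apply: sqint_box_ge => //.
- by rewrite exprn_ge0// exprn_ge0// flat_ge0.
- by move=> x; exact: cutoff_ge.
- exact: continuous_measurable3 (CnW (smooth_cutoff R n 0%N)).
Qed.

(** Four components, each at most [3 * K] in modulus and supported in the box of half-side
    [2 * n.+1]. *)
Lemma vpacket_residual_le K n :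
  (forall (u y : T3), u \in [:: @b1 R; @b2 R; @b3 R] -> `|'D_u (cutoff n) y| <= K) ->
  rip (nab (dpacket n) - r *: vpacket n) (nab (dpacket n) - r *: vpacket n) <=
  4 * ((3 * K) ^+ 2 * (2 * (2 * n.+1%:R)) ^+ 3).
Proof.
move=> hK.
pose G (x : R3) := \sum_i eE R i * dq (bB R i) (packet r n) x - r *: packet r n x.
have GL : G \in qL2 mu.
  rewrite (_ : G = \sum_i (fun x => eE R i * dq (bB R i) (packet r n) x) -
                   (fun x => r *: packet r n x)).
    apply: rpredB; last exact: qL2Z (packet_L2 n).
    apply: rpred_sum => i _; apply: qL2_mull.
    exact: qtest_L2 (qtest_dq (bB_dir R i) (packet_test r n)).
  by apply/funext => x; rewrite /G [RHS]/GRing.add /= fct_sumE.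
have GE : \forall x \ae mu, L2_fun (nab (dpacket n) - r *: vpacket n) x = G x.
  have e i : \forall x \ae mu, L2_fun (dpacket n i) x = dq (bB R i) (packet r n) x.
    exact: L2_classE.
  have h1 := aeI (e ord0) (aeI (e (lift ord0 ord0)) (e (lift ord0 (lift ord0 ord0)))).
  have h2 := aeI (rscaleL2E r (vpacket n)) (L2_classE (packet_L2 n)).
  have h3 := aeI (L2_subE (nab (dpacket n)) (r *: vpacket n)) (nab_ae (dpacket n)).
  apply: aeS (aeI h3 (aeI h1 h2)) => x [[-> ->] [[e0 [e1 e2]] [-> ->]]].
  by rewrite /G !big_ord_recl !big_ord0 e0 e1 e2.
rewrite (ripE GL GL GE GE) -lee_fin (sqint_qdot GL).
rewrite [X in (_ <= X%:E)%E](_ : _ = \sum_(k < 4) (3 * K) ^+ 2 * (2 * (2 * n.+1%:R)) ^+ 3); last first.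
  by rewrite sumr_const card_ord mulr_natl.
rewrite -sumEFin; apply: lee_sum => k _.
have GE' x : G x = \sum_i 'D_(bB R i) (cutoff n) x *: (eE R i * wave r x).
  exact: packet_eq.
apply: sqint_box_le => //.
- by move=> x /=; rewrite GE'; exact: packet_residual_le.
- move=> x xn /=; rewrite GE' big1 ?co0// => i _.
  by rewrite (derive_eq0 _ (@cutoff_eq0 R n))// scale0r.
- by have /qL2_co/(_ k)/Lfun2_measurable := GL.
Qed.

Lemma real_not_resolvent : ~ rho_S T (r%:A : H).
Proof.
move=> /real_resolvent_bound_below[C C0 hC].
have [K K0 hK] := derive_cutoff_le R.
set c := ((flat (1 : {poly R}) 1 ^+ 2) ^+ 3) ^+ 2.
have c0 : 0 < c by rewrite !exprn_gt0// flat_gt0.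
(* The two estimates compare [8 * c * N ^+ 3] with [C * 4 * 9 * K ^+ 2 * 64 * N]. Dividing by
   [8 * c * N] gives [N ^+ 2 <= D], which fails as [N > D] and [N >= 1]. *)
pose D := 288 * C * K ^+ 2 / c.
pose n := Num.bound `|D|; pose N : R := n.+1%:R.
have N0 : 0 < N by rewrite ltr0n.
have dw : pdom T (vpacket n) by apply/pdom_nablaP; exists (dpacket n) => i; exact: vpacket_weak.
have := hC _ dw; rewrite (nablaE (vpacket_weak n)) => h.
have := vpacket_norm_ge n; rewrite -/c -/N => h1.
have h2 := vpacket_residual_le (fun u y ud => hK n u y ud); rewrite -/N in h2.
have : c * (2 * N) ^+ 3 <= C * (4 * ((3 * (K / N)) ^+ 2 * (2 * (2 * N)) ^+ 3)).
  by apply: le_trans h1 _; apply: le_trans h _; rewrite ler_wpM2l.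
rewrite (_ : C * _ = (8 * N) * (c * D)); last first.
  by rewrite /D; field; rewrite !gt_eqF.
rewrite (_ : c * _ = (8 * N) * (c * N ^+ 2)); last by ring.
rewrite ler_pM2l ?mulr_gt0// ler_pM2l// leNgt => /negP; apply.
have DN : D < N.
  apply: le_lt_trans (ler_norm _) _; apply: lt_le_trans (archi_boundP (normr_ge0 D)) _.
  by rewrite ler_nat.
by apply: lt_le_trans DN _; rewrite expr2 ler_peMr ?ler1n// ltW.
Qed.

End real_spectrum.

Theorem theorem5p1 (R : realType) :
  sigma_S (nabla R) = range (fun r : R => r%:A : quat R).
Proof.
apply/seteqP; split=> [s s_sp|_ [r _ <-]]; last exact: real_not_resolvent.
have [|/nonreal_resolvent//] := eqVneq (qim1 s ^+ 2 + qim2 s ^+ 2 + qim3 s ^+ 2) 0.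
move=> /eqP; rewrite !paddr_eq0 ?addr_ge0 ?sqr_ge0// !sqrf_eq0.
move=> /andP[/andP[/eqP s1 /eqP s2] /eqP s3].
by exists (qre s) => //; apply: quatP; rewrite /= ?s1 ?s2 ?s3; ring.
Qed.
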